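(* Let $k$ be a constant and consider the three-dimensional homogeneous cylindrical Helmholtz equation $$u_{rr}+\frac{1}{r}u_r+\frac{1}{r^2}u_{\theta\theta}+u_{zz}+k^2u=0$$ for a function $u=u(r,\theta,z)$. The complete set of infinitesimal generators of the point symmetry group of this equation consists of the vector fields $$v=\xi^1\frac{\partial}{\partial r}+\xi^2\frac{\partial}{\partial\theta}+\xi^3\frac{\partial}{\partial z}+\eta\frac{\partial}{\partial u}$$ with $$\xi^1=(c_1z+c_3)\sin\theta+(c_2z+c_4)\cos\theta,$$ $$\xi^2=-\frac1r(c_2z+c_4)\sin\theta+\frac1r(c_1z+c_3)\cos\theta+c_5,$$ $$\xi^3=-r(c_1\sin\theta+c_2\cos\theta)+c_6,$$ $$\eta=\exp(-\sqrt{c_3}\,z-\sqrt{c_2}\,\theta)\big(c_7\exp(2\sqrt{c_2}\,\theta)+c_8\big)\big(c_9\exp(2\sqrt{c_3}\,z)+c_{10}\big)\Big(c_{11}\,\mathrm{BY}(\sqrt{-c_2},\sqrt{c_3+k^2}\,r)+c_{12}\,\mathrm{BJ}(\sqrt{-c_2},\sqrt{c_3+k^2}\,r)\Big)+c_{13}u,$$ where $c_1,\dots,c_{13}$ are arbitrary constants. It is a seven-dimensional Lie algebra $\mathfrak g$, with basis $$X_1=\partial_\theta,\quad X_2=\partial_z,\quad X_3=u\,\partial_u,\quad X_4=\sin\theta\,\partial_r+\frac{\cos\theta}{r}\partial_\theta,\quad X_5=-\cos\theta\,\partial_r+\frac{\sin\theta}{r}\partial_\theta,$$ $$X_6=-z\cos\theta\,\partial_r+\frac{z\sin\theta}{r}\partial_\theta+r\cos\theta\,\partial_z,\quad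 X_7=z\sin\theta\,\partial_r+\frac{z\cos\theta}{r}\partial_\theta-r\sin\theta\,\partial_z,$$ and commutators $$[X_1,X_4]=-X_5,\ [X_1,X_5]=X_4,\ [X_1,X_6]=X_7,\ [X_1,X_7]=-X_6,\ [X_2,X_6]=X_5,\ [X_2,X_7]=X_4,$$ $$[X_4,X_7]=-X_2,\ [X_5,X_6]=-X_2,\ [X_6,X_7]=X_1,$$ all other commutators $[X_i,X_j]$ with $i<j$ being zero.
   Context: Write $x=(x_1,x_2,x_3)=(r,\theta,z)$. A vector field $v=\sum_{i=1}^3\xi^i(x,u)\partial_{x_i}+\eta(x,u)\partial_u$ with smooth coefficients is an infinitesimal generator of the point symmetry group (infinitesimal symmetry) of the equation $\Delta:=u_{rr}+\frac1r u_r+\frac1{r^2}u_{\theta\theta}+u_{zz}+k^2u=0$ if $v^{(2)}(\Delta)=0$ whenever $\Delta=0$. Here $v^{(2)}=v+\sum_{1\le \#J\le 2}\widehat\eta_J\,\partial_{u_J}$ is the second prolongation of $v$ to the jet space $J^2(\mathbb R^3,\mathbb R)$, with $\widehat\eta_J=D_J(Q)+\sum_{i=1}^3\xi^i u_{J,i}$, $Q=\eta-\sum_{i=1}^3\xi^i u_i$, and $D_J$ the total derivative with respect to the variables indicated by the multi-index $J$. $\mathrm{BJ}(\nu,y)$ and $\mathrm{BY}(\nu,y)$ denote the Bessel functions of the first and second kind of order $\nu$ at argument $y$. The commutator is $[X_i,X_j]=X_iX_j-X_jX_i$. The paper obtains the basis $X_1,\dots,X_7$ by splitting the general form of $v$.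
   Formalization: k is real and nonzero; completeness is proved with the Bessel part of η replaced by an arbitrary solution of the equation (cos(kz)∂_u is not of the displayed form); g is the family with η = c13 u; constants giving undefined Bessel values are excluded. *)

(* Defs.v *)
(* Stdlib real numbers with Coquelicot. *)
From Stdlib Require Import Reals List Arith.
From Coquelicot Require Import Coquelicot.
Import ListNotations.
Open Scope R_scope.

(** * Functions and vector fields in the variables (r, theta, z, u) *)

Inductive indep := ir | ith | iz.
Inductive coord := dx (i : indep) | du.

Definition indep_eq_dec (i j : indep) : {i = j} + {i <> j}.
Proof. decide equality. Defined.

Definition sum_indep (F : indep -> R) : R := F ir + F ith + F iz.

(* [point] is a product, so that it carries the product topology. *)
Definition point := (R * R * R * R)%type.

Definition get (c : coord) (p : point) : R :=
  let '(r, t, z, u) := p in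
  match c with dx ir => r | dx ith => t | dx iz => z | du => u end.

Definition upd (c : coord) (p : point) (s : R) : point :=
  let '(r, t, z, u) := p in
  match c with
  | dx ir => (s, t, z, u)
  | dx ith => (r, s, z, u)
  | dx iz => (r, t, s, u)
  | du => (r, t, z, s)
  end.

Definition pd (c : coord) (f : point -> R) (p : point) : R :=
  Derive (fun s => f (upd c p s)) (get c p).

Fixpoint pds (l : list coord) (f : point -> R) : point -> R :=
  match l with
  | [] => f
  | c :: l' => pd c (pds l' f)
  end.

(* All functions are only meant on the open set r > 0; their values elsewhere
   are irrelevant. *)
Definition dom (p : point) : Prop := 0 < get (dx ir) p.

Definition smooth (f : point -> R) : Prop :=
  forall (l : list coord) (p : point), dom p ->
    continuous (pds l f) p /\
    forall c : coord, ex_derive (fun s => pds l f (upd c p s)) (get c p).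

(* The field  sum_i v (dx i) d/dx_i + v du d/du. *)
Definition vfield := coord -> point -> R.

Definition vf_eq (v w : vfield) : Prop :=
  forall (c : coord) (p : point), dom p -> v c p = w c p.

Definition act (v : vfield) (f : point -> R) (p : point) : R :=
  sum_indep (fun i => v (dx i) p * pd (dx i) f p) + v du p * pd du f p.

Definition is_commutator (v w x : vfield) : Prop :=
  forall f : point -> R, smooth f ->
  forall p : point, dom p ->
    act v (act w f) p - act w (act v f) p = act x f p.

(** * Jets and prolongation *)

(* (a, b, c) stands for the derivative taken a times in r, b times in theta
   and c times in z; its order is a + b + c. *)
Definition mindex := (nat * nat * nat)%type.

Definition mindex_eq_dec (I J : mindex) : {I = J} + {I <> J}.
Proof. repeat decide equality. Defined.

Definition mindex_incr (J : mindex) (i : indep) : mindex :=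
  let '(a, b, c) := J in
  match i with
  | ir => (S a, b, c)
  | ith => (a, S b, c)
  | iz => (a, b, S c)
  end.

Definition ind1 (i : indep) : mindex := mindex_incr (0, 0, 0)%nat i.

Definition mindices_1_2 : list mindex :=
  [(1,0,0); (0,1,0); (0,0,1);
   (2,0,0); (0,2,0); (0,0,2); (1,1,0); (1,0,1); (0,1,1)]%nat.

(* A jet carries coordinates u_J of every order. The functions below involve
   only finitely many of them, and the third order ones, which appear in
   D_J Q for #J = 2, cancel in the prolongation coefficients. *)
Record jet := mkjet { jx : indep -> R ; ju : mindex -> R }.

Definition jet_setx (j : jet) (i : indep) (s : R) : jet :=
  mkjet (fun i' => if indep_eq_dec i' i then s else jx j i') (ju j).

Definition jet_setu (j : jet) (J : mindex) (s : R) : jet :=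
  mkjet (jx j) (fun J' => if mindex_eq_dec J' J then s else ju j J').

Definition jd_x (i : indep) (F : jet -> R) (j : jet) : R :=
  Derive (fun s => F (jet_setx j i s)) (jx j i).

Definition jd_u (J : mindex) (F : jet -> R) (j : jet) : R :=
  Derive (fun s => F (jet_setu j J s)) (ju j J).

Definition sum_list (l : list mindex) (F : mindex -> R) : R :=
  fold_right Rplus 0 (map F l).

(* The sum is cut off at order 2: total derivatives are only applied to
   functions of jets of order at most 2. *)
Definition Dtot (i : indep) (F : jet -> R) (j : jet) : R :=
  jd_x i F j
  + sum_list ((0, 0, 0)%nat :: mindices_1_2)
      (fun J => ju j (mindex_incr J i) * jd_u J F j).

Definition DJ (J : mindex) (F : jet -> R) : jet -> R :=
  let '(a, b, c) := J in
  Nat.iter a (Dtot ir) (Nat.iter b (Dtot ith) (Nat.iter c (Dtot iz) F)).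

Definition base (j : jet) : point :=
  (jx j ir, jx j ith, jx j iz, ju j (0, 0, 0)%nat).

Definition charQ (v : vfield) (j : jet) : R :=
  v du (base j) - sum_indep (fun i => v (dx i) (base j) * ju j (ind1 i)).

Definition eta_hat (v : vfield) (J : mindex) (j : jet) : R :=
  DJ J (charQ v) j
  + sum_indep (fun i => v (dx i) (base j) * ju j (mindex_incr J i)).

Definition prolong2 (v : vfield) (F : jet -> R) (j : jet) : R :=
  sum_indep (fun i => v (dx i) (base j) * jd_x i F j)
  + v du (base j) * jd_u (0, 0, 0)%nat F j
  + sum_list mindices_1_2 (fun J => eta_hat v J j * jd_u J F j).

Definition helmholtz (k : R) (j : jet) : R :=
  let r := jx j ir in
  ju j (2, 0, 0)%nat + / r * ju j (1, 0, 0)%nat + / r ^ 2 * ju j (0, 2, 0)%nat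
  + ju j (0, 0, 2)%nat + k ^ 2 * ju j (0, 0, 0)%nat.

Definition inf_symmetry (k : R) (v : vfield) : Prop :=
  (forall c : coord, smooth (v c)) /\
  forall j : jet, 0 < jx j ir ->
    helmholtz k j = 0 -> prolong2 v (helmholtz k) j = 0.

(** * Solutions of the equation *)

Definition lift3 (b : R -> R -> R -> R) (p : point) : R :=
  let '(r, t, z, _) := p in b r t z.

Definition helmholtz_solution (k : R) (b : R -> R -> R -> R) : Prop :=
  smooth (lift3 b) /\
  forall p : point, dom p ->
    pds [dx ir; dx ir] (lift3 b) p
    + / get (dx ir) p * pd (dx ir) (lift3 b) p
    + / get (dx ir) p ^ 2 * pds [dx ith; dx ith] (lift3 b) p
    + pds [dx iz; dx iz] (lift3 b) p + k ^ 2 * lift3 b p = 0.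

(** * Bessel functions of complex order and argument *)

Definition Cexp (z : C) : C :=
  (exp (Re z) * cos (Im z), exp (Re z) * sin (Im z)).

Definition Ccos (z : C) : C := ((Cexp (Ci * z) + Cexp (- (Ci * z))) / 2)%C.
Definition Csin (z : C) : C := ((Cexp (Ci * z) - Cexp (- (Ci * z))) / (2 * Ci))%C.

(* Principal branches, with the argument in (-pi, pi]. *)
Definition Carg (z : C) : R :=
  if Rle_dec 0 (Im z) then acos (Re z / Cmod z) else - acos (Re z / Cmod z).

Definition Clog (z : C) : C := (ln (Cmod z), Carg z).

(* z to the complex power w, with 0^0 = 1 and 0^w = 0 for w <> 0. *)
Definition Cpower (z w : C) : C :=
  if Ceq_dec z 0 then (if Ceq_dec w 0 then 1 else 0)%C else Cexp (w * Clog z)%C.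

(* The principal complex square root of a real number: [sqrt] vanishes on
   negative numbers, so at most one of the two components is nonzero. *)
Definition csqrt (a : R) : C := (sqrt a, sqrt (- a)).

Definition Clim_seq (a : nat -> C) : C :=
  (real (Lim_seq (fun n => Re (a n))), real (Lim_seq (fun n => Im (a n)))).

Definition CSeries (a : nat -> C) : C :=
  (Series (fun n => Re (a n)), Series (fun n => Im (a n))).

Fixpoint Crising (z : C) (n : nat) : C :=
  match n with
  | O => z
  | S m => (Crising z m * (z + RtoC (INR n)))%C
  end.

(* 1 / Gamma, by Gauss's limit  z (z+1) ... (z+n) / (n! n^z). *)
Definition rGamma (z : C) : C :=
  Clim_seq (fun n =>
    (Crising z n / (RtoC (INR (fact n)) * Cpower (RtoC (INR n)) z))%C).

Definition BJ (nu y : C) : C :=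
  (Cpower (y / 2) nu *
   CSeries (fun m =>
     RtoC ((-1) ^ m / INR (fact m)) * rGamma (nu + RtoC (INR m) + 1)
     * Cpow (y / 2) (2 * m)))%C.

Definition BY_generic (nu y : C) : C :=
  ((BJ nu y * Ccos (PI * nu) - BJ (- nu) y) / Csin (PI * nu))%C.

(* The sine vanishes exactly at the integer orders, where BY is the limit of
   [BY_generic] over real non-integer orders. *)
Definition BY (nu y : C) : C :=
  if Ceq_dec (Csin (PI * nu)) 0
  then (real (Lim (fun mu => Re (BY_generic (RtoC mu) y)) (Re nu)),
        real (Lim (fun mu => Im (BY_generic (RtoC mu) y)) (Re nu)))
  else BY_generic nu y.

(** * The family of generators *)

(* In the families below [c 1], ..., [c 6], [c 13] are the real constants and
   [d 7], ..., [d 12] the complex ones; other indices are not used. *)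

Definition xi_family (c : nat -> R) (i : indep) (p : point) : R :=
  let '(r, t, z, _) := p in
  match i with
  | ir => (c 1%nat * z + c 3%nat) * sin t + (c 2%nat * z + c 4%nat) * cos t
  | ith => - (1 / r) * (c 2%nat * z + c 4%nat) * sin t
           + 1 / r * (c 1%nat * z + c 3%nat) * cos t + c 5%nat
  | iz => - r * (c 1%nat * sin t + c 2%nat * cos t) + c 6%nat
  end.

Definition eta_bessel (k c2 c3 : R) (d : nat -> C) (r t z : R) : C :=
  (Cexp (- csqrt c3 * z - csqrt c2 * t)
   * (d 7%nat * Cexp (2 * csqrt c2 * t) + d 8%nat)
   * (d 9%nat * Cexp (2 * csqrt c3 * z) + d 10%nat)
   * (d 11%nat * BY (csqrt (- c2)) (csqrt (c3 + k ^ 2) * r)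
      + d 12%nat * BJ (csqrt (- c2)) (csqrt (c3 + k ^ 2) * r)))%C.

(* The Bessel terms that occur are defined: at argument 0, BY is undefined and
   so is BJ of a nonzero imaginary order. *)
Definition bessel_defined (k c2 c3 : R) (d : nat -> C) : Prop :=
  c3 + k ^ 2 = 0 -> d 11%nat = 0%C /\ (0 < c2 -> d 12%nat = 0%C).

Definition displayed_field (k : R) (c : nat -> R) (d : nat -> C) (v : vfield)
  : Prop :=
  (forall i p, dom p -> v (dx i) p = xi_family c i p) /\
  forall r t z u : R, 0 < r ->
    RtoC (v du (r, t, z, u)) =
    (eta_bessel k (c 2%nat) (c 3%nat) d r t z + RtoC (c 13%nat * u))%C.

Definition superposed_field (c : nat -> R) (b : R -> R -> R -> R) (v : vfield)
  : Prop :=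
  (forall i p, dom p -> v (dx i) p = xi_family c i p) /\
  forall r t z u : R, 0 < r -> v du (r, t, z, u) = b r t z + c 13%nat * u.

Definition in_g (v : vfield) : Prop :=
  exists c : nat -> R, superposed_field c (fun _ _ _ => 0) v.

(** * The basis and its commutators *)

Definition X (n : nat) : vfield := fun e p =>
  let '(r, t, z, u) := p in
  match n, e with
  | 1%nat, dx ith => 1
  | 2%nat, dx iz => 1
  | 3%nat, du => u
  | 4%nat, dx ir => sin t
  | 4%nat, dx ith => cos t / r
  | 5%nat, dx ir => - cos t
  | 5%nat, dx ith => sin t / r
  | 6%nat, dx ir => - z * cos t
  | 6%nat, dx ith => z * sin t / r
  | 6%nat, dx iz => r * cos t
  | 7%nat, dx ir => z * sin t
  | 7%nat, dx ith => z * cos t / r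
  | 7%nat, dx iz => - r * sin t
  | _, _ => 0
  end.

Definition vzero : vfield := fun _ _ => 0.
Definition vopp (v : vfield) : vfield := fun e p => - v e p.

Definition lincomb (a : nat -> R) : vfield :=
  fun e p => sum_n_m (fun n => a n * X n e p) 1 7.

Definition bracket_table (m n : nat) : vfield :=
  match m, n with
  | 1%nat, 4%nat => vopp (X 5)
  | 1%nat, 5%nat => X 4
  | 1%nat, 6%nat => X 7
  | 1%nat, 7%nat => vopp (X 6)
  | 2%nat, 6%nat => X 5
  | 2%nat, 7%nat => X 4
  | 4%nat, 7%nat => vopp (X 2)
  | 5%nat, 6%nat => vopp (X 2)
  | 6%nat, 7%nat => X 1
  | _, _ => vzero
  end.

(* Main.v *)
(* Invariance is tested on the jets obtained by solving the equation for
   [u_rr], the other coordinates being free; comparing coefficients gives the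
   determining equations. They say that the base part of the field does not
   depend on [u] and is conformal for the Euclidean metric, and that
   [eta = a u + b] with [2 da] the Laplacian of the base part. The conformal
   factor [phi] is then harmonic, hence so is [a], and the remaining equation
   [lap a + 2 k^2 phi = 0] forces [phi = 0] as [k <> 0]. So the base part is a
   Killing field, [a] is constant and [b] solves the equation.

   For the Bessel part, the Gauss product converges for every complex
   argument, and the recurrence of 1 / Gamma makes the series of [BJ] a
   Frobenius solution of the radial equation. At an integer order [n], [BY] is
   the derivative at [e = 0] of a combination of the solutions of orders
   [n + e] and [- (n + e)]; it is computed from the first order expansions in
   [e], uniform in the index, of the coefficients of the two series. The
   Wronskian of two Frobenius solutions times [r] is constant, so its value at
   [r = 0] shows that [BJ] and [BY] span the solutions. *)
Require Import Defs.
From Stdlib Require Import Reals List Lra Lia Arith ZArith Classical FunctionalExtensionality.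
From Coquelicot Require Import Coquelicot.
Import ListNotations.
Open Scope R_scope.

(** * Smooth functions on the half space *)

(** The displayed eta is a single separated product and uses [c 2] and [c 3] both as Killing
    coefficients and as separation constants, so it cannot exhaust the symmetries. Completeness is
    therefore proved with an arbitrary solution [b], and the Bessel formula is recovered for
    separated solutions with free separation constants. The conformal factor is harmonic because, in
    dimension 3, cross differentiation makes the sum of any two diagonal entries of its Hessian
    vanish. The separation constants may have any sign, so orders, arguments and exponents are
    complex; complex functions are handled through their components, and a real eta is obtained by
    taking real parts. The delicate point is [BY] at integer orders, a limit of quotients of
    infinite series: limit and sum are exchanged through remainders bounded by [U * K ^ m * e ^ 2],
    which the factor 1/m! of the series makes summable. These remainders all come from the expansion
    of 1 / Gamma at 1, whose slope is Euler's constant, carried to the other integers by the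
    recurrence. *)

Lemma get_upd_same (c : coord) (p : point) (s : R) : get c (upd c p s) = s.
Proof. destruct p as [[[r t] z] u]; destruct c as [[| |]|]; reflexivity. Qed.

Lemma upd_get (c : coord) (p : point) : upd c p (get c p) = p.
Proof. destruct p as [[[r t] z] u]; destruct c as [[| |]|]; reflexivity. Qed.

Lemma upd_upd (c : coord) (p : point) (s s' : R) :
  upd c (upd c p s) s' = upd c p s'.
Proof. destruct p as [[[r t] z] u]; destruct c as [[| |]|]; reflexivity. Qed.

Lemma get_upd_other (c d : coord) (p : point) (s : R) :
  c <> d -> get d (upd c p s) = get d p.
Proof.
  destruct p as [[[r t] z] u]; destruct c as [[| |]|]; destruct d as [[| |]|];
    intro H; try reflexivity; now elim H.
Qed.

Lemma coord_eq_dec (c d : coord) : {c = d} + {c <> d}.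
Proof. repeat decide equality. Defined.

Lemma dom_upd_near (c : coord) (p : point) :
  dom p -> locally (get c p) (fun s => dom (upd c p s)).
Proof.
  unfold dom; destruct p as [[[r t] z] u]; simpl; intro H.
  destruct c as [[| |]|]; simpl; try (now apply filter_forall).
  exact (open_gt 0 r H).
Qed.

Lemma continuous_get (c : coord) (p : point) : continuous (get c) p.
Proof.
  destruct p as [[[r t] z] u]; destruct c as [[| |]|].
  - apply (continuous_ext (fun q : point => fst (fst (fst q)))).
    { now intros [[[? ?] ?] ?]. }
    apply (continuous_comp (fun q : point => fst (fst q)) fst);
      [apply (continuous_comp (fun q : point => fst q) fst)|];
      apply continuous_fst.
  - apply (continuous_ext (fun q : point => snd (fst (fst q)))).
    { now intros [[[? ?] ?] ?]. }
    apply (continuous_comp (fun q : point => fst (fst q)) snd);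
      [apply (continuous_comp (fun q : point => fst q) fst); apply continuous_fst
      |apply continuous_snd].
  - apply (continuous_ext (fun q : point => snd (fst q))).
    { now intros [[[? ?] ?] ?]. }
    apply (continuous_comp (fun q : point => fst q) snd);
      [apply continuous_fst|apply continuous_snd].
  - apply (continuous_ext (fun q : point => snd q)).
    { now intros [[[? ?] ?] ?]. }
    apply continuous_snd.
Qed.

Lemma continuous_pair (U V W : UniformSpace) (f : U -> V) (g : U -> W) (x : U) :
  continuous f x -> continuous g x -> continuous (fun y => (f y, g y)) x.
Proof.
  intros Hf Hg; apply (continuous_comp_2 f g pair); trivial.
  apply (continuous_ext (fun z => z)); [now intros []|apply continuous_id].
Qed.

Lemma continuous_point (U : UniformSpace) (h : U -> point) (x : U) :
  (forall c, continuous (fun y => get c (h y)) x) -> continuous h x.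
Proof.
  intro H.
  apply (continuous_ext
    (fun y => (get (dx ir) (h y), get (dx ith) (h y), get (dx iz) (h y), get du (h y)))).
  { intro y; now destruct (h y) as [[[r t] z] u]. }
  repeat apply continuous_pair; apply H.
Qed.

Lemma dom_near (p : point) : dom p -> locally p dom.
Proof. intro H; exact (continuous_get (dx ir) p _ (open_gt 0 _ H)). Qed.

Definition pdiff (f : point -> R) (p : point) : Prop :=
  forall c : coord, ex_derive (fun s => f (upd c p s)) (get c p).

Lemma pd_ext (c : coord) (f g : point -> R) (p : point) :
  (forall q, dom q -> f q = g q) -> dom p -> pd c f p = pd c g p.
Proof.
  intros E Hp; apply Derive_ext_loc.
  generalize (dom_upd_near c p Hp); apply filter_imp; intros s Hs; auto.
Qed.

Lemma pdiff_ext (f g : point -> R) (p : point) :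
  (forall q, dom q -> f q = g q) -> dom p -> pdiff f p -> pdiff g p.
Proof.
  intros E Hp H c; apply (ex_derive_ext_loc (fun s => f (upd c p s))); [|apply H].
  generalize (dom_upd_near c p Hp); apply filter_imp; intros s Hs; auto.
Qed.

(** Smoothness graded by order instead of by lists of coordinates: the derivative of a product is a
    sum of products of order one less, so closure properties follow by induction on [n]. *)
Fixpoint Cn (n : nat) (f : point -> R) : Prop :=
  (forall p, dom p -> continuous f p /\ pdiff f p) /\
  match n with O => True | S m => forall c, Cn m (pd c f) end.

Lemma Cn_ext (n : nat) (f g : point -> R) :
  (forall q, dom q -> f q = g q) -> Cn n f -> Cn n g.
Proof.
  revert f g; induction n as [|n IH]; intros f g E [H1 H2]; split; trivial.
  1, 2: intros p Hp; destruct (H1 p Hp) as [Hc Hd]; split;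
    [|exact (pdiff_ext f g p E Hp Hd)];
    apply (continuous_ext_loc g f p); trivial;
    generalize (dom_near p Hp); apply filter_imp; auto.
  intro c; apply (IH (pd c f)); trivial; intros q Hq; now apply pd_ext.
Qed.

Lemma Cn_S (n : nat) (f : point -> R) : Cn (S n) f -> Cn n f.
Proof.
  revert f; induction n as [|n IH]; intros f [H1 H2]; split; trivial.
  intro c; apply IH, H2.
Qed.

Lemma smooth_pd (f : point -> R) (c : coord) : smooth f -> smooth (pd c f).
Proof.
  intros H l.
  (* [pds] applies the head of the list last, so an inner derivative is appended at the end. *)
  assert (E : pds l (pd c f) = pds (l ++ [c]) f).
  { induction l as [|d l IH]; simpl; [reflexivity|now rewrite IH]. }
  rewrite E; apply H.
Qed.

Lemma smooth_Cn (f : point -> R) : smooth f <-> forall n, Cn n f.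
Proof.
  split.
  - intros H n; revert f H; induction n as [|n IH]; intros f H; split; trivial.
    1, 2: exact (H []).
    intro c; apply IH, smooth_pd, H.
  - intros H l; assert (G : forall n, Cn n (pds l f)).
    { induction l as [|c l IH]; trivial; intro n; exact (proj2 (IH (S n)) c). }
    exact (proj1 (G O)).
Qed.

Lemma smooth_cont (f : point -> R) (p : point) :
  smooth f -> dom p -> continuous f p.
Proof. intros H Hp; exact (proj1 (H [] p Hp)). Qed.

Lemma smooth_pdiff (f : point -> R) (p : point) :
  smooth f -> dom p -> pdiff f p.
Proof. intros H Hp; exact (proj2 (H [] p Hp)). Qed.

Lemma smooth_ext (f g : point -> R) :
  (forall q, dom q -> f q = g q) -> smooth f -> smooth g.
Proof.
  rewrite !smooth_Cn; intros E H n; now apply (Cn_ext n f).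
Qed.

Lemma pds_ext (l : list coord) (f g : point -> R) :
  (forall q, dom q -> f q = g q) -> forall p, dom p -> pds l f p = pds l g p.
Proof.
  intro E; induction l as [|c l IH]; simpl; trivial.
  intros p Hp; now apply pd_ext.
Qed.

Lemma pd_plus (c : coord) (f g : point -> R) (p : point) :
  pdiff f p -> pdiff g p -> pd c (fun q => f q + g q) p = pd c f p + pd c g p.
Proof. intros Hf Hg; apply Derive_plus; auto. Qed.

Lemma pd_opp (c : coord) (f : point -> R) (p : point) :
  pd c (fun q => - f q) p = - pd c f p.
Proof. exact (Derive_opp (fun s => f (upd c p s)) _). Qed.

Lemma pd_minus (c : coord) (f g : point -> R) (p : point) :
  pdiff f p -> pdiff g p -> pd c (fun q => f q - g q) p = pd c f p - pd c g p.
Proof. intros Hf Hg; apply Derive_minus; auto. Qed.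

Lemma pd_mult (c : coord) (f g : point -> R) (p : point) :
  pdiff f p -> pdiff g p ->
  pd c (fun q => f q * g q) p = pd c f p * g p + f p * pd c g p.
Proof.
  intros Hf Hg; unfold pd.
  rewrite (Derive_mult (fun s => f (upd c p s)) (fun s => g (upd c p s))); auto.
  now rewrite upd_get.
Qed.

Lemma pd_const (c : coord) (a : R) (p : point) : pd c (fun _ => a) p = 0.
Proof. exact (Derive_const a _). Qed.

Lemma pdiff_const (a : R) (p : point) : pdiff (fun _ => a) p.
Proof. intro c; apply ex_derive_const. Qed.

Lemma pdiff_plus (f g : point -> R) (p : point) :
  pdiff f p -> pdiff g p -> pdiff (fun q => f q + g q) p.
Proof.
  intros Hf Hg c; apply (ex_derive_plus (fun s => f (upd c p s))); [apply Hf|apply Hg].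
Qed.

Lemma pdiff_mult (f g : point -> R) (p : point) :
  pdiff f p -> pdiff g p -> pdiff (fun q => f q * g q) p.
Proof.
  intros Hf Hg c.
  apply (ex_derive_mult (fun s => f (upd c p s)) (fun s => g (upd c p s)));
    [apply Hf|apply Hg].
Qed.

Lemma Cn_const (n : nat) (a : R) : Cn n (fun _ => a).
Proof.
  revert a; induction n as [|n IH]; intro a; split; trivial.
  1, 2: intros p _; split; [apply continuous_const|apply pdiff_const].
  intro c; apply (Cn_ext n (fun _ => 0)); trivial.
  intros q _; now rewrite pd_const.
Qed.

Lemma Cn_plus (n : nat) (f g : point -> R) :
  Cn n f -> Cn n g -> Cn n (fun p => f p + g p).
Proof.
  revert f g; induction n as [|n IH]; intros f g [F1 F2] [G1 G2]; split; trivial.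
  1, 2: intros p Hp; destruct (F1 p Hp), (G1 p Hp); split;
    [now apply (continuous_plus f g)|now apply pdiff_plus].
  intro c; apply (Cn_ext n (fun p => pd c f p + pd c g p)); auto.
  intros q Hq; symmetry; apply pd_plus; [apply F1|apply G1]; trivial.
Qed.

Lemma Cn_mult (n : nat) (f g : point -> R) :
  Cn n f -> Cn n g -> Cn n (fun p => f p * g p).
Proof.
  revert f g; induction n as [|n IH]; intros f g F G;
    pose proof F as [F1 F2]; pose proof G as [G1 G2]; split; trivial.
  1, 2: intros p Hp; destruct (F1 p Hp), (G1 p Hp); split;
    [now apply (continuous_mult f g)|now apply pdiff_mult].
  intro c; apply (Cn_ext n (fun p => pd c f p * g p + f p * pd c g p)).
  - intros q Hq; symmetry; apply pd_mult; [apply F1|apply G1]; trivial.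
  - apply Cn_plus; apply IH; auto; now apply Cn_S.
Qed.

Lemma smooth_const (a : R) : smooth (fun _ => a).
Proof. rewrite smooth_Cn; intro n; apply Cn_const. Qed.

Lemma smooth_plus (f g : point -> R) :
  smooth f -> smooth g -> smooth (fun p => f p + g p).
Proof. rewrite !smooth_Cn; intros F G n; now apply Cn_plus. Qed.

Lemma smooth_mult (f g : point -> R) :
  smooth f -> smooth g -> smooth (fun p => f p * g p).
Proof. rewrite !smooth_Cn; intros F G n; now apply Cn_mult. Qed.

Lemma smooth_opp (f : point -> R) : smooth f -> smooth (fun p => - f p).
Proof.
  intro F; apply (smooth_ext (fun p => -1 * f p)); [intros; ring|].
  apply smooth_mult; trivial; apply smooth_const.
Qed.

Lemma smooth_minus (f g : point -> R) :
  smooth f -> smooth g -> smooth (fun p => f p - g p).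
Proof. intros F G; apply smooth_plus; trivial; now apply smooth_opp. Qed.

Lemma smooth_pow (f : point -> R) (n : nat) : smooth f -> smooth (fun p => f p ^ n).
Proof.
  intro F; induction n as [|n IH]; [exact (smooth_const 1)|exact (smooth_mult f _ F IH)].
Qed.

(** * Functions of a single coordinate *)

Lemma is_derive_coord (phi : R -> R) (c d : coord) (p : point) (l : R) :
  is_derive phi (get c p) l ->
  is_derive (fun s => phi (get c (upd d p s))) (get d p)
            (if coord_eq_dec d c then l else 0).
Proof.
  intro H; destruct (coord_eq_dec d c) as [->|n].
  - apply (is_derive_ext phi); trivial; intro t; now rewrite get_upd_same.
  - apply (is_derive_ext (fun _ => phi (get c p))).
    + intro t; now rewrite (get_upd_other d c).
    + apply @is_derive_const.
Qed.

Lemma pd_coord (phi : R -> R) (c d : coord) (p : point) (l : R) :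
  is_derive phi (get c p) l ->
  pd d (fun q => phi (get c q)) p = if coord_eq_dec d c then l else 0.
Proof. intro H; now apply is_derive_unique, is_derive_coord. Qed.

(** A function of one coordinate has one order more than its derivative; the second hypothesis is
    empty for [n = 0], which starts the inductions below. *)
Lemma Cn_coord (n : nat) (c : coord) (phi phi' : R -> R) :
  (forall p, dom p -> is_derive phi (get c p) (phi' (get c p))) ->
  (forall m, n = S m -> Cn m (fun p => phi' (get c p))) ->
  Cn n (fun p => phi (get c p)).
Proof.
  intros H1 H2.
  assert (B : forall p, dom p -> continuous (fun p => phi (get c p)) p /\
                                 pdiff (fun p => phi (get c p)) p).
  { intros p Hp; split.
    - apply (continuous_comp (get c) phi); [apply continuous_get|].
      apply @ex_derive_continuous; eexists; now apply H1.
    - intro d; eexists; now apply is_derive_coord, H1. }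
  destruct n as [|n]; split; trivial.
  intro d; apply (Cn_ext n (fun p => if coord_eq_dec d c then phi' (get c p) else 0)).
  - intros q Hq; symmetry; now apply pd_coord, H1.
  - destruct (coord_eq_dec d c); [now apply H2|apply Cn_const].
Qed.

Lemma smooth_get (c : coord) : smooth (get c).
Proof.
  rewrite smooth_Cn; intro n.
  apply (Cn_coord n c (fun x => x) (fun _ => 1)).
  - intros p _; apply @is_derive_id.
  - intros m _; apply Cn_const.
Qed.

(** The derivative [- / x * / x] is a polynomial in the function itself, so the induction closes by
    [Cn_mult]. *)
Lemma smooth_inv_r : smooth (fun p => / get (dx ir) p).
Proof.
  rewrite smooth_Cn; intro n; induction n as [|n IH].
  - apply (Cn_coord 0 (dx ir) Rinv (fun x => - / x * / x)); [|discriminate].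
    intros p Hp; unfold dom in Hp; auto_derive; [lra|field; lra].
  - apply (Cn_coord (S n) (dx ir) Rinv (fun x => - / x * / x)).
    + intros p Hp; unfold dom in Hp; auto_derive; [lra|field; lra].
    + intros m E; injection E as <-.
      apply (Cn_ext n (fun p => -1 * (/ get (dx ir) p * / get (dx ir) p))).
      * intros; ring.
      * apply Cn_mult; [apply Cn_const|now apply Cn_mult].
Qed.

Lemma smooth_sin_cos (c : coord) :
  smooth (fun p => sin (get c p)) /\ smooth (fun p => cos (get c p)).
Proof.
  rewrite !smooth_Cn.
  assert (H : forall n, Cn n (fun p => sin (get c p)) /\ Cn n (fun p => cos (get c p))).
  { induction n as [|n [IH1 IH2]]; split.
    - apply (Cn_coord 0 c sin cos); [|discriminate].
      intros p _; apply is_derive_sin.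
    - apply (Cn_coord 0 c cos (fun x => - sin x)); [|discriminate].
      intros p _; apply is_derive_cos.
    - apply (Cn_coord (S n) c sin cos).
      + intros p _; apply is_derive_sin.
      + intros m E; injection E as <-; trivial.
    - apply (Cn_coord (S n) c cos (fun x => - sin x)).
      + intros p _; apply is_derive_cos.
      + intros m E; injection E as <-.
        apply (Cn_ext n (fun p => -1 * sin (get c p))); [intros; ring|].
        apply Cn_mult; trivial; apply Cn_const. }
  split; intro n; apply H.
Qed.

Definition smooth_sin (c : coord) := proj1 (smooth_sin_cos c).
Definition smooth_cos (c : coord) := proj2 (smooth_sin_cos c).

Lemma pd_get (c d : coord) (p : point) :
  pd d (get c) p = if coord_eq_dec d c then 1 else 0.
Proof. apply (pd_coord (fun x => x)); apply @is_derive_id. Qed.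

Lemma pd_sin (c d : coord) (p : point) :
  pd d (fun q => sin (get c q)) p = if coord_eq_dec d c then cos (get c p) else 0.
Proof. apply pd_coord, is_derive_sin. Qed.

Lemma pd_cos (c d : coord) (p : point) :
  pd d (fun q => cos (get c q)) p = if coord_eq_dec d c then - sin (get c p) else 0.
Proof. apply pd_coord, is_derive_cos. Qed.

Lemma pd_inv_r (d : coord) (p : point) : dom p ->
  pd d (fun q => / get (dx ir) q) p =
  if coord_eq_dec d (dx ir) then - / get (dx ir) p ^ 2 else 0.
Proof.
  intro Hp; unfold dom in Hp; apply (pd_coord Rinv).
  auto_derive; [lra|field; lra].
Qed.

(** Schwarz's theorem on the two-dimensional slice through [p] in the directions [c] and [d]; the
    continuity of the mixed derivatives comes from the joint continuity required by [smooth]. *)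
Lemma pd_comm (f : point -> R) (c d : coord) (p : point) :
  smooth f -> dom p -> pd c (pd d f) p = pd d (pd c f) p.
Proof.
  intros Hf Hp.
  destruct (coord_eq_dec c d) as [->|n]; [reflexivity|].
  assert (upd_comm : forall p x y, upd d (upd c p x) y = upd c (upd d p y) x).
  { intros [[[r t] z] u] x y; destruct c as [[| |]|]; destruct d as [[| |]|];
      try reflexivity; now elim n. }
  set (F := fun x y => f (upd d (upd c p x) y)).
  assert (E1 : forall x y,
    Derive (fun w => Derive (fun t => F w t) y) x =
    pd c (pd d f) (upd d (upd c p x) y)).
  { intros x y; unfold pd at 1; rewrite upd_comm, get_upd_same.
    apply Derive_ext; intro s; unfold pd.
    rewrite upd_upd, <- upd_comm, get_upd_same.
    apply Derive_ext; intro s'; now rewrite upd_upd. }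
  assert (E2 : forall x y,
    Derive (fun w => Derive (fun t => F t w) x) y =
    pd d (pd c f) (upd d (upd c p x) y)).
  { intros x y; unfold pd at 1; rewrite get_upd_same.
    apply Derive_ext; intro s; unfold pd.
    rewrite upd_upd, upd_comm, get_upd_same.
    apply Derive_ext; intro s'; rewrite upd_upd; unfold F; now rewrite upd_comm. }
  assert (B : upd d (upd c p (get c p)) (get d p) = p).
  { now rewrite upd_get, upd_get. }
  assert (D : locally_2d (fun x y => dom (upd d (upd c p x) y)) (get c p) (get d p)).
  { unfold dom in *; clear - Hp n.
    destruct p as [[[r t] z] u]; simpl in Hp.
    (* A displacement smaller than [r] keeps the radial coordinate positive. *)
    exists (mkposreal r Hp); intros x y Hx Hy; simpl in Hx, Hy.
    destruct c as [[| |]|]; destruct d as [[| |]|]; simpl in *; trivial;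
      try (apply Rabs_def2 in Hx; apply Rabs_def2 in Hy; lra). }
  assert (Cg : forall g, smooth g ->
    continuity_2d_pt (fun x y => g (upd d (upd c p x) y)) (get c p) (get d p)).
  { intros g Hg; apply continuity_2d_pt_filterlim.
    assert (Cu : continuous (fun z : R * R => upd d (upd c p (fst z)) (snd z))
                            (get c p, get d p)).
    { apply continuous_point; intro e.
      destruct (coord_eq_dec d e) as [->|nd].
      - apply (continuous_ext (fun z : R * R => snd z)); [|apply continuous_snd].
        intro w; now rewrite get_upd_same.
      - destruct (coord_eq_dec c e) as [->|nc].
        + apply (continuous_ext (fun z : R * R => fst z)); [|apply continuous_fst].
          intro w; now rewrite (get_upd_other d), get_upd_same.
        + apply (continuous_ext (fun _ => get e p)); [|apply continuous_const].
          intro w; now rewrite (get_upd_other d), (get_upd_other c). }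
    apply (filterlim_comp _ _ _ (fun z : R * R => upd d (upd c p (fst z)) (snd z)) g
             _ (locally p)).
    - pose proof Cu as Cu'; unfold continuous in Cu'; cbn [fst snd] in Cu'.
      rewrite B in Cu'; exact Cu'.
    - rewrite B; exact (smooth_cont g p Hg Hp). }
  assert (S := Schwarz F (get c p) (get d p)).
  rewrite (E1 (get c p) (get d p)), (E2 (get c p) (get d p)), B in S; apply S.
  - destruct D as [eps D]; exists eps; intros x y Hx Hy.
    specialize (D x y Hx Hy); set (q := upd d (upd c p x) y) in *.
    repeat split.
    + generalize (smooth_pdiff f q Hf D c); unfold q.
      rewrite upd_comm, get_upd_same; apply ex_derive_ext.
      intro s; unfold F; now rewrite upd_upd, upd_comm.
    + generalize (smooth_pdiff f q Hf D d); unfold q.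
      rewrite get_upd_same; apply ex_derive_ext.
      intro s; unfold F; now rewrite upd_upd.
    + generalize (smooth_pdiff (pd d f) q (smooth_pd f d Hf) D c); unfold q.
      rewrite upd_comm, get_upd_same; apply ex_derive_ext.
      intro s; unfold pd; rewrite upd_upd, <- upd_comm, get_upd_same.
      apply Derive_ext; intro s'; now rewrite upd_upd.
    + generalize (smooth_pdiff (pd c f) q (smooth_pd f c Hf) D d); unfold q.
      rewrite get_upd_same; apply ex_derive_ext.
      intro s; unfold pd; rewrite upd_upd, upd_comm, get_upd_same.
      apply Derive_ext; intro s'; rewrite upd_upd; unfold F; now rewrite upd_comm.
  - apply (continuity_2d_pt_ext (fun x y => pd c (pd d f) (upd d (upd c p x) y))).
    { intros; now rewrite E1. }
    apply Cg; now repeat apply smooth_pd.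
  - apply (continuity_2d_pt_ext (fun x y => pd d (pd c f) (upd d (upd c p x) y))).
    { intros; now rewrite E2. }
    apply Cg; now repeat apply smooth_pd.
Qed.

(** A coordinate line meets the half space in an interval, so a vanishing derivative forces a
    constant along it. *)
Lemma pd_zero_upd (c : coord) (f : point -> R) :
  (forall p, dom p -> pdiff f p) -> (forall p, dom p -> pd c f p = 0) ->
  forall p s, dom p -> dom (upd c p s) -> f p = f (upd c p s).
Proof.
  intros Hd H0 p s Hp Hs.
  assert (L : forall x y, x < y -> dom (upd c p x) -> dom (upd c p y) ->
            f (upd c p x) = f (upd c p y)).
  { intros x y Hxy Hx Hy.
    apply (eq_is_derive (V:=R_NormedModule) (fun w => f (upd c p w))); trivial.
    intros w Hw.
    assert (Hdw : dom (upd c p w)).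
    { unfold dom in *; destruct p as [[[r t] z] u]; destruct c as [[| |]|];
        simpl in *; lra. }
    pose proof (H0 _ Hdw) as Hz; pose proof (Hd _ Hdw c) as He.
    unfold pd in Hz; rewrite get_upd_same in Hz, He.
    change (@zero R_NormedModule) with 0; rewrite <- Hz.
    apply (is_derive_ext (fun s0 => f (upd c (upd c p w) s0))).
    - intro t; now rewrite upd_upd.
    - now apply Derive_correct. }
  rewrite <- (upd_get c p) at 1.
  assert (Hp' : dom (upd c p (get c p))) by (now rewrite upd_get).
  destruct (Rtotal_order (get c p) s) as [Hl|[->|Hg]]; trivial.
  - now apply L.
  - symmetry; now apply L.
Qed.

(** The path from [p] to [q] changes one coordinate at a time and stays in the half space, since its
    radial coordinate only takes the two given positive values at the corners. *)
Lemma gradient_zero_const (f : point -> R) :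
  (forall p, dom p -> pdiff f p) ->
  (forall c p, dom p -> pd c f p = 0) ->
  forall p q, dom p -> dom q -> f p = f q.
Proof.
  intros Hd H0.
  assert (U : forall c p s, dom p -> dom (upd c p s) -> f p = f (upd c p s)).
  { intros c p s; apply pd_zero_upd; auto. }
  intros [[[r t] z] u] [[[r' t'] z'] u'] Hp Hq; unfold dom in Hp, Hq; simpl in Hp, Hq.
  rewrite (U (dx ir) (r, t, z, u) r') by assumption; simpl.
  rewrite (U (dx ith) (r', t, z, u) t') by assumption; simpl.
  rewrite (U (dx iz) (r', t', z, u) z') by assumption; simpl.
  now rewrite (U du (r', t', z', u) u') by assumption.
Qed.

(** * The second prolongation of the Helmholtz equation *)

Definition jdom (j : jet) : Prop := 0 < jx j ir.

Definition jdiff (F : jet -> R) (j : jet) : Prop :=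
  (forall i, ex_derive (fun s => F (jet_setx j i s)) (jx j i)) /\
  (forall J, ex_derive (fun s => F (jet_setu j J s)) (ju j J)).

Lemma jet_setx_same (j : jet) (i : indep) : jet_setx j i (jx j i) = j.
Proof.
  destruct j as [x u]; unfold jet_setx; simpl; f_equal.
  apply functional_extensionality; intro i'; now destruct (indep_eq_dec i' i) as [->|].
Qed.

Lemma jet_setu_same (j : jet) (J : mindex) : jet_setu j J (ju j J) = j.
Proof.
  destruct j as [x u]; unfold jet_setu; simpl; f_equal.
  apply functional_extensionality; intro J'; now destruct (mindex_eq_dec J' J) as [->|].
Qed.

Lemma base_setx (j : jet) (i : indep) (s : R) :
  base (jet_setx j i s) = upd (dx i) (base j) s.
Proof. destruct i; reflexivity. Qed.

Lemma base_setu (j : jet) (J : mindex) (s : R) :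
  base (jet_setu j J s) =
  if mindex_eq_dec (0, 0, 0)%nat J then upd du (base j) s else base j.
Proof.
  unfold base, jet_setu; cbn [jx ju].
  now destruct (mindex_eq_dec (0, 0, 0)%nat J).
Qed.

Lemma jdom_setx_near (j : jet) (i : indep) :
  jdom j -> locally (jx j i) (fun s => jdom (jet_setx j i s)).
Proof.
  intro H; generalize (dom_upd_near (dx i) (base j) H).
  replace (get (dx i) (base j)) with (jx j i) by (destruct i; reflexivity).
  apply filter_imp; intro s; now rewrite <- base_setx.
Qed.

(** Agreement on [jdom] is enough, since this set is open in r and untouched by changes of the
    [u_J]. This lets a formula for a first total derivative be differentiated again. *)
Lemma Dtot_ext (i : indep) (F G : jet -> R) (j : jet) :
  (forall j, jdom j -> F j = G j) -> jdom j -> Dtot i F j = Dtot i G j.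
Proof.
  intros E Hj; unfold Dtot; f_equal.
  - apply Derive_ext_loc; generalize (jdom_setx_near j i Hj); apply filter_imp; auto.
  - unfold sum_list; f_equal; apply map_ext; intro J; f_equal.
    apply Derive_ext; intro s; now apply E.
Qed.

Lemma sum_list_plus (l : list mindex) (F G : mindex -> R) :
  sum_list l (fun J => F J + G J) = sum_list l F + sum_list l G.
Proof.
  unfold sum_list; induction l as [|J l IH]; simpl; [ring|rewrite IH; ring].
Qed.

Lemma sum_list_scal (l : list mindex) (a : R) (F : mindex -> R) :
  sum_list l (fun J => a * F J) = a * sum_list l F.
Proof.
  unfold sum_list; induction l as [|J l IH]; simpl; [ring|rewrite IH; ring].
Qed.

Lemma sum_list_ext (l : list mindex) (F G : mindex -> R) :
  (forall J, F J = G J) -> sum_list l F = sum_list l G.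
Proof. intro E; unfold sum_list; f_equal; apply map_ext; trivial. Qed.

Lemma jdiff_plus (F G : jet -> R) (j : jet) :
  jdiff F j -> jdiff G j -> jdiff (fun j => F j + G j) j.
Proof.
  intros [F1 F2] [G1 G2]; split; intro.
  - apply (ex_derive_plus (fun s => F (jet_setx j i s))); auto.
  - apply (ex_derive_plus (fun s => F (jet_setu j J s))); auto.
Qed.

Lemma jdiff_mult (F G : jet -> R) (j : jet) :
  jdiff F j -> jdiff G j -> jdiff (fun j => F j * G j) j.
Proof.
  intros [F1 F2] [G1 G2]; split; intro.
  - apply (ex_derive_mult (fun s => F (jet_setx j i s)) (fun s => G (jet_setx j i s))); auto.
  - apply (ex_derive_mult (fun s => F (jet_setu j J s)) (fun s => G (jet_setu j J s))); auto.
Qed.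

Lemma jdiff_opp (F : jet -> R) (j : jet) : jdiff F j -> jdiff (fun j => - F j) j.
Proof.
  intros [F1 F2]; split; intro.
  - apply (ex_derive_opp (fun s => F (jet_setx j i s))); auto.
  - apply (ex_derive_opp (fun s => F (jet_setu j J s))); auto.
Qed.

Lemma jdiff_minus (F G : jet -> R) (j : jet) :
  jdiff F j -> jdiff G j -> jdiff (fun j => F j - G j) j.
Proof. intros HF HG; apply jdiff_plus; trivial; now apply jdiff_opp. Qed.

Lemma jdiff_base (f : point -> R) (j : jet) :
  smooth f -> jdom j -> jdiff (fun j => f (base j)) j.
Proof.
  intros Hf Hj; pose proof (smooth_pdiff f (base j) Hf Hj) as H; split.
  - intro i; generalize (H (dx i)).
    replace (get (dx i) (base j)) with (jx j i) by (destruct i; reflexivity).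
    apply ex_derive_ext; intro s; now rewrite base_setx.
  - intro J; destruct (mindex_eq_dec (0, 0, 0)%nat J) as [E|n].
    + generalize (H du); rewrite <- E; apply ex_derive_ext.
      intro s; now rewrite base_setu.
    + apply (ex_derive_ext (fun _ => f (base j))); [|apply ex_derive_const].
      intro s; rewrite base_setu; now destruct (mindex_eq_dec (0, 0, 0)%nat J).
Qed.

Lemma jd_u_u (I J : mindex) (j : jet) :
  is_derive (fun s => ju (jet_setu j I s) J) (ju j I)
            (if mindex_eq_dec J I then 1 else 0).
Proof.
  unfold jet_setu; cbn [ju]; destruct (mindex_eq_dec J I).
  - apply @is_derive_id.
  - apply @is_derive_const.
Qed.

Lemma jdiff_u (J : mindex) (j : jet) : jdiff (fun j => ju j J) j.
Proof.
  split; intro.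
  - exact (ex_derive_const (ju j J) (jx j i)).
  - eexists; apply jd_u_u.
Qed.

Lemma Dtot_plus (i : indep) (F G : jet -> R) (j : jet) :
  jdiff F j -> jdiff G j ->
  Dtot i (fun j => F j + G j) j = Dtot i F j + Dtot i G j.
Proof.
  intros [F1 F2] [G1 G2]; unfold Dtot.
  transitivity (jd_x i F j + jd_x i G j
    + sum_list ((0, 0, 0)%nat :: mindices_1_2)
       (fun J => ju j (mindex_incr J i) * jd_u J F j
               + ju j (mindex_incr J i) * jd_u J G j)).
  2: rewrite sum_list_plus; ring.
  f_equal.
  - apply Derive_plus; auto.
  - apply sum_list_ext; intro J; rewrite <- Rmult_plus_distr_l; f_equal.
    apply Derive_plus; auto.
Qed.

Lemma Dtot_mult (i : indep) (F G : jet -> R) (j : jet) :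
  jdiff F j -> jdiff G j ->
  Dtot i (fun j => F j * G j) j = Dtot i F j * G j + F j * Dtot i G j.
Proof.
  intros [F1 F2] [G1 G2]; unfold Dtot.
  transitivity (jd_x i F j * G j + F j * jd_x i G j
    + sum_list ((0, 0, 0)%nat :: mindices_1_2)
       (fun J => G j * (ju j (mindex_incr J i) * jd_u J F j)
               + F j * (ju j (mindex_incr J i) * jd_u J G j))).
  2: rewrite sum_list_plus, !sum_list_scal; ring.
  f_equal.
  - unfold jd_x; rewrite (Derive_mult (fun s => F (jet_setx j i s))); auto.
    now rewrite !jet_setx_same.
  - apply sum_list_ext; intro J; unfold jd_u.
    rewrite (Derive_mult (fun s => F (jet_setu j J s))); auto.
    rewrite !jet_setu_same; ring.
Qed.

Lemma Dtot_opp (i : indep) (F : jet -> R) (j : jet) :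
  Dtot i (fun j => - F j) j = - Dtot i F j.
Proof.
  unfold Dtot.
  transitivity (-1 * jd_x i F j
    + sum_list ((0, 0, 0)%nat :: mindices_1_2)
       (fun J => -1 * (ju j (mindex_incr J i) * jd_u J F j))).
  2: rewrite sum_list_scal; ring.
  f_equal.
  - unfold jd_x; rewrite (Derive_opp (fun s => F (jet_setx j i s))); ring.
  - apply sum_list_ext; intro J; unfold jd_u.
    rewrite (Derive_opp (fun s => F (jet_setu j J s))); ring.
Qed.

Lemma Dtot_minus (i : indep) (F G : jet -> R) (j : jet) :
  jdiff F j -> jdiff G j ->
  Dtot i (fun j => F j - G j) j = Dtot i F j - Dtot i G j.
Proof.
  intros HF HG; unfold Rminus; rewrite (Dtot_plus i F); trivial.
  - now rewrite Dtot_opp.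
  - now apply jdiff_opp.
Qed.

Definition D1 (i : indep) (f : point -> R) (j : jet) : R :=
  pd (dx i) f (base j) + ju j (ind1 i) * pd du f (base j).

Lemma Dtot_base (i : indep) (f : point -> R) (j : jet) :
  Dtot i (fun j => f (base j)) j = D1 i f j.
Proof.
  unfold Dtot, D1; f_equal.
  - unfold jd_x, pd.
    replace (get (dx i) (base j)) with (jx j i) by (destruct i; reflexivity).
    apply Derive_ext; intro s; now rewrite base_setx.
  - unfold sum_list, mindices_1_2; cbn [map fold_right].
    assert (E : forall J, (0, 0, 0)%nat <> J -> jd_u J (fun j => f (base j)) j = 0).
    { intros J n; unfold jd_u.
      rewrite (Derive_ext _ (fun _ => f (base j))); [apply Derive_const|].
      intro s; rewrite base_setu; now destruct (mindex_eq_dec (0, 0, 0)%nat J). }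
    rewrite (E (1,0,0)%nat), (E (0,1,0)%nat), (E (0,0,1)%nat), (E (2,0,0)%nat),
      (E (0,2,0)%nat), (E (0,0,2)%nat), (E (1,1,0)%nat), (E (1,0,1)%nat),
      (E (0,1,1)%nat) by discriminate.
    unfold jd_u at 1; rewrite (Derive_ext _ (fun s => f (upd du (base j) s))).
    + unfold pd, ind1; change (get du (base j)) with (ju j (0, 0, 0)%nat); ring.
    + intro s; now rewrite base_setu.
Qed.

Lemma Dtot_u (i : indep) (J : mindex) (j : jet) :
  In J mindices_1_2 -> Dtot i (fun j => ju j J) j = ju j (mindex_incr J i).
Proof.
  intro HJ; unfold Dtot, sum_list, mindices_1_2; cbn [map fold_right].
  assert (E : forall I, jd_u I (fun j => ju j J) j = if mindex_eq_dec J I then 1 else 0).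
  { intro I; apply is_derive_unique, jd_u_u. }
  rewrite !E; unfold jd_x; change (fun s => ju (jet_setx j i s) J) with (fun _ : R => ju j J).
  rewrite Derive_const.
  unfold mindices_1_2 in HJ; simpl in HJ.
  repeat (destruct HJ as [<-|HJ]; [simpl; ring|]); destruct HJ.
Qed.

Definition D2 (i : indep) (f : point -> R) (j : jet) : R :=
  D1 i (pd (dx i) f) j + ju j (mindex_incr (ind1 i) i) * pd du f (base j)
  + ju j (ind1 i) * D1 i (pd du f) j.

Lemma in_ind1 (i : indep) : In (ind1 i) mindices_1_2.
Proof. destruct i; simpl; tauto. Qed.

Lemma in_ind2 (i l : indep) : In (mindex_incr (ind1 l) i) mindices_1_2.
Proof. destruct i, l; simpl; tauto. Qed.

Lemma jdiff_D1 (i : indep) (f : point -> R) (j : jet) :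
  smooth f -> jdom j -> jdiff (D1 i f) j.
Proof.
  intros Hf Hj; apply jdiff_plus; [|apply jdiff_mult; [apply jdiff_u|]];
    now apply jdiff_base; trivial; apply smooth_pd.
Qed.

Lemma Dtot_D1 (i : indep) (f : point -> R) (j : jet) :
  smooth f -> jdom j -> Dtot i (D1 i f) j = D2 i f j.
Proof.
  intros Hf Hj; unfold D1 at 1.
  assert (B : forall c, jdiff (fun j => pd c f (base j)) j).
  { intro c; apply jdiff_base; trivial; now apply smooth_pd. }
  rewrite Dtot_plus, Dtot_mult; auto using jdiff_mult, jdiff_u.
  rewrite !Dtot_base, Dtot_u by apply in_ind1; unfold D2; ring.
Qed.

(** The classical first prolongation coefficient D_i eta - sum_l (D_i xi^l) u_l, in which no second
    order jet coordinate is left. *)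
Definition prol1 (v : vfield) (i : indep) (j : jet) : R :=
  D1 i (v du) j - sum_indep (fun l => D1 i (v (dx l)) j * ju j (ind1 l)).

(** The classical coefficient of u_ii: Leibniz applied twice to the characteristic, with the third
    order terms left out. *)
Definition prol2 (v : vfield) (i : indep) (j : jet) : R :=
  D2 i (v du) j
  - sum_indep (fun l => D2 i (v (dx l)) j * ju j (ind1 l)
                + 2 * D1 i (v (dx l)) j * ju j (mindex_incr (ind1 l) i)).

Lemma Dtot_charQ (v : vfield) (i : indep) (j : jet) :
  (forall c, smooth (v c)) -> jdom j ->
  Dtot i (charQ v) j =
  prol1 v i j - sum_indep (fun l => v (dx l) (base j) * ju j (mindex_incr (ind1 l) i)).
Proof.
  intros Hv Hj; unfold charQ, sum_indep.
  assert (B : forall c, jdiff (fun j => v c (base j)) j) by (intro; now apply jdiff_base).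
  rewrite Dtot_minus, !Dtot_plus, !Dtot_mult;
    auto 6 using jdiff_plus, jdiff_mult, jdiff_u.
  rewrite !Dtot_base, !Dtot_u by apply in_ind1; unfold prol1, sum_indep; ring.
Qed.

Lemma jdiff_prol1 (v : vfield) (i : indep) (j : jet) :
  (forall c, smooth (v c)) -> jdom j -> jdiff (prol1 v i) j.
Proof.
  intros Hv Hj; unfold prol1, sum_indep.
  assert (B1 : forall l, jdiff (fun j => D1 i (v (dx l)) j * ju j (ind1 l)) j).
  { intro l; apply jdiff_mult; [now apply jdiff_D1|apply jdiff_u]. }
  apply jdiff_minus; [now apply jdiff_D1|].
  apply jdiff_plus; [apply jdiff_plus|]; apply B1.
Qed.

(** The third order terms xi^l u_lii are isolated in the last sum; they are exactly what the
    definition of [eta_hat] adds back. *)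
Lemma Dtot_Dtot_charQ (v : vfield) (i : indep) (j : jet) :
  (forall c, smooth (v c)) -> jdom j ->
  Dtot i (Dtot i (charQ v)) j =
  prol2 v i j - sum_indep (fun l =>
    v (dx l) (base j) * ju j (mindex_incr (mindex_incr (ind1 l) i) i)).
Proof.
  intros Hv Hj.
  rewrite (Dtot_ext i _ _ j (fun j Hj => Dtot_charQ v i j Hv Hj) Hj).
  assert (B : forall c, jdiff (fun j => v c (base j)) j) by (intro; now apply jdiff_base).
  assert (B1 : forall i c, jdiff (D1 i (v c)) j) by (intros; now apply jdiff_D1).
  rewrite Dtot_minus; [|now apply jdiff_prol1|unfold sum_indep; auto 6 using jdiff_plus, jdiff_mult, jdiff_u].
  unfold prol1, sum_indep.
  rewrite Dtot_minus, !Dtot_plus, !Dtot_mult;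
    auto 6 using jdiff_plus, jdiff_mult, jdiff_u.
  rewrite !Dtot_base, !Dtot_D1, !Dtot_u by (apply in_ind1 || apply in_ind2 || auto).
  unfold prol2, sum_indep; ring.
Qed.

Lemma eta_hat_1 (v : vfield) (i : indep) (j : jet) :
  (forall c, smooth (v c)) -> jdom j -> eta_hat v (ind1 i) j = prol1 v i j.
Proof.
  intros Hv Hj; unfold eta_hat.
  replace (DJ (ind1 i) (charQ v) j) with (Dtot i (charQ v) j) by (destruct i; reflexivity).
  rewrite Dtot_charQ by trivial; unfold sum_indep; destruct i; simpl; ring.
Qed.

Lemma eta_hat_2 (v : vfield) (i : indep) (j : jet) :
  (forall c, smooth (v c)) -> jdom j ->
  eta_hat v (mindex_incr (ind1 i) i) j = prol2 v i j.
Proof.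
  intros Hv Hj; unfold eta_hat.
  replace (DJ (mindex_incr (ind1 i) i) (charQ v) j)
    with (Dtot i (Dtot i (charQ v)) j) by (destruct i; reflexivity).
  rewrite Dtot_Dtot_charQ by trivial; unfold sum_indep; destruct i; simpl; ring.
Qed.

(** The equation involves only u, u_r and the pure second derivatives, so one first order and three
    second order coefficients survive. *)
Lemma prolong2_helmholtz (k : R) (v : vfield) (j : jet) :
  (forall c, smooth (v c)) -> jdom j ->
  let r := jx j ir in
  prolong2 v (helmholtz k) j =
  v (dx ir) (base j) * (- / r ^ 2 * ju j (1, 0, 0)%nat - 2 / r ^ 3 * ju j (0, 2, 0)%nat)
  + k ^ 2 * v du (base j) + / r * prol1 v ir j
  + prol2 v ir j + / r ^ 2 * prol2 v ith j + prol2 v iz j.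
Proof.
  intros Hv Hj r; unfold jdom in Hj; fold r in Hj.
  assert (X1 : jd_x ir (helmholtz k) j =
    - / r ^ 2 * ju j (1, 0, 0)%nat - 2 / r ^ 3 * ju j (0, 2, 0)%nat).
  { apply is_derive_unique; unfold helmholtz; simpl.
    fold r; auto_derive; [repeat split; nra|field; lra]. }
  assert (X2 : jd_x ith (helmholtz k) j = 0) by exact (Derive_const (helmholtz k j) _).
  assert (X3 : jd_x iz (helmholtz k) j = 0) by exact (Derive_const (helmholtz k j) _).
  unfold prolong2, sum_list, mindices_1_2; cbn [map fold_right].
  (* The equation is linear in the [u_J]; all its derivatives by jet coordinates are read off at
     once. *)
  assert (U : forall J, jd_u J (helmholtz k) j =
    (if mindex_eq_dec (2, 0, 0)%nat J then 1 else 0)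
    + / r * (if mindex_eq_dec (1, 0, 0)%nat J then 1 else 0)
    + / r ^ 2 * (if mindex_eq_dec (0, 2, 0)%nat J then 1 else 0)
    + (if mindex_eq_dec (0, 0, 2)%nat J then 1 else 0)
    + k ^ 2 * (if mindex_eq_dec (0, 0, 0)%nat J then 1 else 0)).
  { intro J; apply is_derive_unique; unfold helmholtz; cbn [jx jet_setu]; fold r.
    repeat apply @is_derive_plus; try apply is_derive_scal; apply jd_u_u. }
  rewrite !U.
  pose proof (eta_hat_1 v ir j Hv Hj) as H1.
  pose proof (fun i => eta_hat_2 v i j Hv Hj) as H2.
  pose proof (H2 ir) as H2r; pose proof (H2 ith) as H2t; pose proof (H2 iz) as H2z.
  cbn [ind1 mindex_incr] in H1, H2r, H2t, H2z.
  rewrite H1, H2r, H2t, H2z.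
  unfold sum_indep; rewrite X1, X2, X3; simpl; ring.
Qed.

(** * The determining equations *)

Create HintDb smooth.
#[export] Hint Resolve smooth_const smooth_plus smooth_mult smooth_opp smooth_minus
  smooth_get smooth_pow smooth_sin smooth_cos smooth_inv_r smooth_pd smooth_pdiff : smooth.

Lemma D1_indep_u (i : indep) (f : point -> R) (j : jet) :
  (forall p, dom p -> pd du f p = 0) -> jdom j -> D1 i f j = pd (dx i) f (base j).
Proof. intros H Hj; unfold D1; rewrite H by trivial; ring. Qed.

Lemma D2_expand (i : indep) (f : point -> R) (j : jet) :
  smooth f -> jdom j ->
  D2 i f j = pd (dx i) (pd (dx i) f) (base j)
    + 2 * ju j (ind1 i) * pd (dx i) (pd du f) (base j)
    + ju j (mindex_incr (ind1 i) i) * pd du f (base j)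
    + ju j (ind1 i) ^ 2 * pd du (pd du f) (base j).
Proof.
  intros Hf Hj; unfold D2, D1.
  rewrite (pd_comm f du (dx i)) by trivial; ring.
Qed.

Lemma pd_of_zero (c : coord) (f : point -> R) (p : point) :
  (forall p, dom p -> f p = 0) -> dom p -> pd c f p = 0.
Proof. intros H Hp; rewrite (pd_ext c f (fun _ => 0)); trivial; apply pd_const. Qed.

Lemma D2_indep_u (i : indep) (f : point -> R) (j : jet) :
  smooth f -> (forall p, dom p -> pd du f p = 0) -> jdom j ->
  D2 i f j = pd (dx i) (pd (dx i) f) (base j).
Proof.
  intros Hf H Hj; rewrite D2_expand by trivial.
  rewrite (pd_of_zero (dx i) (pd du f)), (pd_of_zero du (pd du f)), H by trivial; ring.
Qed.

(* The jets with vanishing third order part on which the equation holds are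
   parametrized by all the coordinates but [u_rr]. *)
Definition test_jet (k : R) (p : point) (ur ut uz utt uzz urt urz utz : R) : jet :=
  let '(r, t, z, u) := p in
  mkjet (fun i => get (dx i) p)
    (fun J => match J with
     | (0, 0, 0)%nat => u
     | (1, 0, 0)%nat => ur
     | (0, 1, 0)%nat => ut
     | (0, 0, 1)%nat => uz
     | (2, 0, 0)%nat => - (/ r * ur + / r ^ 2 * utt + uzz + k ^ 2 * u)
     | (0, 2, 0)%nat => utt
     | (0, 0, 2)%nat => uzz
     | (1, 1, 0)%nat => urt
     | (1, 0, 1)%nat => urz
     | (0, 1, 1)%nat => utz
     | _ => 0
     end).

Notation dr := (dx ir).
Notation dt := (dx ith).
Notation dz := (dx iz).

(** At a fixed point, invariance becomes a polynomial identity in eight free numbers; the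
    determining equations are extracted from it by choosing values. *)
Lemma invariance_on_test_jet (k : R) (v : vfield) (p : point)
    (ur ut uz utt uzz urt urz utz : R) :
  inf_symmetry k v -> dom p ->
  let s := / get dr p in
  let u := get du p in
  let urr := - (s * ur + s ^ 2 * utt + uzz + k ^ 2 * u) in
  let d c := fun f : point -> R => pd c f p in
  let D_r := fun f => d dr f + ur * d du f in
  let D_t := fun f => d dt f + ut * d du f in
  let D_z := fun f => d dz f + uz * d du f in
  let D_rr := fun f => d dr (pd dr f) + 2 * ur * d dr (pd du f) + urr * d du f
                       + ur ^ 2 * d du (pd du f) in
  let D_tt := fun f => d dt (pd dt f) + 2 * ut * d dt (pd du f) + utt * d du f
                       + ut ^ 2 * d du (pd du f) in
  let D_zz := fun f => d dz (pd dz f) + 2 * uz * d dz (pd du f) + uzz * d du f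
                       + uz ^ 2 * d du (pd du f) in
  let X := v dr in let T := v dt in let Z := v dz in let H := v du in
  X p * (- s ^ 2 * ur - 2 * s ^ 3 * utt) + k ^ 2 * H p
  + s * (D_r H - (D_r X * ur + D_r T * ut + D_r Z * uz))
  + (D_rr H - (D_rr X * ur + D_rr T * ut + D_rr Z * uz)
     - 2 * (D_r X * urr + D_r T * urt + D_r Z * urz))
  + s ^ 2 * (D_tt H - (D_tt X * ur + D_tt T * ut + D_tt Z * uz)
     - 2 * (D_t X * urt + D_t T * utt + D_t Z * utz))
  + (D_zz H - (D_zz X * ur + D_zz T * ut + D_zz Z * uz)
     - 2 * (D_z X * urz + D_z T * utz + D_z Z * uzz)) = 0.
Proof.
  intros [Hs Hv] Hp; cbv zeta beta.
  set (j := test_jet k p ur ut uz utt uzz urt urz utz).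
  assert (Bj : base j = p) by (now destruct p as [[[r t] z] u]).
  assert (Hj : jdom j) by (unfold j; destruct p as [[[r t] z] u]; exact Hp).
  assert (Hh : helmholtz k j = 0).
  { unfold helmholtz, j; destruct p as [[[r t] z] u]; cbn; ring. }
  specialize (Hv j Hj Hh).
  rewrite prolong2_helmholtz in Hv by trivial.
  unfold prol1, prol2, sum_indep in Hv; rewrite !D2_expand in Hv by auto.
  unfold D1 in Hv; rewrite Bj in Hv; rewrite <- Hv.
  unfold j; clear - Hp; destruct p as [[[r t] z] u]; unfold dom in Hp; simpl in Hp.
  cbn [test_jet get jx ju ind1 mindex_incr].
  field; lra.
Qed.

Lemma diff0 (a b : R) : a = 0 -> b = 0 -> a - b = 0.
Proof. intros -> ->; ring. Qed.

(** The coefficient of each of u_rt, u_rz, u_tz is the difference of two test jets. It is affine in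
    the first derivatives, so the [u]-derivatives in it vanish separately, and what is left are the
    off-diagonal conformal equations. *)
Lemma base_components_indep_u (k : R) (v : vfield) (p : point) :
  inf_symmetry k v -> dom p ->
  pd du (v dr) p = 0 /\ pd du (v dt) p = 0 /\ pd du (v dz) p = 0 /\
  get dr p ^ 2 * pd dr (v dt) p = - pd dt (v dr) p /\
  pd dr (v dz) p = - pd dz (v dr) p /\
  get dr p ^ 2 * pd dz (v dt) p = - pd dt (v dz) p.
Proof.
  intros Hv Hp.
  pose proof (fun ur ut uz => invariance_on_test_jet k v p ur ut uz 0 0 0 0 0 Hv Hp) as H0.
  pose proof (fun ur ut uz => invariance_on_test_jet k v p ur ut uz 0 0 1 0 0 Hv Hp) as H1.
  pose proof (fun ur ut uz => invariance_on_test_jet k v p ur ut uz 0 0 0 1 0 Hv Hp) as H2.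
  pose proof (fun ur ut uz => invariance_on_test_jet k v p ur ut uz 0 0 0 0 1 Hv Hp) as H3.
  unfold dom in Hp; cbv zeta beta in *.
  set (s := / get dr p) in *.
  assert (Hs : get dr p * s = 1) by (unfold s; field; lra).
  assert (M : forall x y, x + s ^ 2 * y = 0 -> get dr p ^ 2 * x = - y).
  { intros x y E; replace x with (- (s ^ 2 * y)) by lra.
    replace (get dr p ^ 2 * - (s ^ 2 * y)) with (- ((get dr p * s) ^ 2 * y)) by ring.
    rewrite Hs; ring. }
  assert (Z : forall y, s ^ 2 * y = 0 -> y = 0).
  { intros y E; apply Rmult_integral in E; destruct E as [E|E]; trivial.
    assert (s <> 0) by (intro E'; rewrite E' in Hs; lra).
    elim (pow_nonzero s 2 H E). }
  (* u_rt enters with the factor -2; [A2] and [A3] treat u_rz and u_tz in the same way. *)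
  assert (A1 : forall ur ut,
    pd dr (v dt) p + ur * pd du (v dt) p + s ^ 2 * (pd dt (v dr) p + ut * pd du (v dr) p) = 0).
  { intros ur ut; specialize (H0 ur ut 0); specialize (H1 ur ut 0).
    apply (Rmult_eq_reg_l (-2)); [|lra]; rewrite Rmult_0_r.
    etransitivity; [|exact (diff0 _ _ H1 H0)]; ring. }
  assert (A2 : forall ur uz,
    pd dr (v dz) p + ur * pd du (v dz) p + (pd dz (v dr) p + uz * pd du (v dr) p) = 0).
  { intros ur uz; specialize (H0 ur 0 uz); specialize (H2 ur 0 uz).
    apply (Rmult_eq_reg_l (-2)); [|lra]; rewrite Rmult_0_r.
    etransitivity; [|exact (diff0 _ _ H2 H0)]; ring. }
  assert (A3 : forall ut uz,
    pd dz (v dt) p + uz * pd du (v dt) p + s ^ 2 * (pd dt (v dz) p + ut * pd du (v dz) p) = 0).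
  { intros ut uz; specialize (H0 0 ut uz); specialize (H3 0 ut uz).
    apply (Rmult_eq_reg_l (-2)); [|lra]; rewrite Rmult_0_r.
    etransitivity; [|exact (diff0 _ _ H3 H0)]; ring. }
  repeat split.
  - pose proof (A2 0 0); pose proof (A2 0 1); lra.
  - pose proof (A1 0 0); pose proof (A1 1 0); lra.
  - pose proof (A2 0 0); pose proof (A2 1 0); lra.
  - apply M; pose proof (A1 0 0); lra.
  - pose proof (A2 0 0); lra.
  - apply M; pose proof (A3 0 0); lra.
Qed.

(** The remaining coefficients: the pure second derivatives give the diagonal conformal equations,
    the first derivatives tie the gradient of [pd du H] to the Laplacian of the base part, and the
    constant term is the equation for [H]. *)
Lemma determining_equations (k : R) (v : vfield) (p : point) :
  inf_symmetry k v -> dom p ->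
  let r := get dr p in
  let lap f := pd dr (pd dr f) p + / r * pd dr f p + / r ^ 2 * pd dt (pd dt f) p
               + pd dz (pd dz f) p in
  let X := v dr in let T := v dt in let Z := v dz in let H := v du in
  pd dz Z p = pd dr X p /\
  r * pd dt T p = r * pd dr X p - X p /\
  pd du (pd du H) p = 0 /\
  2 * pd dr (pd du H) p = lap X - 2 / r * pd dr X p + X p / r ^ 2 /\
  2 * pd dt (pd du H) p = r ^ 2 * lap T /\
  2 * pd dz (pd du H) p = lap Z /\
  lap H + k ^ 2 * H p - k ^ 2 * get du p * (pd du H p - 2 * pd dr X p) = 0.
Proof.
  intros Hv Hp.
  assert (U : forall q, dom q -> pd du (v dr) q = 0 /\ pd du (v dt) q = 0 /\ pd du (v dz) q = 0).
  { intros q Hq; pose proof (base_components_indep_u k v q Hv Hq); tauto. }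
  assert (UX : forall c, pd c (pd du (v dr)) p = 0) by (intro; apply pd_of_zero; trivial; apply U).
  assert (UT : forall c, pd c (pd du (v dt)) p = 0) by (intro; apply pd_of_zero; trivial; apply U).
  assert (UZ : forall c, pd c (pd du (v dz)) p = 0) by (intro; apply pd_of_zero; trivial; apply U).
  destruct (U p Hp) as (U1 & U2 & U3).
  intros r lap X T Z H; assert (Hr : 0 < r) by exact Hp.
  (* The invariance condition with the mixed second derivatives set to 0, ordered by the other jet
     coordinates. *)
  set (P := fun ur ut uz utt uzz =>
    - X p * (/ r ^ 2 * ur + 2 / r ^ 3 * utt) + k ^ 2 * H p + lap H
    - (/ r * ur + / r ^ 2 * utt + uzz + k ^ 2 * get du p) * (pd du H p - 2 * pd dr X p)
    + / r * ur * pd du H p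
    + / r ^ 2 * (utt * (pd du H p - 2 * pd dt T p))
    + uzz * (pd du H p - 2 * pd dz Z p)
    + ur * (2 * pd dr (pd du H) p - lap X) + ut * (2 / r ^ 2 * pd dt (pd du H) p - lap T)
    + uz * (2 * pd dz (pd du H) p - lap Z)
    + (ur ^ 2 + / r ^ 2 * ut ^ 2 + uz ^ 2) * pd du (pd du H) p).
  assert (K : forall ur ut uz utt uzz, P ur ut uz utt uzz = 0).
  { intros ur ut uz utt uzz.
    pose proof (invariance_on_test_jet k v p ur ut uz utt uzz 0 0 0 Hv Hp) as K.
    cbv zeta beta in K; fold X T Z H in K, UX, UT, UZ, U1, U2, U3; fold r in K.
    rewrite !UX, !UT, !UZ, U1, U2, U3 in K.
    rewrite <- K; unfold P, lap; field; lra. }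
  assert (K0 : P 0 0 0 0 0 = 0) by apply K.
  assert (Kz : P 0 0 0 0 1 = 0) by apply K.
  assert (Kt : P 0 0 0 1 0 = 0) by apply K.
  assert (Kr1 : P 1 0 0 0 0 = 0) by apply K.
  assert (Kr2 : P (-1) 0 0 0 0 = 0) by apply K.
  assert (Kt1 : P 0 1 0 0 0 = 0) by apply K.
  assert (Kt2 : P 0 (-1) 0 0 0 = 0) by apply K.
  assert (Kz1 : P 0 0 1 0 0 = 0) by apply K.
  assert (Kz2 : P 0 0 (-1) 0 0 = 0) by apply K.
  clear K; unfold P in *.
  repeat split.
  - apply Rminus_diag_uniq; apply (Rmult_eq_reg_l (-2)); [|lra]; rewrite Rmult_0_r.
    etransitivity; [|exact (diff0 _ _ Kz K0)]; ring.
  - apply Rminus_diag_uniq; apply (Rmult_eq_reg_l (-2 / r ^ 3)).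
    2: { unfold Rdiv; apply Rmult_integral_contrapositive_currified; [lra|].
         apply Rinv_neq_0_compat, pow_nonzero; lra. }
    rewrite Rmult_0_r.
    etransitivity; [|exact (diff0 _ _ Kt K0)]; field; lra.
  (* The second difference in u_z isolates the quadratic coefficient; below, the differences between
     the values at 1 and -1 isolate the linear ones. *)
  - apply (Rmult_eq_reg_l 2); [|lra]; rewrite Rmult_0_r.
    etransitivity; [|exact (diff0 _ _ (diff0 _ _ Kz1 K0) (diff0 _ _ K0 Kz2))]; ring.
  - apply Rminus_diag_uniq; apply (Rmult_eq_reg_l 2); [|lra]; rewrite Rmult_0_r.
    etransitivity; [|exact (diff0 _ _ Kr1 Kr2)]; field; lra.
  - apply Rminus_diag_uniq; apply (Rmult_eq_reg_l (2 / r ^ 2)).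
    2: { unfold Rdiv; apply Rmult_integral_contrapositive_currified; [lra|].
         apply Rinv_neq_0_compat, pow_nonzero; lra. }
    rewrite Rmult_0_r.
    etransitivity; [|exact (diff0 _ _ Kt1 Kt2)]; field; lra.
  - apply Rminus_diag_uniq; apply (Rmult_eq_reg_l 2); [|lra]; rewrite Rmult_0_r.
    etransitivity; [|exact (diff0 _ _ Kz1 Kz2)]; field; lra.
  - etransitivity; [|exact K0]; ring.
Qed.

(** * Solving the determining equations *)

Lemma pd_rmult (c : coord) (f : point -> R) (p : point) : smooth f -> dom p ->
  pd c (fun q => get dr q * f q) p =
  (if coord_eq_dec c dr then f p else 0) + get dr p * pd c f p.
Proof.
  intros Hf Hp; rewrite pd_mult, pd_get by auto with smooth.
  destruct (coord_eq_dec c dr); ring.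
Qed.

Lemma pd_r2mult (c : coord) (f : point -> R) (p : point) : smooth f -> dom p ->
  pd c (fun q => get dr q ^ 2 * f q) p =
  (if coord_eq_dec c dr then 2 * get dr p * f p else 0) + get dr p ^ 2 * pd c f p.
Proof.
  intros Hf Hp.
  rewrite (pd_ext c _ (fun q => get dr q * (get dr q * f q))) by (trivial; intros; ring).
  rewrite !pd_rmult by auto with smooth.
  destruct (coord_eq_dec c dr); ring.
Qed.

(** The hypotheses are the conformal Killing equations in cylindrical coordinates with factor [phi],
    and thanks to them the first three left sides are the covariant components of the vector
    Laplacian. In dimension n that Laplacian is (2 - n) grad phi, whence the minus signs. *)
Lemma conformal_laplacian (X T Z : point -> R) :
  smooth X -> smooth T -> smooth Z ->
  (forall p, dom p -> pd dz Z p = pd dr X p) ->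
  (forall p, dom p -> get dr p * pd dt T p = get dr p * pd dr X p - X p) ->
  (forall p, dom p -> get dr p ^ 2 * pd dr T p = - pd dt X p) ->
  (forall p, dom p -> pd dr Z p = - pd dz X p) ->
  (forall p, dom p -> get dr p ^ 2 * pd dz T p = - pd dt Z p) ->
  forall p, dom p ->
  let r := get dr p in
  let lap f := pd dr (pd dr f) p + / r * pd dr f p + / r ^ 2 * pd dt (pd dt f) p
               + pd dz (pd dz f) p in
  let phi := pd dr X in
  lap X - 2 / r * phi p + X p / r ^ 2 = - pd dr phi p /\
  r ^ 2 * lap T = - pd dt phi p /\
  lap Z = - pd dz phi p /\
  pd dr (pd dr phi) p = 0 /\
  pd dt (pd dt phi) p = - r * pd dr phi p /\
  pd dz (pd dz phi) p = 0.
Proof.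
  intros HX HT HZ Ea Eb Ec Ed Ee.
  set (phi := pd dr X).
  assert (Hphi : smooth phi) by (unfold phi; auto with smooth).
  assert (F1 : forall q, dom q ->
    pd dt (pd dt X) q = - (get dr q ^ 2 * pd dr phi q) + get dr q * phi q - X q).
  { intros q Hq.
    pose proof (pd_ext dr _ _ q Eb Hq) as G1; pose proof (pd_ext dt _ _ q Ec Hq) as G2.
    rewrite pd_minus, !pd_rmult in G1 by auto with smooth.
    rewrite pd_opp, pd_r2mult in G2 by auto with smooth.
    rewrite (pd_comm T dr dt) in G1 by trivial; simpl in G1, G2.
    fold phi in G1; specialize (Eb q Hq); fold phi in Eb.
    replace (pd dt (pd dt X) q) with
      (- (get dr q * (get dr q * pd dt (pd dr T) q))) by lra.
    replace (get dr q * pd dt (pd dr T) q) with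
      (get dr q * pd dr phi q - pd dt T q) by lra.
    replace (X q) with (get dr q * phi q - get dr q * pd dt T q) by lra; ring. }
  assert (F2 : forall q, dom q -> pd dz (pd dz X) q = - pd dr phi q).
  { intros q Hq.
    pose proof (pd_ext dr _ _ q Ea Hq) as G1; pose proof (pd_ext dz _ _ q Ed Hq) as G2.
    rewrite pd_opp in G2; rewrite (pd_comm Z dr dz) in G1 by trivial.
    unfold phi; lra. }
  assert (F3 : forall q, dom q ->
    pd dt (pd dt Z) q = get dr q * pd dz X q - get dr q ^ 2 * pd dz phi q).
  { intros q Hq.
    pose proof (pd_ext dz _ _ q Eb Hq) as G1; pose proof (pd_ext dt _ _ q Ee Hq) as G2.
    rewrite pd_minus, !pd_rmult in G1 by auto with smooth.
    rewrite pd_opp, pd_r2mult in G2 by auto with smooth.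
    rewrite (pd_comm T dz dt) in G1 by trivial; simpl in G1, G2; fold phi in G1.
    replace (pd dt (pd dt Z) q) with
      (- (get dr q * (get dr q * pd dt (pd dz T) q))) by lra.
    replace (get dr q * pd dt (pd dz T) q) with
      (get dr q * pd dz phi q - pd dz X q) by lra; ring. }
  intros p Hp r lap; assert (Hr : 0 < r) by exact Hp.
  assert (Zrr : pd dr (pd dr Z) p = - pd dz phi p).
  { rewrite (pd_ext dr _ _ p Ed Hp), pd_opp; unfold phi.
    now rewrite (pd_comm X dr dz). }
  assert (Zzz : pd dz (pd dz Z) p = pd dz phi p) by exact (pd_ext dz _ _ p Ea Hp).
  assert (Ztz : pd dt (pd dz Z) p = pd dt phi p) by exact (pd_ext dt _ _ p Ea Hp).
  assert (Xrt : pd dr (pd dt X) p = pd dt phi p) by (unfold phi; now apply pd_comm).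
  (* [P1], [P2], [P3] say that any two of the Hessian entries phi_rr, phi_tt / r^2 + phi_r / r and
     phi_zz add up to 0; hence each of them is 0. *)
  assert (P1 : pd dz (pd dz phi) p = - pd dr (pd dr phi) p).
  { rewrite <- pd_opp, <- (pd_ext dr _ _ p F2 Hp).
    rewrite (pd_comm (pd dz X) dr dz) by auto with smooth.
    apply pd_ext; trivial; intros q Hq; unfold phi; now apply pd_comm. }
  assert (P2 : pd dt (pd dt phi) p = - r ^ 2 * pd dr (pd dr phi) p - r * pd dr phi p).
  { assert (E : pd dt (pd dt phi) p = pd dr (pd dt (pd dt X)) p).
    { rewrite (pd_comm (pd dt X) dr dt) by auto with smooth.
      apply pd_ext; trivial; intros q Hq; unfold phi; now apply pd_comm. }
    rewrite E, (pd_ext dr _ _ p F1 Hp).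
    rewrite pd_minus, pd_plus, pd_opp, pd_r2mult, pd_rmult by auto 10 with smooth.
    simpl; fold r phi; ring. }
  assert (P3 : pd dt (pd dt phi) p = - r ^ 2 * pd dz (pd dz phi) p - r * pd dr phi p).
  { assert (E : pd dt (pd dt phi) p = pd dz (pd dt (pd dt Z)) p).
    { rewrite (pd_comm (pd dt Z) dz dt) by auto with smooth.
      apply pd_ext; trivial; intros q Hq.
      rewrite (pd_comm Z dz dt) by trivial; symmetry; now apply pd_ext. }
    rewrite E, (pd_ext dz _ _ p F3 Hp).
    rewrite pd_minus, pd_r2mult, pd_rmult by auto 10 with smooth.
    simpl; rewrite (F2 p Hp); fold r phi; ring. }
  assert (P4 : pd dr (pd dr phi) p = 0).
  { apply (Rmult_eq_reg_l (2 * r ^ 2)); [|nra].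
    rewrite P1, P2 in P3; lra. }
  pose proof (pd_ext dr _ _ p Ec Hp) as Trr; pose proof (pd_ext dt _ _ p Eb Hp) as Ttt;
    pose proof (pd_ext dz _ _ p Ee Hp) as Tzz.
  rewrite pd_r2mult, pd_opp, Xrt in Trr by auto with smooth.
  rewrite pd_minus, !pd_rmult in Ttt by auto with smooth.
  rewrite pd_r2mult, pd_opp, (pd_comm Z dz dt), Ztz in Tzz by auto with smooth.
  simpl in Trr, Ttt, Tzz; fold phi in Ttt; fold r in Trr, Ttt, Tzz.
  repeat split.
  - unfold lap; rewrite F1, F2 by trivial; fold phi r; field; lra.
  - unfold lap.
    replace (r ^ 2 * (pd dr (pd dr T) p + / r * pd dr T p + / r ^ 2 * pd dt (pd dt T) p
             + pd dz (pd dz T) p)) with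
      ((0 + r ^ 2 * pd dz (pd dz T) p) + (2 * r * pd dr T p + r ^ 2 * pd dr (pd dr T) p)
       + / r * (r * pd dt (pd dt T) p - r ^ 2 * pd dr T p)) by (simpl; field; lra).
    replace (r * pd dt (pd dt T) p) with (r * pd dt phi p - pd dt X p) by lra.
    specialize (Ec p Hp); fold r in Ec; rewrite Ec.
    replace (0 + r ^ 2 * pd dz (pd dz T) p) with (- pd dt phi p) by (simpl; lra).
    replace (2 * r * pd dr T p + r ^ 2 * pd dr (pd dr T) p) with (- pd dt phi p)
      by (simpl; lra).
    field; lra.
  - unfold lap; rewrite Zrr, Zzz, F3, Ed by trivial; fold r; field; lra.
  - exact P4.
  - rewrite P2, P4; ring.
  - rewrite P1, P4; ring.
Qed.

Lemma pd_comm2 (f : point -> R) (c d : coord) (p : point) :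
  smooth f -> dom p -> pd c (pd d (pd d f)) p = pd d (pd d (pd c f)) p.
Proof.
  intros Hf Hp; rewrite pd_comm by auto with smooth.
  apply pd_ext; trivial; intros q Hq; now apply pd_comm.
Qed.

Lemma conformal_factor_zero (k : R) (v : vfield) :
  k <> 0 -> inf_symmetry k v ->
  forall p, dom p -> pd dr (v dr) p = 0 /\ forall c, pd c (pd du (v du)) p = 0.
Proof.
  intros hk Hv; pose proof Hv as [Hs _].
  set (X := v dr); set (T := v dt); set (Z := v dz); set (H := v du).
  set (phi := pd dr X); set (a := pd du H).
  assert (HX : smooth X) by apply Hs; assert (HT : smooth T) by apply Hs;
  assert (HZ : smooth Z) by apply Hs; assert (HH : smooth H) by apply Hs.
  assert (Hphi : smooth phi) by (unfold phi; auto with smooth).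
  assert (Ha : smooth a) by (unfold a; auto with smooth).
  pose proof (fun q => base_components_indep_u k v q Hv) as B.
  pose proof (fun q => determining_equations k v q Hv) as Q.
  fold X T Z H in B, Q; cbv zeta beta in Q; fold phi a in Q.
  assert (L := conformal_laplacian X T Z HX HT HZ
    (fun q Hq => proj1 (Q q Hq)) (fun q Hq => proj1 (proj2 (Q q Hq)))
    (fun q Hq => proj1 (proj2 (proj2 (proj2 (B q Hq)))))
    (fun q Hq => proj1 (proj2 (proj2 (proj2 (proj2 (B q Hq))))))
    (fun q Hq => proj2 (proj2 (proj2 (proj2 (proj2 (B q Hq))))))).
  cbv zeta beta in L; fold phi in L.
  (* [a] and [- phi / 2] have the same gradient; in the direction [du] both derivatives are 0. *)
  assert (Da : forall c q, dom q -> pd c a q = - / 2 * pd c phi q).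
  { intros c q Hq.
    destruct (Q q Hq) as (_ & _ & Q3 & Q4 & Q5 & Q6 & _).
    destruct (L q Hq) as (L1 & L2 & L3 & _).
    destruct c as [[| |]|]; try lra.
    unfold phi; rewrite (pd_comm X du dr), (pd_of_zero dr (pd du X)); trivial; [lra|].
    intros; now apply B. }
  assert (Hphi0 : forall p, dom p -> phi p = 0).
  { intros p Hp; assert (Hr : 0 < get dr p) by exact Hp.
    assert (DDa : forall c, pd c (pd c a) p = - / 2 * pd c (pd c phi) p).
    { intro c; rewrite (pd_ext c _ (fun q => - / 2 * pd c phi q)); auto.
      rewrite pd_mult, pd_const by auto 10 with smooth; ring. }
    (* The [u]-derivative of the last determining equation; [/ r ^ 2] is written as a product for
       the product rule. *)
    assert (E : pd du (fun q => pd dr (pd dr H) q + / get dr q * pd dr H q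
      + (/ get dr q * / get dr q) * pd dt (pd dt H) q + pd dz (pd dz H) q + k ^ 2 * H q
      - k ^ 2 * (get du q * (a q - 2 * phi q))) p = 0).
    { apply pd_of_zero; trivial; intros q Hq; unfold dom in Hq.
      destruct (Q q Hq) as (_ & _ & _ & _ & _ & _ & Q7); rewrite <- Q7; field; lra. }
    rewrite pd_minus, !pd_plus, !pd_mult, !pd_const, pd_inv_r, pd_minus, pd_mult,
      pd_const, pd_get in E by auto 20 with smooth.
    rewrite !pd_comm2, (pd_comm H du dr) in E by trivial.
    simpl in E; fold a in E.
    rewrite !DDa, !Da in E by trivial.
    destruct (L p Hp) as (_ & _ & _ & L4 & L5 & L6); rewrite L4, L5, L6 in E.
    assert (Pu : pd du phi p = 0).
    { unfold phi; rewrite pd_comm by trivial; apply pd_of_zero; trivial.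
      intros; now apply B. }
    rewrite Pu in E.
    apply (Rmult_eq_reg_l (2 * k ^ 2)); [|pose proof (pow2_gt_0 k hk); lra].
    rewrite Rmult_0_r, <- E; unfold a; field; lra. }
  intros p Hp; split; [now apply Hphi0|].
  intro c; rewrite Da, (pd_of_zero c phi); trivial; ring.
Qed.

Lemma sin2_cos2' (t : R) : sin t * sin t + cos t * cos t = 1.
Proof. exact (sin2_cos2 t). Qed.

(** [X] is independent of r and affine in z with slope [P]; both [P] and the remaining part solve
    f'' = - f in theta. The constants are first integrals: f sin + f' cos and f cos - f' sin for
    each of these oscillators, then [T] - X_theta / r and [Z] + r [P]. *)
Lemma killing_field_form (X T Z : point -> R) :
  smooth X -> smooth T -> smooth Z ->
  (forall p, dom p -> pd du X p = 0) ->
  (forall p, dom p -> pd du T p = 0) ->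
  (forall p, dom p -> pd du Z p = 0) ->
  (forall p, dom p -> pd dr X p = 0) ->
  (forall p, dom p -> pd dz Z p = 0) ->
  (forall p, dom p -> get dr p * pd dt T p = - X p) ->
  (forall p, dom p -> get dr p ^ 2 * pd dr T p = - pd dt X p) ->
  (forall p, dom p -> pd dr Z p = - pd dz X p) ->
  (forall p, dom p -> get dr p ^ 2 * pd dz T p = - pd dt Z p) ->
  exists c : nat -> R, forall p, dom p ->
    X p = xi_family c ir p /\ T p = xi_family c ith p /\ Z p = xi_family c iz p.
Proof.
  intros HX HT HZ UX UT UZ E0 Ea Eb Ec Ed Ee.
  set (P := pd dz X); assert (HP : smooth P) by (unfold P; auto with smooth).
  assert (UP : forall p, dom p -> pd du P p = 0).
  { intros p Hp; unfold P; rewrite pd_comm by trivial; now apply pd_of_zero. }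
  assert (F1 : forall q, dom q -> pd dt (pd dt X) q = - X q).
  { intros q Hq.
    pose proof (pd_ext dr _ _ q Eb Hq) as G1; pose proof (pd_ext dt _ _ q Ec Hq) as G2.
    rewrite pd_opp, pd_rmult, E0 in G1 by auto with smooth.
    rewrite pd_opp, pd_r2mult in G2 by auto with smooth.
    rewrite (pd_comm T dr dt) in G1 by trivial; simpl in G1, G2.
    specialize (Eb q Hq).
    replace (pd dt (pd dt X) q) with
      (- (get dr q * (get dr q * pd dt (pd dr T) q))) by lra.
    replace (get dr q * pd dt (pd dr T) q) with (- pd dt T q) by lra; lra. }
  assert (F2 : forall q, dom q -> pd dz P q = 0).
  { intros q Hq.
    pose proof (pd_ext dz _ _ q Ed Hq) as G2; rewrite pd_opp in G2.
    rewrite pd_comm, (pd_of_zero dr (pd dz Z)) in G2 by trivial; unfold P; lra. }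
  assert (F3 : forall q, dom q -> pd dr P q = 0).
  { intros q Hq; unfold P; rewrite pd_comm by trivial; now apply pd_of_zero. }
  assert (F4 : forall q, dom q -> pd dr (pd dt X) q = 0).
  { intros q Hq; rewrite pd_comm by trivial; now apply pd_of_zero. }
  (* The derivatives of the three mixed equations combine to r T_z = P_theta, and [Ee] turns this
     into the claim. *)
  assert (F5 : forall q, dom q -> pd dt Z q = - (get dr q * pd dt P q)).
  { intros q Hq; assert (Hr : 0 < get dr q) by exact Hq.
    pose proof (pd_ext dr _ _ q Ee Hq) as G1; pose proof (pd_ext dz _ _ q Ec Hq) as G2;
      pose proof (pd_ext dt _ _ q Ed Hq) as G3.
    rewrite pd_opp, pd_r2mult in G1, G2 by auto with smooth.
    rewrite pd_opp in G3; rewrite (pd_comm T dz dr), (pd_comm X dz dt) in G2 by trivial.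
    rewrite (pd_comm Z dr dt), G3 in G1 by trivial; simpl in G1, G2.
    fold P in G1, G2; specialize (Ee q Hq).
    apply (Rmult_eq_reg_l 2); [|lra].
    replace (2 * pd dt Z q) with (- (get dr q * (2 * get dr q * pd dz T q))) by (simpl in Ee; lra).
    replace (2 * get dr q * pd dz T q) with (2 * pd dt P q) by lra; ring. }
  assert (F6 : forall q, dom q -> pd dt (pd dt P) q = - P q).
  { intros q Hq; unfold P; rewrite <- pd_comm2 by trivial.
    rewrite (pd_ext dz _ (fun q => - X q)) by trivial; apply pd_opp. }
  assert (F7 : forall q, dom q -> pd dz (pd dt X) q = pd dt P q).
  { intros q Hq; unfold P; now apply pd_comm. }
  assert (F8 : forall q, dom q -> pd dr (pd dt P) q = 0).
  { intros q Hq; rewrite pd_comm by trivial; now apply pd_of_zero. }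
  assert (F9 : forall q, dom q -> pd dz (pd dt P) q = 0).
  { intros q Hq; rewrite pd_comm by trivial; now apply pd_of_zero. }
  assert (F10 : forall q, dom q -> pd du (pd dt P) q = 0).
  { intros q Hq; rewrite pd_comm by trivial; now apply pd_of_zero. }
  assert (F11 : forall q, dom q -> pd du (pd dt X) q = 0).
  { intros q Hq; rewrite pd_comm by trivial; now apply pd_of_zero. }
  assert (Cst : forall f, smooth f -> (forall p, dom p -> pd dr f p = 0) ->
    (forall p, dom p -> pd dt f p = 0) -> (forall p, dom p -> pd dz f p = 0) ->
    (forall p, dom p -> pd du f p = 0) -> exists a, forall p, dom p -> f p = a).
  { intros f Hf G1 G2 G3 G4; exists (f (1, 0, 0, 0)); intros p Hp.
    apply gradient_zero_const; trivial.
    - auto with smooth.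
    - intros c q Hq; destruct c as [[| |]|]; auto.
    - unfold dom; simpl; lra. }
  set (S := fun p => sin (get dt p)); set (K := fun p => cos (get dt p)).
  (* The part of [X] free of z, followed by its theta-derivative. *)
  set (q := fun p => X p - get dz p * P p).
  set (qt := fun p => pd dt X p - get dz p * pd dt P p).
  assert (HS : smooth S) by apply smooth_sin; assert (HK : smooth K) by apply smooth_cos.
  assert (Hq : smooth q) by (unfold q; auto with smooth).
  assert (Hqt : smooth qt) by (unfold qt; auto with smooth).
  assert (PS : forall c p, pd c S p = if coord_eq_dec c dt then K p else 0)
    by (intros; apply pd_sin).
  assert (PK : forall c p, pd c K p = if coord_eq_dec c dt then - S p else 0)
    by (intros; apply pd_cos).
  assert (Pq : forall c p, dom p -> pd c q p =
    if coord_eq_dec c dt then qt p else 0).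
  { intros c p Hp; unfold q.
    rewrite pd_minus, pd_mult, pd_get by auto with smooth.
    destruct c as [[| |]|]; simpl; fold P;
      rewrite ?F2, ?F3, ?E0, ?UX, ?UP by trivial; unfold qt; ring. }
  assert (Pqt : forall c p, dom p -> pd c qt p =
    if coord_eq_dec c dt then - q p else 0).
  { intros c p Hp; unfold qt.
    rewrite pd_minus, pd_mult, pd_get by auto with smooth.
    destruct c as [[| |]|]; simpl;
      rewrite ?F8, ?F9, ?F10, ?F11, ?F7, ?F4, ?F1, ?F6 by trivial; unfold q; ring. }
  destruct (Cst (fun p => P p * S p + pd dt P p * K p)) as [c1 C1];
    try (intros p Hp; rewrite ?pd_plus, ?pd_minus, !pd_mult, PS, PK by auto with smooth;
         simpl; rewrite ?F2, ?F3, ?UP, ?F6, ?F8, ?F9, ?F10 by trivial; ring).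
  { auto with smooth. }
  destruct (Cst (fun p => P p * K p - pd dt P p * S p)) as [c2 C2];
    try (intros p Hp; rewrite ?pd_plus, ?pd_minus, !pd_mult, PS, PK by auto with smooth;
         simpl; rewrite ?F2, ?F3, ?UP, ?F6, ?F8, ?F9, ?F10 by trivial; ring).
  { auto with smooth. }
  destruct (Cst (fun p => q p * S p + qt p * K p)) as [c3 C3];
    try (intros p Hp; rewrite ?pd_plus, ?pd_minus, !pd_mult, PS, PK, Pq, Pqt by auto with smooth;
         simpl; ring).
  { auto with smooth. }
  destruct (Cst (fun p => q p * K p - qt p * S p)) as [c4 C4];
    try (intros p Hp; rewrite ?pd_plus, ?pd_minus, !pd_mult, PS, PK, Pq, Pqt by auto with smooth;
         simpl; ring).
  { auto with smooth. }
  destruct (Cst (fun p => T p - / get dr p * pd dt X p)) as [c5 C5].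
  { auto with smooth. }
  1-4: intros p Hp; assert (Hr : get dr p <> 0) by (unfold dom in Hp; lra);
    rewrite pd_minus, pd_mult, pd_inv_r by auto with smooth; simpl;
    rewrite ?F4, ?F1, ?F7, ?F11, ?UT by trivial; simpl.
  - apply (Rmult_eq_reg_l (get dr p ^ 2)); [|now apply pow_nonzero].
    rewrite Rmult_minus_distr_l, Ec by trivial; simpl; field; trivial.
  - apply (Rmult_eq_reg_l (get dr p)); trivial.
    rewrite Rmult_minus_distr_l, Eb by trivial; simpl; field; trivial.
  - apply (Rmult_eq_reg_l (get dr p ^ 2)); [|now apply pow_nonzero].
    rewrite Rmult_minus_distr_l, Ee, F5 by trivial; simpl; field; trivial.
  - simpl; ring.
  - destruct (Cst (fun p => Z p + get dr p * P p)) as [c6 C6].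
    { auto with smooth. }
    1-4: intros p Hp; rewrite pd_plus, pd_rmult by auto with smooth; simpl;
      rewrite ?F3, ?F2, ?UP, ?Ed, ?Ea, ?UZ, ?F5 by trivial; unfold P; ring.
    (* Index 6 falls under the last branch, together with indices that do not occur in
       [xi_family]. *)
    exists (fun n => match n with
      1 => c1 | 2 => c2 | 3 => c3 | 4 => c4 | 5 => c5 | _ => c6 end%nat).
    intros [[[r t] z] u] Hp; simpl.
    pose proof (C1 _ Hp) as D1; pose proof (C2 _ Hp) as D2; pose proof (C3 _ Hp) as D3;
    pose proof (C4 _ Hp) as D4; pose proof (C5 _ Hp) as D5; pose proof (C6 _ Hp) as D6.
    unfold S, K, q, qt, dom in *; cbn [get] in *.
    rewrite <- D1, <- D2, <- D3, <- D4, <- D5, <- D6.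
    set (x := X (r, t, z, u)); set (y := P (r, t, z, u)).
    set (xt := pd dt X (r, t, z, u)); set (yt := pd dt P (r, t, z, u)).
    pose proof (sin2_cos2' t) as SC.
    assert (SC' : cos t * cos t = 1 - sin t * sin t) by lra.
    repeat split.
    + ring_simplify; replace (cos t ^ 2) with (1 - sin t * sin t) by (rewrite <- SC'; ring); ring.
    + field_simplify; [|lra].
      replace (cos t ^ 2) with (1 - sin t * sin t) by (rewrite <- SC'; ring); field; lra.
    + ring_simplify; replace (cos t ^ 2) with (1 - sin t * sin t) by (rewrite <- SC'; ring); ring.
Qed.

Lemma xi_family_ext (c c' : nat -> R) (i : indep) (p : point) :
  (forall n, (1 <= n <= 6)%nat -> c n = c' n) -> xi_family c i p = xi_family c' i p.
Proof.
  intro E; destruct p as [[[r t] z] u]; destruct i; simpl;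
    rewrite ?(E 1%nat), ?(E 2%nat), ?(E 3%nat), ?(E 4%nat), ?(E 5%nat), ?(E 6%nat) by lia;
    reflexivity.
Qed.

Lemma symmetry_superposed (k : R) (v : vfield) :
  k <> 0 -> inf_symmetry k v ->
  exists (c : nat -> R) (b : R -> R -> R -> R),
    helmholtz_solution k b /\ superposed_field c b v.
Proof.
  intros hk Hv; pose proof Hv as [Hs _].
  pose proof (fun q => base_components_indep_u k v q Hv) as B.
  pose proof (fun q => determining_equations k v q Hv) as Q; cbv zeta beta in Q.
  pose proof (conformal_factor_zero k v hk Hv) as P0.
  destruct (killing_field_form (v dr) (v dt) (v dz)) as [c Hc]; auto.
  1-3: intros; now apply B.
  { intros; now apply P0. }
  { intros p Hp; rewrite (proj1 (Q p Hp)); now apply P0. }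
  { intros p Hp; rewrite (proj1 (proj2 (Q p Hp))), (proj1 (P0 p Hp)); ring. }
  1-3: intros; now apply B.
  set (c13 := pd du (v du) (1, 0, 0, 0)).
  assert (H13 : forall p, dom p -> pd du (v du) p = c13).
  { intros p Hp; apply gradient_zero_const; trivial.
    - auto with smooth.
    - intros d q Hq; now apply P0.
    - unfold dom; simpl; lra. }
  (* [v du - c13 * u] has zero [u]-derivative, so its restriction to [u = 0] determines it. *)
  set (b := fun r t z => v du (r, t, z, 0)).
  assert (Eb : forall p, dom p -> lift3 b p = v du p - c13 * get du p).
  { intros [[[r t] z] u] Hp; unfold b; cbn [lift3].
    symmetry; transitivity (v du (r, t, z, 0) - c13 * 0); [|ring].
    apply (pd_zero_upd du (fun p => v du p - c13 * get du p)) with (s := 0) (p := (r, t, z, u));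
      trivial; intros p' Hp'.
    - auto 10 with smooth.
    - rewrite pd_minus, pd_mult, pd_const, pd_get, H13 by auto 10 with smooth; simpl; ring. }
  exists (fun n => if Nat.eqb n 13 then c13 else c n), b; split; split.
  - apply (smooth_ext (fun p => v du p - c13 * get du p)); [|auto with smooth].
    intros; symmetry; now apply Eb.
  - intros p Hp.
    assert (D1b : forall i q, dom q -> pd (dx i) (lift3 b) q = pd (dx i) (v du) q).
    { intros i q Hq; rewrite (pd_ext _ _ _ _ Eb Hq).
      rewrite pd_minus, pd_mult, pd_const, pd_get by auto 10 with smooth.
      destruct i; simpl; ring. }
    assert (D2b : forall i, pds [dx i; dx i] (lift3 b) p = pd (dx i) (pd (dx i) (v du)) p).
    { intro i; simpl; apply pd_ext; auto. }
    rewrite !D2b, !D1b, Eb by trivial.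
    destruct (Q p Hp) as (_ & _ & _ & _ & _ & _ & Q7).
    rewrite (proj1 (P0 p Hp)), H13 in Q7 by trivial.
    unfold dom in Hp; rewrite <- Q7; field; lra.
  - intros i p Hp; destruct (Hc p Hp) as (H1 & H2 & H3).
    rewrite (xi_family_ext _ c).
    + destruct i; trivial.
    + intros n Hn; destruct (Nat.eqb_spec n 13); [lia|trivial].
  - intros r t z u Hr; simpl.
    assert (E := Eb (r, t, z, u) Hr); cbn [lift3 get] in E; rewrite E; ring.
Qed.

Lemma smooth_xi_family (c : nat -> R) (i : indep) : smooth (xi_family c i).
Proof.
  assert (St : smooth (fun p => sin (get dt p))) by auto with smooth.
  assert (Ct : smooth (fun p => cos (get dt p))) by auto with smooth.
  destruct i.
  - apply (smooth_ext (fun p => (c 1%nat * get dz p + c 3%nat) * sin (get dt p)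
      + (c 2%nat * get dz p + c 4%nat) * cos (get dt p))).
    { now intros [[[r t] z] u] _. }
    auto 10 with smooth.
  - apply (smooth_ext (fun p => - / get dr p * (c 2%nat * get dz p + c 4%nat) * sin (get dt p)
      + / get dr p * (c 1%nat * get dz p + c 3%nat) * cos (get dt p) + c 5%nat)).
    { intros [[[r t] z] u] Hp; unfold dom in Hp; cbn [get] in *; simpl; field; lra. }
    auto 10 with smooth.
  - apply (smooth_ext (fun p => - get dr p * (c 1%nat * sin (get dt p)
      + c 2%nat * cos (get dt p)) + c 6%nat)).
    { now intros [[[r t] z] u] _. }
    auto 10 with smooth.
Qed.

Ltac pd_compute :=
  match goal with |- pd ?c ?f ?p = _ =>
    destruct p as [[[? ?] ?] ?]; unfold pd; apply is_derive_unique;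
    unfold dom in *; simpl in *; auto_derive; [repeat split; lra|field; lra]
  end.

Lemma pd_xi_r (c : nat -> R) (d : coord) (p : point) : dom p ->
  pd d (xi_family c ir) p =
  match d with
  | dx ir => 0
  | dx ith => (c 1%nat * get dz p + c 3%nat) * cos (get dt p)
              - (c 2%nat * get dz p + c 4%nat) * sin (get dt p)
  | dx iz => c 1%nat * sin (get dt p) + c 2%nat * cos (get dt p)
  | du => 0
  end.
Proof. intro Hp; destruct d as [[| |]|]; pd_compute. Qed.

Lemma pd_xi_t (c : nat -> R) (d : coord) (p : point) : dom p ->
  pd d (xi_family c ith) p =
  let r := get dr p in
  match d with
  | dx ir => 1 / r ^ 2 * (c 2%nat * get dz p + c 4%nat) * sin (get dt p)
             - 1 / r ^ 2 * (c 1%nat * get dz p + c 3%nat) * cos (get dt p)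
  | dx ith => - (1 / r) * (c 2%nat * get dz p + c 4%nat) * cos (get dt p)
              - 1 / r * (c 1%nat * get dz p + c 3%nat) * sin (get dt p)
  | dx iz => - (1 / r) * c 2%nat * sin (get dt p) + 1 / r * c 1%nat * cos (get dt p)
  | du => 0
  end.
Proof. intro Hp; destruct d as [[| |]|]; pd_compute. Qed.

Lemma pd_xi_z (c : nat -> R) (d : coord) (p : point) : dom p ->
  pd d (xi_family c iz) p =
  match d with
  | dx ir => - (c 1%nat * sin (get dt p) + c 2%nat * cos (get dt p))
  | dx ith => - get dr p * (c 1%nat * cos (get dt p) - c 2%nat * sin (get dt p))
  | dx iz => 0
  | du => 0
  end.
Proof. intro Hp; destruct d as [[| |]|]; pd_compute. Qed.

Lemma pd_pd_xi_r (c : nat -> R) (i : indep) (p : point) : dom p ->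
  pd (dx i) (pd (dx i) (xi_family c ir)) p =
  match i with ith => - xi_family c ir p | _ => 0 end.
Proof.
  intro Hp; rewrite (pd_ext _ _ _ p (pd_xi_r c (dx i)) Hp).
  destruct i; pd_compute.
Qed.

Lemma pd_pd_xi_t (c : nat -> R) (i : indep) (p : point) : dom p ->
  pd (dx i) (pd (dx i) (xi_family c ith)) p =
  let r := get dr p in
  match i with
  | ir => - 2 / r ^ 3 * (c 2%nat * get dz p + c 4%nat) * sin (get dt p)
          + 2 / r ^ 3 * (c 1%nat * get dz p + c 3%nat) * cos (get dt p)
  | ith => 1 / r * (c 2%nat * get dz p + c 4%nat) * sin (get dt p)
           - 1 / r * (c 1%nat * get dz p + c 3%nat) * cos (get dt p)
  | iz => 0
  end.
Proof.
  intro Hp; rewrite (pd_ext _ _ _ p (pd_xi_t c (dx i)) Hp).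
  destruct i; destruct p as [[[r t] z] u]; unfold pd; apply is_derive_unique;
    unfold dom in *; simpl in *; (auto_derive; [repeat split; nra|field; lra]).
Qed.

Lemma pd_pd_xi_z (c : nat -> R) (i : indep) (p : point) : dom p ->
  pd (dx i) (pd (dx i) (xi_family c iz)) p =
  match i with
  | ith => get dr p * (c 1%nat * sin (get dt p) + c 2%nat * cos (get dt p))
  | _ => 0
  end.
Proof.
  intro Hp; rewrite (pd_ext _ _ _ p (pd_xi_z c (dx i)) Hp).
  destruct i; pd_compute.
Qed.

Lemma superposed_symmetry (k : R) (v : vfield) (c : nat -> R) (b : R -> R -> R -> R) :
  helmholtz_solution k b -> superposed_field c b v -> inf_symmetry k v.
Proof.
  intros [Hb Pb] [Hx Hu].
  assert (Eu : forall p, dom p -> v du p = lift3 b p + c 13%nat * get du p).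
  { intros [[[r t] z] u] Hp; now apply Hu. }
  assert (Hs : forall d, smooth (v d)).
  { intros [i|].
    - apply (smooth_ext (xi_family c i)); [|apply smooth_xi_family].
      intros; symmetry; now apply Hx.
    - apply (smooth_ext (fun p => lift3 b p + c 13%nat * get du p)).
      + intros; symmetry; now apply Eu.
      + auto with smooth. }
  split; trivial.
  intros j Hj Hh; rewrite prolong2_helmholtz by trivial.
  assert (U : forall i p, dom p -> pd du (v (dx i)) p = 0).
  { intros i p Hp; rewrite (pd_ext du _ (xi_family c i)) by auto.
    destruct i; [rewrite pd_xi_r|rewrite pd_xi_t|rewrite pd_xi_z]; trivial. }
  assert (Ubu : forall p, dom p -> pd du (lift3 b) p = 0).
  { intros [[[r t] z] u] _; exact (Derive_const (b r t z) u). }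
  assert (Hu1 : forall d p, dom p -> pd d (v du) p =
    match d with du => c 13%nat | _ => pd d (lift3 b) p end).
  { intros d p Hp; rewrite (pd_ext d _ _ p Eu Hp).
    rewrite pd_plus, pd_mult, pd_const, pd_get by auto 10 with smooth.
    destruct d as [[| |]|]; simpl; rewrite ?Ubu by trivial; ring. }
  assert (Hu2 : forall i p, dom p -> pd (dx i) (pd (dx i) (v du)) p =
     pds [dx i; dx i] (lift3 b) p).
  { intros i p Hp; now apply pd_ext; [apply (Hu1 (dx i))|]. }
  assert (Hu3 : forall d p, dom p -> pd d (pd du (v du)) p = 0).
  { intros d p Hp; rewrite (pd_ext d _ (fun _ => c 13%nat)); auto.
    - apply pd_const.
    - apply (Hu1 du). }
  unfold prol1, prol2, sum_indep.
  assert (D1x : forall i l, D1 i (v (dx l)) j = pd (dx i) (v (dx l)) (base j)).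
  { intros i l; now apply D1_indep_u; [apply U|]. }
  assert (D2x : forall i l, D2 i (v (dx l)) j = pd (dx i) (pd (dx i) (v (dx l))) (base j)).
  { intros i l; now apply D2_indep_u; [|apply U|]. }
  rewrite !D2x, !D1x, !D2_expand by auto; unfold D1.
  assert (Hp : dom (base j)) by exact Hj.
  rewrite !Hu2, !Hu3, !Hu1 by trivial.
  rewrite !(fun i => pd_ext _ _ _ _ (Hx i) Hp).
  rewrite (pd_ext dr (pd dr (v dr)) (pd dr (xi_family c ir))),
    (pd_ext dt (pd dt (v dr)) (pd dt (xi_family c ir))),
    (pd_ext dz (pd dz (v dr)) (pd dz (xi_family c ir))),
    (pd_ext dr (pd dr (v dt)) (pd dr (xi_family c ith))),
    (pd_ext dt (pd dt (v dt)) (pd dt (xi_family c ith))),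
    (pd_ext dz (pd dz (v dt)) (pd dz (xi_family c ith))),
    (pd_ext dr (pd dr (v dz)) (pd dr (xi_family c iz))),
    (pd_ext dt (pd dt (v dz)) (pd dt (xi_family c iz))),
    (pd_ext dz (pd dz (v dz)) (pd dz (xi_family c iz)))
    by (trivial; intros; apply pd_ext; trivial; apply Hx).
  rewrite !pd_pd_xi_r, !pd_pd_xi_t, !pd_pd_xi_z, !pd_xi_r, !pd_xi_t, !pd_xi_z by trivial.
  rewrite Eu, Hx by trivial.
  specialize (Pb (base j) Hp); unfold helmholtz in Hh.
  set (brr := pds [dr; dr] (lift3 b) (base j)) in *.
  set (btt := pds [dt; dt] (lift3 b) (base j)) in *.
  set (bzz := pds [dz; dz] (lift3 b) (base j)) in *.
  set (br := pd dr (lift3 b) (base j)) in *.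
  set (bt := pd dt (lift3 b) (base j)) in *.
  set (bz := pd dz (lift3 b) (base j)) in *.
  set (bb := lift3 b (base j)) in *.
  clearbody brr btt bzz br bt bz bb.
  unfold xi_family, base in *; cbn [get ind1 mindex_incr] in *; unfold jdom in Hj.
  set (r := jx j ir) in *; set (t := jx j ith) in *; set (z := jx j iz) in *.
  (* The equation for [b] eliminates b_rr and the equation on the jet eliminates u_rr; what remains
     is an algebraic identity. *)
  assert (Eb : brr = - (/ r * br + / r ^ 2 * btt + bzz + k ^ 2 * bb)) by lra.
  assert (Ej : ju j (2, 0, 0)%nat = - (/ r * ju j (1, 0, 0)%nat + / r ^ 2 * ju j (0, 2, 0)%nat
    + ju j (0, 0, 2)%nat + k ^ 2 * ju j (0, 0, 0)%nat)) by lra.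
  rewrite Eb, Ej; field; unfold dom in Hp; simpl in Hp; lra.
Qed.

(** * The Lie algebra *)

(** The second derivatives of [f] cancel by symmetry, so the commutator is again a vector field,
    determined by its components. *)
Lemma commutator_of_components (v w x : vfield) :
  (forall e, smooth (v e)) -> (forall e, smooth (w e)) ->
  (forall e p, dom p -> act v (w e) p - act w (v e) p = x e p) ->
  is_commutator v w x.
Proof.
  intros Hv Hw Hx f Hf p Hp.
  unfold act at 5; unfold sum_indep; rewrite <- !Hx by trivial.
  unfold act, sum_indep.
  rewrite !pd_plus, !pd_mult by auto 10 with smooth.
  rewrite (pd_comm f dt dr), (pd_comm f dz dr), (pd_comm f du dr),
    (pd_comm f dz dt), (pd_comm f du dt), (pd_comm f du dz) by trivial.
  ring.
Qed.

Definition zero3 : R -> R -> R -> R := fun _ _ _ => 0.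

(** The Lie bracket expressed in the parameters of the family; index 13 falls in the zero branch
    because [X 3] is central. *)
Definition family_bracket (c d : nat -> R) (n : nat) : R :=
  match n with
  | 1%nat => c 2%nat * d 5%nat - c 5%nat * d 2%nat
  | 2%nat => c 5%nat * d 1%nat - c 1%nat * d 5%nat
  | 3%nat => c 4%nat * d 5%nat - c 5%nat * d 4%nat + c 6%nat * d 1%nat - c 1%nat * d 6%nat
  | 4%nat => c 5%nat * d 3%nat - c 3%nat * d 5%nat + c 6%nat * d 2%nat - c 2%nat * d 6%nat
  | 5%nat => c 1%nat * d 2%nat - c 2%nat * d 1%nat
  | 6%nat => c 1%nat * d 3%nat - c 3%nat * d 1%nat + c 2%nat * d 4%nat - c 4%nat * d 2%nat
  | _ => 0
  end.

Lemma superposed_zero_du (c : nat -> R) (v : vfield) :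
  superposed_field c zero3 v -> forall p, dom p -> v du p = c 13%nat * get du p.
Proof.
  intros [_ H] [[[r t] z] u] Hp; rewrite H by exact Hp; unfold zero3; simpl; ring.
Qed.

Lemma smooth_superposed_zero (c : nat -> R) (v : vfield) :
  superposed_field c zero3 v -> forall e, smooth (v e).
Proof.
  intros Hv [i|].
  - apply (smooth_ext (xi_family c i)); [|apply smooth_xi_family].
    intros; symmetry; now apply Hv.
  - apply (smooth_ext (fun p => c 13%nat * get du p)); [|auto with smooth].
    intros; symmetry; now apply superposed_zero_du.
Qed.

Lemma commutator_superposed (c d : nat -> R) (v w x : vfield) :
  superposed_field c zero3 v -> superposed_field d zero3 w ->
  superposed_field (family_bracket c d) zero3 x -> is_commutator v w x.
Proof.
  intros Hv Hw Hx.
  apply commutator_of_components;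
    [exact (smooth_superposed_zero c v Hv)|exact (smooth_superposed_zero d w Hw)|].
  assert (P : forall c v e p, superposed_field c zero3 v -> dom p ->
    pd e (v du) p = if coord_eq_dec e du then c 13%nat else 0).
  { clear; intros c v e p Hv Hp.
    rewrite (pd_ext e _ _ p (superposed_zero_du c v Hv) Hp).
    rewrite pd_mult, pd_const, pd_get by auto with smooth.
    destruct (coord_eq_dec e du); ring. }
  assert (Q : forall c v e i p, superposed_field c zero3 v -> dom p ->
    pd e (v (dx i)) p = pd e (xi_family c i) p).
  { clear; intros c v e i p Hv Hp; apply pd_ext; trivial; apply Hv. }
  intros [i|] p Hp; unfold act, sum_indep.
  - rewrite !(Q c v), !(Q d w), (proj1 Hx) by trivial.
    rewrite !(superposed_zero_du c v Hv), !(superposed_zero_du d w Hw) by trivial.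
    destruct Hv as [Hv _], Hw as [Hw _]; rewrite !Hv, !Hw by trivial.
    assert (SC : cos (get dt p) ^ 2 = 1 - sin (get dt p) ^ 2).
    { pose proof (sin2_cos2' (get dt p)); simpl; lra. }
    destruct i; [rewrite !pd_xi_r|rewrite !pd_xi_t|rewrite !pd_xi_z]; trivial;
    destruct p as [[[r t] z] u]; unfold dom in Hp;
      cbn [xi_family get family_bracket] in *; (field_simplify; [|lra..]);
      rewrite ?SC; field; lra.
  - rewrite !(P c v), !(P d w) by trivial.
    rewrite (superposed_zero_du c v Hv), (superposed_zero_du d w Hw),
      (superposed_zero_du _ x Hx) by trivial.
    simpl; ring.
Qed.

(** Coordinates in the basis converted to parameters of the family; the signs reflect that [X 5] and
    [X 6] are opposite to the fields of [c 4] and [c 2]. *)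
Definition coef_family (a : nat -> R) (n : nat) : R :=
  match n with
  | 1%nat => a 7%nat | 2%nat => - a 6%nat | 3%nat => a 4%nat | 4%nat => - a 5%nat | 5%nat => a 1%nat | 6%nat => a 2%nat | 13%nat => a 3%nat
  | _ => 0
  end.

Lemma lincomb_expand (a : nat -> R) (e : coord) (p : point) :
  lincomb a e p = a 1%nat * X 1 e p + a 2%nat * X 2 e p + a 3%nat * X 3 e p
    + a 4%nat * X 4 e p + a 5%nat * X 5 e p + a 6%nat * X 6 e p + a 7%nat * X 7 e p.
Proof.
  unfold lincomb; rewrite !sum_n_Sm, sum_n_m_zero by lia.
  change plus with Rplus; change zero with 0; ring.
Qed.

Lemma lincomb_superposed (a : nat -> R) :
  superposed_field (coef_family a) zero3 (lincomb a).
Proof.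
  split.
  - intros i [[[r t] z] u] Hp; unfold dom in Hp; rewrite lincomb_expand.
    destruct i; simpl in *; field; lra.
  - intros r t z u Hr; rewrite lincomb_expand; simpl; unfold zero3; ring.
Qed.

Lemma superposed_zero_eq (c : nat -> R) (v w : vfield) :
  superposed_field c zero3 v -> superposed_field c zero3 w -> vf_eq v w.
Proof.
  intros Hv Hw [i|] p Hp.
  - now rewrite (proj1 Hv), (proj1 Hw).
  - now rewrite (superposed_zero_du c v Hv), (superposed_zero_du c w Hw).
Qed.

Lemma superposed_zero_vf_eq (c : nat -> R) (v w : vfield) :
  vf_eq v w -> superposed_field c zero3 w -> superposed_field c zero3 v.
Proof.
  intros E [H1 H2]; split.
  - intros i p Hp; rewrite E; auto.
  - intros r t z u Hr; rewrite E; auto.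
Qed.

Lemma superposed_family_ext (c d : nat -> R) (v : vfield) :
  (forall n, (1 <= n <= 6)%nat -> c n = d n) -> c 13%nat = d 13%nat ->
  superposed_field c zero3 v -> superposed_field d zero3 v.
Proof.
  intros E E13 [H1 H2]; split.
  - intros i p Hp; rewrite <- (xi_family_ext c d) by trivial; auto.
  - intros; rewrite <- E13; auto.
Qed.

Lemma in_g_lincomb (v : vfield) :
  in_g v <-> exists a : nat -> R, vf_eq v (lincomb a).
Proof.
  split.
  - intros [c Hc].
    (* The inverse of [coef_family]. *)
    exists (fun n => match n with
      1%nat => c 5%nat | 2%nat => c 6%nat | 3%nat => c 13%nat | 4%nat => c 3%nat | 5%nat => - c 4%nat | 6%nat => - c 2%nat | _ => c 1%nat
      end).
    apply (superposed_zero_eq c); [exact Hc|].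
    eapply superposed_family_ext; [| |apply lincomb_superposed]; [|reflexivity].
    intros n Hn; do 7 (destruct n as [|n]; [first [lia|simpl; ring]|]); lia.
  - intros [a Ha]; exists (coef_family a).
    apply (superposed_zero_vf_eq _ _ _ Ha), lincomb_superposed.
Qed.

Lemma in_g_commutator (v w : vfield) :
  in_g v -> in_g w -> exists x : vfield, in_g x /\ is_commutator v w x.
Proof.
  intros [c Hc] [d Hd].
  set (x := fun (e : coord) (p : point) => match e with
    | dx i => xi_family (family_bracket c d) i p | du => 0 end).
  assert (Hx : superposed_field (family_bracket c d) zero3 x).
  { split; [reflexivity|]; intros; simpl; unfold zero3; ring. }
  exists x; split; [now exists (family_bracket c d)|].
  now apply (commutator_superposed c d).
Qed.

Lemma lincomb_independent (a : nat -> R) :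
  vf_eq (lincomb a) vzero -> forall n : nat, (1 <= n <= 7)%nat -> a n = 0.
Proof.
  intros H.
  assert (E : forall e r t z u, 0 < r -> lincomb a e (r, t, z, u) = 0) by (intros; now apply H).
  (* At theta = 0 or pi/2 only one of sine and cosine survives, and z = 0 or 1 separates [X 4],
     [X 5] from [X 6], [X 7]. *)
  pose proof (E dr 1 0 0 1 Rlt_0_1) as H5.
  pose proof (E dr 1 (PI / 2) 0 1 Rlt_0_1) as H4.
  pose proof (E dr 1 0 1 1 Rlt_0_1) as H6.
  pose proof (E dr 1 (PI / 2) 1 1 Rlt_0_1) as H7.
  pose proof (E dt 1 0 0 1 Rlt_0_1) as H1.
  pose proof (E dz 1 0 0 1 Rlt_0_1) as H2.
  pose proof (E du 1 0 0 1 Rlt_0_1) as H3.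
  rewrite lincomb_expand in *; simpl in *.
  rewrite ?sin_0, ?cos_0, ?sin_PI2, ?cos_PI2 in *.
  intros n Hn; do 8 (destruct n as [|n]; [first [lia|lra]|]); lia.
Qed.

Definition unit_coef (m n : nat) : R := if Nat.eqb n m then 1 else 0.

Lemma X_superposed (m : nat) :
  (1 <= m <= 7)%nat -> superposed_field (coef_family (unit_coef m)) zero3 (X m).
Proof.
  intro Hm; apply (superposed_zero_vf_eq _ _ (lincomb (unit_coef m)));
    [|apply lincomb_superposed].
  intros e p Hp; rewrite lincomb_expand; unfold unit_coef.
  do 8 (destruct m as [|m]; [first [lia|cbn [Nat.eqb]; ring]|]); lia.
Qed.

Lemma basis_commutators (m n : nat) :
  (1 <= m)%nat -> (m < n)%nat -> (n <= 7)%nat ->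
  is_commutator (X m) (X n) (bracket_table m n).
Proof.
  intros H1 H2 H3.
  eapply commutator_superposed; [apply X_superposed; lia|apply X_superposed; lia|].
  do 8 (destruct m as [|m]; [first [lia|
    do 8 (destruct n as [|n]; [first [lia|
      split; [intros i [[[r t] z] u] Hp; unfold dom in Hp; destruct i;
              simpl in *; unfold vopp, vzero, unit_coef; simpl; field; lra
             |intros r t z u Hr; simpl; unfold vopp, vzero, zero3; simpl; ring]]|]);
    lia]|]); lia.
Qed.

Lemma helmholtz_solution_zero (k : R) : helmholtz_solution k zero3.
Proof.
  assert (E : forall q, dom q -> 0 = lift3 zero3 q) by (now intros [[[r t] z] u] _).
  split.
  - apply (smooth_ext (fun _ => 0)); trivial; apply smooth_const.
  - intros p Hp.
    assert (P : forall l, pds l (lift3 zero3) p = 0).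
    { intro l; rewrite <- (pds_ext l (fun _ => 0) _ E) by trivial.
      revert p Hp; induction l as [|d l IH]; intros p Hp; simpl; trivial.
      now apply pd_of_zero. }
    change (pd dr (lift3 zero3) p) with (pds [dr] (lift3 zero3) p).
    rewrite !P, <- E by trivial; ring.
Qed.

Lemma in_g_symmetry (k : R) (v : vfield) : in_g v -> inf_symmetry k v.
Proof.
  intros [c Hc]; apply (superposed_symmetry k v c zero3); trivial.
  apply helmholtz_solution_zero.
Qed.

(** * Complex functions of a real variable *)

Lemma is_derive_Rmult (f g : R -> R) (x df dg : R) :
  is_derive f x df -> is_derive g x dg ->
  is_derive (fun t => f t * g t) x (df * g x + f x * dg).
Proof. intros Hf Hg; apply (is_derive_mult f g); trivial; exact Rmult_comm. Qed.

(** Taken by components, so that the real mean value theorem and the real power series lemmas apply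
    directly. *)
Definition cderiv (f : R -> C) (x : R) (l : C) : Prop :=
  is_derive (fun t => Re (f t)) x (Re l) /\ is_derive (fun t => Im (f t)) x (Im l).

Lemma cderiv_ext_loc (f g : R -> C) (x : R) (l : C) :
  locally x (fun t => f t = g t) -> cderiv f x l -> cderiv g x l.
Proof.
  intros E [H1 H2]; split; [apply (is_derive_ext_loc (fun t => Re (f t)))
    |apply (is_derive_ext_loc (fun t => Im (f t)))]; trivial;
  revert E; apply filter_imp; intros t Et; now rewrite Et.
Qed.

Lemma cderiv_ext (f g : R -> C) (x : R) (l : C) :
  (forall t, f t = g t) -> cderiv f x l -> cderiv g x l.
Proof. intro E; apply cderiv_ext_loc, filter_forall, E. Qed.

Lemma cderiv_eq (f : R -> C) (x : R) (l l' : C) : cderiv f x l -> l = l' -> cderiv f x l'.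
Proof. now intros H <-. Qed.

Lemma cderiv_const (a : C) (x : R) : cderiv (fun _ => a) x 0.
Proof.
  split; [exact (is_derive_const (V:=R_NormedModule) (Re a) x)
         |exact (is_derive_const (V:=R_NormedModule) (Im a) x)].
Qed.

Lemma cderiv_RtoC (f : R -> R) (x l : R) :
  is_derive f x l -> cderiv (fun t => RtoC (f t)) x (RtoC l).
Proof. intro H; split; [exact H|exact (is_derive_const (V:=R_NormedModule) 0 x)]. Qed.

Lemma cderiv_id (x : R) : cderiv RtoC x 1.
Proof. exact (cderiv_RtoC (fun t => t) x 1 (is_derive_id x)). Qed.

Lemma cderiv_plus (f g : R -> C) (x : R) (df dg : C) :
  cderiv f x df -> cderiv g x dg -> cderiv (fun t => f t + g t)%C x (df + dg)%C.
Proof.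
  intros [F1 F2] [G1 G2]; split.
  - apply (is_derive_plus (fun t => Re (f t)) (fun t => Re (g t))); trivial.
  - apply (is_derive_plus (fun t => Im (f t)) (fun t => Im (g t))); trivial.
Qed.

Lemma cderiv_mult (f g : R -> C) (x : R) (df dg : C) :
  cderiv f x df -> cderiv g x dg ->
  cderiv (fun t => f t * g t)%C x (df * g x + f x * dg)%C.
Proof.
  intros [F1 F2] [G1 G2]; split.
  - evar_last.
    + apply (is_derive_minus (fun t => Re (f t) * Re (g t)) (fun t => Im (f t) * Im (g t)));
        apply is_derive_Rmult; eassumption.
    + unfold minus, plus, opp, Re, Im; simpl; ring.
  - evar_last.
    + apply (is_derive_plus (fun t => Re (f t) * Im (g t)) (fun t => Im (f t) * Re (g t)));
        apply is_derive_Rmult; eassumption.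
    + unfold plus, Re, Im; simpl; ring.
Qed.

Lemma cderiv_scal (a : C) (f : R -> C) (x : R) (df : C) :
  cderiv f x df -> cderiv (fun t => a * f t)%C x (a * df)%C.
Proof.
  intro H; apply (cderiv_eq _ _ (0 * f x + a * df)%C); [|ring].
  apply cderiv_mult; trivial; apply cderiv_const.
Qed.

Lemma cderiv_opp (f : R -> C) (x : R) (df : C) :
  cderiv f x df -> cderiv (fun t => - f t)%C x (- df)%C.
Proof.
  intro H; apply (cderiv_ext (fun t => -1 * f t)%C); [intro; ring|].
  apply (cderiv_eq _ _ (-1 * df)%C); [now apply cderiv_scal|ring].
Qed.

Lemma cderiv_minus (f g : R -> C) (x : R) (df dg : C) :
  cderiv f x df -> cderiv g x dg -> cderiv (fun t => f t - g t)%C x (df - dg)%C.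
Proof. intros F G; apply cderiv_plus; trivial; now apply cderiv_opp. Qed.

Lemma cderiv_comp (f : R -> C) (g : R -> R) (x dg : R) (df : C) :
  cderiv f (g x) df -> is_derive g x dg -> cderiv (fun t => f (g t)) x (RtoC dg * df)%C.
Proof.
  intros [F1 F2] G; split.
  - evar_last; [apply (is_derive_comp (fun t => Re (f t)) g); eassumption|].
    unfold scal, mult, Re, Im; simpl; unfold mult; simpl; ring.
  - evar_last; [apply (is_derive_comp (fun t => Im (f t)) g); eassumption|].
    unfold scal, mult, Re, Im; simpl; unfold mult; simpl; ring.
Qed.

Lemma Cexp_plus (a b : C) : Cexp (a + b) = (Cexp a * Cexp b)%C.
Proof.
  destruct a as [a1 a2], b as [b1 b2]; unfold Cexp; simpl.
  rewrite exp_plus, cos_plus, sin_plus; apply injective_projections; simpl; ring.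
Qed.

Lemma Cexp_0 : Cexp 0 = RtoC 1.
Proof. unfold Cexp; simpl; rewrite exp_0, cos_0, sin_0; unfold RtoC; f_equal; ring. Qed.

Lemma Cexp_opp_r (a : C) : (Cexp a * Cexp (- a))%C = 1.
Proof. rewrite <- Cexp_plus, Cplus_opp_r; apply Cexp_0. Qed.

Lemma Cexp_neq_0 (a : C) : Cexp a <> 0.
Proof.
  intro E; pose proof (Cexp_opp_r a) as H; rewrite E, Cmult_0_l in H.
  injection H; lra.
Qed.

Lemma Cexp_RtoC (x : R) : Cexp (RtoC x) = RtoC (exp x).
Proof. unfold Cexp; simpl; rewrite cos_0, sin_0; unfold RtoC; f_equal; ring. Qed.

Lemma Cmod_Cexp (a : C) : Cmod (Cexp a) = exp (Re a).
Proof.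
  unfold Cmod, Cexp; simpl fst; simpl snd.
  replace _ with (sqrt (exp (Re a) ^ 2)).
  - rewrite <- Rsqr_pow2; apply sqrt_Rsqr, Rlt_le, exp_pos.
  - f_equal; pose proof (sin2_cos2 (Im a)) as H; unfold Rsqr in H.
    transitivity (exp (Re a) ^ 2 * (sin (Im a) * sin (Im a) + cos (Im a) * cos (Im a)));
      [rewrite H|]; ring.
Qed.

Lemma cderiv_Cexp (f : R -> C) (x : R) (df : C) :
  cderiv f x df -> cderiv (fun t => Cexp (f t)) x (df * Cexp (f x))%C.
Proof.
  intros [F1 F2]; split; unfold Cexp; simpl.
  - evar_last.
    + apply is_derive_Rmult.
      * apply (is_derive_comp exp (fun t => Re (f t))); [apply is_derive_exp|eassumption].
      * apply (is_derive_comp cos (fun t => Im (f t))); [apply is_derive_cos|eassumption].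
    + unfold scal; simpl; unfold mult, Re, Im; simpl; ring.
  - evar_last.
    + apply is_derive_Rmult.
      * apply (is_derive_comp exp (fun t => Re (f t))); [apply is_derive_exp|eassumption].
      * apply (is_derive_comp sin (fun t => Im (f t))); [apply is_derive_sin|eassumption].
    + unfold scal; simpl; unfold mult, Re, Im; simpl; ring.
Qed.

Lemma cderiv_Cexp_scal (a : C) (g : R -> R) (x dg : R) :
  is_derive g x dg ->
  cderiv (fun t => Cexp (a * RtoC (g t))) x (a * RtoC dg * Cexp (a * RtoC (g x)))%C.
Proof. intro H; apply (cderiv_Cexp (fun t => a * RtoC (g t))%C), cderiv_scal, cderiv_RtoC, H. Qed.

(** [P] describes an interval: the half line for radial functions, the whole line for
    exponentials. *)
Lemma cderiv_zero_const (f : R -> C) (P : R -> Prop) :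
  (forall x y z, P x -> P z -> x <= y <= z -> P y) ->
  (forall x, P x -> cderiv f x 0) -> forall x y, P x -> P y -> f x = f y.
Proof.
  intros HP H.
  assert (L : forall x y, x < y -> P x -> P y -> f x = f y).
  { intros x y Hxy Hx Hy; apply injective_projections.
    - apply (eq_is_derive (V:=R_NormedModule) (fun t => Re (f t)) x y); trivial.
      intros t Ht; apply (H t); eauto.
    - apply (eq_is_derive (V:=R_NormedModule) (fun t => Im (f t)) x y); trivial.
      intros t Ht; apply (H t); eauto. }
  intros x y Hx Hy; destruct (Rtotal_order x y) as [h|[->|h]]; trivial; auto.
  symmetry; auto.
Qed.

(** * Power series with complex coefficients *)

Definition CP (a : nat -> C) (x : R) : C :=
  (PSeries (fun n => Re (a n)) x, PSeries (fun n => Im (a n)) x).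

(** A growth bound stronger than an infinite radius of convergence. It is stable under factors
    linear in [n], derivation and shifts, the operations met with Frobenius series. *)
Definition entire (a : nat -> C) : Prop :=
  exists M K : R, 0 <= K /\ forall n, Cmod (a n) <= M * (K ^ n / INR (fact n)).

Lemma pow_div_fact_le_exp (x : R) (n : nat) : 0 <= x -> x ^ n / INR (fact n) <= exp x.
Proof.
  intro Hx; refine (Rle_trans _ _ _ _ (exp_ge_taylor x n Hx)).
  destruct n as [|n]; [simpl; lra|].
  rewrite tech5.
  assert (0 <= sum_f_R0 (fun k => x ^ k / INR (fact k)) n); [|lra].
  apply cond_pos_sum; intro m; apply Rmult_le_pos; [now apply pow_le|].
  apply Rlt_le, Rinv_0_lt_compat, INR_fact_lt_0.
Qed.

(** For every [r] the terms stay below [M * exp (K * Rabs r)], and boundedness of the terms at [r]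
    bounds the radius below by [r]. *)
Lemma CV_radius_entire (a : nat -> R) (M K : R) :
  0 <= K -> (forall n, Rabs (a n) <= M * (K ^ n / INR (fact n))) ->
  CV_radius a = p_infty.
Proof.
  intros HK H; destruct (CV_radius_bounded a) as [B _].
  assert (HM : 0 <= M).
  { specialize (H O); simpl in H; pose proof (Rabs_pos (a O)); lra. }
  assert (U : forall r, Rbar_le (Finite r) (CV_radius a)).
  { intro r; apply B; exists (M * exp (K * Rabs r)); intro n.
    rewrite Rabs_mult, <- RPow_abs.
    apply Rle_trans with (M * (K ^ n / INR (fact n)) * Rabs r ^ n).
    - apply Rmult_le_compat_r; [apply pow_le, Rabs_pos|apply H].
    - rewrite Rmult_assoc; apply Rmult_le_compat_l; trivial.
      refine (Rle_trans _ _ _ _ (pow_div_fact_le_exp (K * Rabs r) n _)).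
      + rewrite Rpow_mult_distr; unfold Rdiv; right; ring.
      + apply Rmult_le_pos; trivial; apply Rabs_pos. }
  destruct (CV_radius a) as [r| |]; trivial.
  - specialize (U (r + 1)); simpl in U; lra.
  - elim (U 0).
Qed.

Lemma im_le_Cmod (c : C) : Rabs (Im c) <= Cmod c.
Proof. eapply Rle_trans; [apply Rmax_r|apply Rmax_Cmod]. Qed.

Lemma entire_radius (a : nat -> C) : entire a ->
  CV_radius (fun n => Re (a n)) = p_infty /\ CV_radius (fun n => Im (a n)) = p_infty.
Proof.
  intros (M & K & HK & H); split; apply (CV_radius_entire _ M K HK); intro n.
  - eapply Rle_trans; [apply re_le_Cmod|apply H].
  - eapply Rle_trans; [apply im_le_Cmod|apply H].
Qed.

Lemma entire_ex_pseries (a : nat -> C) (x : R) : entire a ->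
  ex_pseries (fun n => Re (a n)) x /\ ex_pseries (fun n => Im (a n)) x.
Proof.
  intro H; destruct (entire_radius a H) as [E1 E2].
  split; apply CV_radius_inside; [rewrite E1|rewrite E2]; exact I.
Qed.

Lemma entire_ext (a b : nat -> C) : (forall n, a n = b n) -> entire a -> entire b.
Proof.
  intros E (M & K & HK & H); exists M, K; split; trivial; intro n; rewrite <- E; auto.
Qed.

Lemma entire_plus (a b : nat -> C) :
  entire a -> entire b -> entire (fun n => a n + b n)%C.
Proof.
  intros (M & K & HK & H) (M' & K' & HK' & H').
  assert (P : forall M K n x, 0 <= K -> Cmod x <= M * (K ^ n / INR (fact n)) ->
     forall K', K <= K' -> Cmod x <= Rabs M * (K' ^ n / INR (fact n))).
  { intros m k n x Hk Hx k' Hkk; eapply Rle_trans; [exact Hx|].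
    apply Rle_trans with (Rabs m * (k ^ n / INR (fact n))).
    - apply Rmult_le_compat_r; [|apply Rle_abs].
      apply Rmult_le_pos; [now apply pow_le|].
      apply Rlt_le, Rinv_0_lt_compat, INR_fact_lt_0.
    - apply Rmult_le_compat_l; [apply Rabs_pos|].
      apply Rmult_le_compat_r; [apply Rlt_le, Rinv_0_lt_compat, INR_fact_lt_0|].
      apply pow_incr; lra. }
  exists (Rabs M + Rabs M'), (Rmax K K'); split.
  { eapply Rle_trans; [exact HK|apply Rmax_l]. }
  intro n; eapply Rle_trans; [apply Cmod_triangle|].
  rewrite Rmult_plus_distr_r; apply Rplus_le_compat.
  - apply (P M K); trivial; apply Rmax_l.
  - apply (P M' K'); trivial; apply Rmax_r.
Qed.

(** The factor [n] is absorbed by doubling [K], since n <= 2^n. *)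
Lemma entire_linear_coef (r : C) (a : nat -> C) :
  entire a -> entire (fun n => (r + 2 * RtoC (INR n)) * a n)%C.
Proof.
  intros (M & K & HK & H); exists ((Cmod r + 2) * M), (2 * K); split; [lra|].
  intro n; rewrite Cmod_mult, Rpow_mult_distr.
  assert (Hn : INR n <= 2 ^ n).
  { clear; induction n as [|n IH]; [simpl; lra|rewrite S_INR; simpl].
    pose proof (pow_R1_Rle 2 n); lra. }
  assert (H1 : Cmod (r + 2 * RtoC (INR n)) <= (Cmod r + 2) * 2 ^ n).
  { eapply Rle_trans; [apply Cmod_triangle|].
    rewrite Cmod_mult, !Cmod_R, (Rabs_pos_eq (INR n)) by apply pos_INR.
    rewrite Rabs_pos_eq by lra.
    pose proof (Cmod_ge_0 r); pose proof (pow_R1_Rle 2 n); nra. }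
  replace ((Cmod r + 2) * M * (2 ^ n * K ^ n / INR (fact n)))
    with (((Cmod r + 2) * 2 ^ n) * (M * (K ^ n / INR (fact n)))) by (unfold Rdiv; ring).
  apply Rmult_le_compat; auto using Cmod_ge_0.
Qed.

Lemma entire_scal (c : C) (a : nat -> C) : entire a -> entire (fun n => c * a n)%C.
Proof.
  intros (M & K & HK & H); exists (Cmod c * M), K; split; trivial; intro n.
  rewrite Cmod_mult, Rmult_assoc; apply Rmult_le_compat_l; auto using Cmod_ge_0.
Qed.

Lemma entire_der (a : nat -> C) :
  entire a -> entire (fun n => RtoC (INR (S n)) * a (S n))%C.
Proof.
  intros (M & K & HK & H); exists (M * K), K; split; trivial; intro n.
  rewrite Cmod_mult, Cmod_R, Rabs_pos_eq by apply pos_INR.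
  replace (M * K * (K ^ n / INR (fact n))) with
    (INR (S n) * (M * (K ^ S n / INR (fact (S n))))).
  - apply Rmult_le_compat_l; [apply pos_INR|apply H].
  - rewrite fact_simpl, mult_INR; cbn [pow]; field; split;
      [apply INR_fact_neq_0|apply not_0_INR; lia].
Qed.

Lemma CP_ext (a b : nat -> C) (x : R) : (forall n, a n = b n) -> CP a x = CP b x.
Proof. intro E; unfold CP; f_equal; apply PSeries_ext; intro n; now rewrite E. Qed.

Lemma CP_plus (a b : nat -> C) (x : R) : entire a -> entire b ->
  CP (fun n => a n + b n)%C x = (CP a x + CP b x)%C.
Proof.
  intros Ha Hb; destruct (entire_ex_pseries a x Ha), (entire_ex_pseries b x Hb).
  apply injective_projections; simpl.
  - rewrite <- PSeries_plus by trivial; apply PSeries_ext; reflexivity.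
  - rewrite <- PSeries_plus by trivial; apply PSeries_ext; reflexivity.
Qed.

Lemma CP_scal (c : C) (a : nat -> C) (x : R) : entire a ->
  CP (fun n => c * a n)%C x = (c * CP a x)%C.
Proof.
  intros Ha; destruct (entire_ex_pseries a x Ha) as [H1 H2].
  assert (S : forall k (u : nat -> R), ex_pseries u x -> ex_pseries (PS_scal k u) x).
  { intros k u Hu; apply @ex_pseries_scal; trivial; apply Rmult_comm. }
  apply injective_projections; simpl.
  - rewrite (PSeries_ext _ (PS_plus (PS_scal (fst c) (fun n => Re (a n)))
      (PS_scal (- snd c) (fun n => Im (a n))))).
    + rewrite PSeries_plus, !PSeries_scal by auto; ring.
    + intro n; unfold PS_plus, PS_scal, plus, scal; simpl; unfold mult; simpl.
      unfold Re, Im; ring.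
  - rewrite (PSeries_ext _ (PS_plus (PS_scal (fst c) (fun n => Im (a n)))
      (PS_scal (snd c) (fun n => Re (a n))))).
    + rewrite PSeries_plus, !PSeries_scal by auto; ring.
    + intro n; unfold PS_plus, PS_scal, plus, scal; simpl; unfold mult; simpl.
      unfold Re, Im; ring.
Qed.

Definition cshift (a : nat -> C) (n : nat) : C :=
  match n with O => 0 | S m => a m end.

Lemma CP_shift (a : nat -> C) (x : R) : CP (cshift a) x = (RtoC x * CP a x)%C.
Proof.
  apply injective_projections; simpl.
  - rewrite Rmult_0_l, Rminus_0_r, <- PSeries_incr_1; apply PSeries_ext.
    now intros [|n].
  - rewrite Rmult_0_l, Rplus_0_r, <- PSeries_incr_1; apply PSeries_ext.
    now intros [|n].
Qed.

Lemma CP_0 (a : nat -> C) : CP a 0 = a O.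
Proof. unfold CP; rewrite !PSeries_0; now destruct (a O). Qed.

Lemma cderiv_CP (a : nat -> C) (x : R) : entire a ->
  cderiv (CP a) x (CP (fun n => RtoC (INR (S n)) * a (S n))%C x).
Proof.
  intro Ha; destruct (entire_radius a Ha) as [E1 E2]; split; simpl.
  - evar_last; [apply (is_derive_PSeries (fun n => Re (a n))); rewrite E1; exact I|].
    apply PSeries_ext; intro n; unfold PS_derive, Re, Im, RtoC; simpl; ring.
  - evar_last; [apply (is_derive_PSeries (fun n => Im (a n))); rewrite E2; exact I|].
    apply PSeries_ext; intro n; unfold PS_derive, Re, Im, RtoC; simpl; ring.
Qed.

(** * The reciprocal Gamma function *)

Lemma RtoC_neq_0 (x : R) : x <> 0 -> RtoC x <> 0.
Proof. intros H E; apply H; now injection E. Qed.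

(** A positive factor leaves the principal argument unchanged, so no multiple of 2 pi appears. *)
Lemma Clog_scal (s : C) (r : R) : s <> 0 -> 0 < r ->
  Clog (s * RtoC r) = (Clog s + RtoC (ln r))%C.
Proof.
  intros Hs Hr; assert (Hm : 0 < Cmod s) by now apply Cmod_gt_0.
  assert (E : Cmod (s * RtoC r) = Cmod s * r).
  { rewrite Cmod_mult, Cmod_R, Rabs_pos_eq; lra. }
  assert (Ei : Im (s * RtoC r) = Im s * r) by (unfold Im; simpl; ring).
  assert (Er : Re (s * RtoC r) = Re s * r) by (unfold Re, Im; simpl; ring).
  unfold Clog; apply injective_projections; simpl.
  - rewrite E; apply ln_mult; trivial.
  - unfold Carg; rewrite E, Ei, Er, Rplus_0_r.
    replace (Re s * r / (Cmod s * r)) with (Re s / Cmod s) by (field; lra).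
    destruct (Rle_dec 0 (Im s * r)) as [h|h], (Rle_dec 0 (Im s)) as [h'|h'];
      trivial; exfalso; nra.
Qed.

Lemma Clog_1 : Clog 1 = 0.
Proof.
  unfold Clog, Carg; simpl; rewrite Cmod_1, ln_1.
  destruct (Rle_dec 0 0) as [h|h]; [|lra].
  replace (1 / 1) with 1 by field; rewrite acos_1; reflexivity.
Qed.

Lemma Cpower_pos (x : R) (w : C) : 0 < x -> Cpower (RtoC x) w = Cexp (w * RtoC (ln x)).
Proof.
  intro Hx; unfold Cpower.
  destruct (Ceq_dec (RtoC x) 0) as [E|_]; [injection E; lra|].
  replace (RtoC x) with (1 * RtoC x)%C by ring.
  rewrite Clog_scal, Clog_1; trivial; [now rewrite Cplus_0_l|].
  intro E; injection E; lra.
Qed.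

(** * Complex limits and convergence of products *)

Definition clim (u : nat -> C) (l : C) : Prop :=
  is_lim_seq (fun n => Re (u n)) (Re l) /\ is_lim_seq (fun n => Im (u n)) (Im l).

Lemma clim_Clim_seq (u : nat -> C) (l : C) : clim u l -> Clim_seq u = l.
Proof.
  intros [H1 H2]; unfold Clim_seq.
  rewrite (is_lim_seq_unique _ _ H1), (is_lim_seq_unique _ _ H2); now destruct l.
Qed.

Lemma clim_unique (u : nat -> C) (l l' : C) : clim u l -> clim u l' -> l = l'.
Proof. intros H H'; now rewrite <- (clim_Clim_seq _ _ H), (clim_Clim_seq _ _ H'). Qed.

Lemma clim_mult (u v : nat -> C) (a b : C) :
  clim u a -> clim v b -> clim (fun n => u n * v n)%C (a * b)%C.
Proof.
  intros [U1 U2] [V1 V2]; split.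
  - apply (is_lim_seq_minus' (fun n => Re (u n) * Re (v n)) (fun n => Im (u n) * Im (v n)));
      now apply is_lim_seq_mult'.
  - apply (is_lim_seq_plus' (fun n => Re (u n) * Im (v n)) (fun n => Im (u n) * Re (v n)));
      now apply is_lim_seq_mult'.
Qed.

Lemma clim_RtoC (u : nat -> R) (l : R) :
  is_lim_seq u l -> clim (fun n => RtoC (u n)) (RtoC l).
Proof. intro H; split; [exact H|apply is_lim_seq_const]. Qed.

Lemma clim_const (a : C) : clim (fun _ => a) a.
Proof. split; apply is_lim_seq_const. Qed.

Lemma clim_ext (u v : nat -> C) (l : C) :
  (forall n, (1 <= n)%nat -> u n = v n) -> clim u l -> clim v l.
Proof.
  intros E [H1 H2]; split; [apply (is_lim_seq_ext_loc (fun n => Re (u n)))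
    |apply (is_lim_seq_ext_loc (fun n => Im (u n)))]; trivial;
    exists 1%nat; intros n Hn; now rewrite E.
Qed.

Lemma Cmod_le_abs (c : C) : Cmod c <= Rabs (Re c) + Rabs (Im c).
Proof.
  destruct c as [a b].
  replace (a, b) with (RtoC a + Ci * RtoC b)%C
    by (apply injective_projections; simpl; ring).
  eapply Rle_trans; [apply Cmod_triangle|].
  rewrite Cmod_mult, Cmod_Ci, !Cmod_R; unfold Re, Im; simpl.
  rewrite Rmult_0_l, Rmult_1_l, !Rmult_0_r, Rmult_1_l, !Rminus_0_r, !Rplus_0_r, !Rplus_0_l.
  lra.
Qed.

(** Relative increments bounded by a telescoping series: this is the behaviour of partial products
    whose factors are 1 + O(1/n^2). *)
Definition near_product (u : nat -> C) (c : R) : Prop :=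
  forall n, (1 <= n)%nat -> Cmod (u (S n) - u n) <= Cmod (u n) * (c * (/ INR n - / INR (S n))).

(** The first bound multiplies the factors using 1 + d <= exp d; the second sums the increments with
    the help of the first. *)
Lemma near_product_growth (u : nat -> C) (c : R) (n m : nat) :
  0 <= c -> near_product u c -> (1 <= n)%nat ->
  Cmod (u (n + m)%nat) <= Cmod (u n) * exp (c * (/ INR n - / INR (n + m))) /\
  Cmod (u (n + m)%nat - u n) <= Cmod (u n) * exp (c / INR n) * (c * (/ INR n - / INR (n + m))).
Proof.
  intros Hc H Hn.
  assert (Ip : forall p, (1 <= p)%nat -> 0 < / INR p).
  { intros p Hp; apply Rinv_0_lt_compat, lt_0_INR; lia. }
  assert (Id : forall p, (1 <= p)%nat -> / INR (S p) <= / INR p).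
  { intros p Hp; apply Rinv_le_contravar; [apply lt_0_INR; lia|apply le_INR; lia]. }
  induction m as [|m [IH1 IH2]].
  - rewrite Nat.add_0_r, !Rminus_diag, Rmult_0_r, exp_0.
    replace (u n - u n)%C with (RtoC 0) by ring; rewrite Cmod_0; lra.
  - rewrite Nat.add_succ_r; set (p := (n + m)%nat) in *.
    assert (Hp : (1 <= p)%nat) by (unfold p; lia).
    pose proof (H p Hp) as Hs; pose proof (Ip p Hp); pose proof (Id p Hp).
    pose proof (Ip (S p) ltac:(lia)) as Hsp.
    set (d := c * (/ INR p - / INR (S p))) in *.
    assert (Hd : 0 <= d) by (unfold d; nra).
    pose proof (Cmod_ge_0 (u p)) as Hup; pose proof (Cmod_ge_0 (u n)) as Hun.
    assert (Hmon : exp (c * (/ INR n - / INR p)) <= exp (c / INR n)).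
    { destruct (Rle_lt_or_eq_dec (c * (/ INR n - / INR p)) (c / INR n)) as [h|h].
      - unfold Rdiv; nra.
      - now apply Rlt_le, exp_increasing.
      - now rewrite h; right. }
    split.
    + apply Rle_trans with (Cmod (u p) * (1 + d)).
      * replace (u (S p)) with (u p + (u (S p) - u p))%C by ring.
        eapply Rle_trans; [apply Cmod_triangle|]; lra.
      * replace (c * (/ INR n - / INR (S p))) with (c * (/ INR n - / INR p) + d)
          by (unfold d; ring).
        rewrite exp_plus, <- Rmult_assoc.
        apply Rmult_le_compat; trivial; [lra|]; apply exp_ineq1_le.
    + replace (u (S p) - u n)%C with ((u (S p) - u p) + (u p - u n))%C by ring.
      eapply Rle_trans; [apply Cmod_triangle|].
      replace (c * (/ INR n - / INR (S p))) with (d + c * (/ INR n - / INR p))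
        by (unfold d; ring).
      rewrite Rmult_plus_distr_l; apply Rplus_le_compat; trivial.
      eapply Rle_trans; [exact Hs|]; apply Rmult_le_compat_r; trivial.
      eapply Rle_trans; [exact IH1|]; apply Rmult_le_compat_l; trivial.
Qed.

Lemma is_lim_seq_inv_INR : is_lim_seq (fun n => / INR n) 0.
Proof. apply (is_lim_seq_inv INR p_infty is_lim_seq_INR); discriminate. Qed.

Lemma telescoping_converges (u : nat -> R) (c : R) :
  (forall n, Rabs (u (S n) - u n) <= c * (/ INR (S n) - / INR (S (S n)))) ->
  exists l : R, is_lim_seq u l.
Proof.
  intro H.
  assert (Hc : 0 <= c).
  { specialize (H O); simpl in H; pose proof (Rabs_pos (u 1%nat - u O)); lra. }
  assert (B : forall n, u O - c <= u n - c * / INR (S n) /\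
                        u n + c * / INR (S n) <= u O + c).
  { induction n as [|n IH].
    - simpl; lra.
    - specialize (H n); apply Rabs_le_between in H; lra. }
  assert (Bn : forall n, 0 < / INR (S n)).
  { intro n; apply Rinv_0_lt_compat, lt_0_INR; lia. }
  (* The correction c / (n + 1) tends to 0 and makes the sequence decreasing. *)
  destruct (ex_finite_lim_seq_decr (fun n => u n + c * / INR (S n)) (u O - c)) as [l Hl].
  - intro n; specialize (H n); apply Rabs_le_between in H; lra.
  - intro n; pose proof (B n); pose proof (Bn n); nra.
  - exists l; apply (is_lim_seq_ext (fun n => (u n + c * / INR (S n)) - c * / INR (S n))).
    { intro; ring. }
    replace (Finite l) with (Finite (l - c * 0)) by (f_equal; ring).
    apply (is_lim_seq_minus' _ (fun n => c * / INR (S n))); trivial.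
    apply (is_lim_seq_scal_l _ c 0).
    apply (is_lim_seq_incr_1 (fun n => / INR n)).
    exact is_lim_seq_inv_INR.
Qed.

Lemma near_product_converges (u : nat -> C) (c : R) :
  0 <= c -> near_product u c ->
  exists l : C, clim u l /\ ((forall n, (1 <= n)%nat -> u n <> 0) -> l <> 0).
Proof.
  intros Hc H.
  set (k := Cmod (u 1%nat) * exp c * c).
  assert (Ip : forall p, (1 <= p)%nat -> 0 < / INR p).
  { intros p Hp; apply Rinv_0_lt_compat, lt_0_INR; lia. }
  assert (D : forall n, Cmod (u (S (S n)) - u (S n)) <= k * (/ INR (S n) - / INR (S (S n)))).
  { intro n; eapply Rle_trans; [apply (H (S n)); lia|].
    unfold k; rewrite (Rmult_assoc _ c).
    assert (G : Cmod (u (S n)) <= Cmod (u 1%nat) * exp c).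
    { eapply Rle_trans; [apply (near_product_growth u c 1 n Hc H (le_n 1))|].
      apply Rmult_le_compat_l; [apply Cmod_ge_0|].
      pose proof (Ip (1 + n)%nat ltac:(lia)).
      destruct (Rle_lt_or_eq_dec (c * (/ INR 1 - / INR (1 + n))) c) as [h|h].
      - simpl (INR 1); rewrite Rinv_1; nra.
      - now apply Rlt_le, exp_increasing.
      - rewrite h; lra. }
    apply Rmult_le_compat_r; trivial.
    assert (/ INR (S (S n)) <= / INR (S n)); [|nra].
    apply Rinv_le_contravar; [apply lt_0_INR; lia|apply le_INR; lia]. }
  destruct (telescoping_converges (fun n => Re (u (S n))) k) as [l1 H1].
  { intro n; eapply Rle_trans; [|apply D].
    replace (Re (u (S (S n))) - Re (u (S n))) with (Re (u (S (S n)) - u (S n)))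
      by (unfold Re; simpl; ring); apply re_le_Cmod. }
  destruct (telescoping_converges (fun n => Im (u (S n))) k) as [l2 H2].
  { intro n; eapply Rle_trans; [|apply D].
    replace (Im (u (S (S n))) - Im (u (S n))) with (Im (u (S (S n)) - u (S n)))
      by (unfold Im; simpl; ring); apply im_le_Cmod. }
  apply (is_lim_seq_incr_1 (fun n => Re (u n))) in H1.
  apply (is_lim_seq_incr_1 (fun n => Im (u n))) in H2.
  exists (l1, l2); split; [now split|].
  intros Hnz E; injection E as -> ->.
  (* With n > 6 c and exp 1 <= 3, the change after n is at most 3/6 of [Cmod (u n)], so the moduli
     stay above half of it. *)
  destruct (nfloor_ex (6 * c)) as [N [_ HN]]; [lra|].
  set (n := S N); assert (Hn : (1 <= n)%nat) by (unfold n; lia).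
  assert (Hn' : c / INR n <= / 6).
  { unfold n; rewrite S_INR; apply Rmult_le_reg_r with (INR N + 1).
    - pose proof (pos_INR N); lra.
    - pose proof (pos_INR N); field_simplify; lra. }
  pose proof (Cmod_gt_0 (u n)) as [Hpos _]; specialize (Hpos (Hnz n Hn)).
  assert (L : forall m, Cmod (u n) / 2 <= Cmod (u (n + m)%nat)).
  { intro m; destruct (near_product_growth u c n m Hc H Hn) as [_ G].
    assert (G' : Cmod (u (n + m)%nat - u n) <= Cmod (u n) * / 2).
    { eapply Rle_trans; [exact G|]; rewrite Rmult_assoc.
      apply Rmult_le_compat_l; [lra|].
      assert (0 <= c / INR n) by (apply Rmult_le_pos; [trivial|apply Rlt_le, Ip, Hn]).
      assert (exp (c / INR n) <= 3).
      { apply Rle_trans with (exp 1); [|exact exp_le_3].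
        apply Rlt_le, exp_increasing; lra. }
      pose proof (Ip (n + m)%nat ltac:(lia)).
      assert (c * (/ INR n - / INR (n + m)) <= c / INR n) by (unfold Rdiv; nra).
      pose proof (exp_pos (c / INR n)); nra. }
    assert (T : Cmod (u n) <= Cmod (u (n + m)%nat) + Cmod (u (n + m)%nat - u n)).
    { rewrite <- (Cmod_opp (u (n + m)%nat - u n)).
      replace (u n) with (u (n + m)%nat + - (u (n + m)%nat - u n))%C at 1 by ring.
      apply Cmod_triangle. }
    lra. }
  (* A limit 0 would make each component smaller than an eighth, hence the modulus smaller than a
     quarter, of [Cmod (u n)]. *)
  set (eps := mkposreal (Cmod (u n) / 8) ltac:(lra)).
  apply is_lim_seq_spec in H1; apply is_lim_seq_spec in H2.
  destruct (H1 eps) as [N1 E1], (H2 eps) as [N2 E2].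
  specialize (E1 (n + (N1 + N2))%nat ltac:(lia)); specialize (E2 (n + (N1 + N2))%nat ltac:(lia)).
  specialize (L (N1 + N2)%nat); rewrite Rminus_0_r in E1, E2; unfold eps in E1, E2; cbn [pos] in E1, E2.
  pose proof (Cmod_le_abs (u (n + (N1 + N2))%nat)); lra.
Qed.

(** * The Gauss product *)

Definition gauss (z : C) (n : nat) : C :=
  (Crising z n / (RtoC (INR (fact n)) * Cpower (RtoC (INR n)) z))%C.

(** (1 + z t) (1 - t)^z; at t = 1 / (n + 1) it is the factor leading from [gauss z n] to
    [gauss z (S n)]. *)
Definition gauss_ratio (z : C) (t : R) : C := ((1 + z * RtoC t) * Cexp (z * RtoC (ln (1 - t))))%C.

Lemma gauss_pos (z : C) (n : nat) : (1 <= n)%nat ->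
  gauss z n = (Crising z n * / RtoC (INR (fact n)) * Cexp (- (z * RtoC (ln (INR n)))))%C.
Proof.
  intro Hn; unfold gauss; rewrite Cpower_pos by (apply lt_0_INR; lia).
  set (w := (z * RtoC (ln (INR n)))%C).
  assert (Cexp w <> 0) by apply Cexp_neq_0.
  assert (RtoC (INR (fact n)) <> 0) by (apply RtoC_neq_0, INR_fact_neq_0).
  replace (Cexp (- w)) with (/ Cexp w)%C; [field; now split|].
  pose proof (Cexp_opp_r w) as E.
  replace (Cexp (- w)) with (/ Cexp w * (Cexp w * Cexp (- w)))%C by (field; trivial).
  rewrite E; ring.
Qed.

Lemma gauss_S (z : C) (n : nat) : (1 <= n)%nat ->
  gauss z (S n) = (gauss z n * gauss_ratio z (/ INR (S n)))%C.
Proof.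
  intro Hn; rewrite !gauss_pos by lia; unfold gauss_ratio.
  assert (Hp : 0 < INR n) by (apply lt_0_INR; lia).
  assert (Hs : INR (S n) = INR n + 1) by apply S_INR.
  replace (1 - / INR (S n)) with (INR n * / INR (S n)) by (rewrite Hs; field; lra).
  rewrite ln_mult, ln_Rinv by (lra || (apply Rinv_0_lt_compat; lra)).
  replace (- (z * RtoC (ln (INR (S n)))))%C with
    (- (z * RtoC (ln (INR n))) + z * RtoC (ln (INR n) + - ln (INR (S n))))%C
    by (rewrite RtoC_plus, RtoC_opp; ring).
  rewrite Cexp_plus; cbn [Crising].
  rewrite fact_simpl, mult_INR, RtoC_mult, RtoC_inv by lra.
  assert (RtoC (INR (S n)) <> 0) by (apply RtoC_neq_0; lra).
  assert (RtoC (INR (fact n)) <> 0) by (apply RtoC_neq_0, INR_fact_neq_0).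
  field; now split.
Qed.

Lemma MVT_bound (f df : R -> R) (x y k : R) :
  (forall t, Rmin x y <= t <= Rmax x y -> is_derive f t (df t)) ->
  (forall t, Rmin x y <= t <= Rmax x y -> Rabs (df t) <= k) ->
  Rabs (f y - f x) <= k * Rabs (y - x).
Proof.
  intros Hd Hk; destruct (MVT_gen f x y df) as [t [Ht E]].
  - intros t Ht; apply Hd; lra.
  - intros t Ht; apply continuity_pt_filterlim, @ex_derive_continuous.
    eexists; now apply Hd.
  - rewrite E, Rabs_mult; apply Rmult_le_compat_r; [apply Rabs_pos|auto].
Qed.

(** The factor 2 comes from applying the mean value theorem to the two components separately. *)
Lemma cderiv_bound (f df : R -> C) (x y k : R) :
  (forall t, Rmin x y <= t <= Rmax x y -> cderiv f t (df t)) ->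
  (forall t, Rmin x y <= t <= Rmax x y -> Cmod (df t) <= k) ->
  Cmod (f y - f x) <= 2 * k * Rabs (y - x).
Proof.
  intros Hd Hk.
  eapply Rle_trans; [apply Cmod_le_abs|].
  assert (A : Rabs (Re (f y - f x)) <= k * Rabs (y - x)).
  { apply (MVT_bound (fun t => Re (f t)) (fun t => Re (df t))).
    - intros t Ht; now apply Hd.
    - intros t Ht; eapply Rle_trans; [apply re_le_Cmod|auto]. }
  assert (B : Rabs (Im (f y - f x)) <= k * Rabs (y - x)).
  { apply (MVT_bound (fun t => Im (f t)) (fun t => Im (df t))).
    - intros t Ht; now apply Hd.
    - intros t Ht; eapply Rle_trans; [apply im_le_Cmod|auto]. }
  lra.
Qed.

(** The derivative of the ratio is - z (1 + z) (t / (1 - t)) (1 - t)^z, of order t, so the mean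
    value bound is of order t^2. The constant uses 1 / (1 - s) <= 2 and |(1 - s)^z| <= 2^|z| on
    [0, 1/2]. *)
Lemma gauss_ratio_bound (z : C) : exists k, 0 <= k /\
  forall t, 0 <= t <= / 2 -> Cmod (gauss_ratio z t - 1) <= k * t ^ 2.
Proof.
  set (k := Cmod (z * (1 + z)) * (2 * exp (Cmod z * ln 2))).
  assert (Hk : 0 <= k).
  { apply Rmult_le_pos; [apply Cmod_ge_0|]; pose proof (exp_pos (Cmod z * ln 2)); lra. }
  exists (2 * k); split; [lra|]; intros t Ht.
  replace (RtoC 1) with (gauss_ratio z 0).
  2: { unfold gauss_ratio; rewrite Rminus_0_r, ln_1, !Cmult_0_r, Cexp_0; ring. }
  replace (2 * k * t ^ 2) with (2 * (k * t) * Rabs (t - 0)).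
  2: { rewrite Rminus_0_r, Rabs_pos_eq by lra; ring. }
  apply (cderiv_bound (gauss_ratio z)
    (fun s => - (z * (1 + z)) * RtoC (s / (1 - s)) * Cexp (z * RtoC (ln (1 - s))))%C);
    intros s Hs; rewrite Rmin_left, Rmax_right in Hs by lra.
  - unfold gauss_ratio; eapply cderiv_eq.
    + apply cderiv_mult.
      * apply cderiv_plus; [apply cderiv_const|].
        apply cderiv_scal, cderiv_id.
      * apply cderiv_Cexp_scal with (dg := - / (1 - s)).
        auto_derive; [lra|field; lra].
    + unfold Rdiv; rewrite RtoC_mult, RtoC_opp.
      assert (RtoC (1 - s) <> 0) by (apply RtoC_neq_0; lra).
      rewrite RtoC_inv by lra; replace (RtoC s) with (1 - RtoC (1 - s))%C
        by (rewrite RtoC_minus; ring).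
      field; trivial.
  - rewrite !Cmod_mult, Cmod_opp, Cmod_R, Cmod_Cexp.
    unfold k; rewrite !Rmult_assoc.
    apply Rmult_le_compat_l; [apply Cmod_ge_0|].
    assert (L : - ln 2 <= ln (1 - s) <= 0).
    { rewrite <- ln_Rinv, <- ln_1 by lra; split.
      - destruct (Req_dec (/ 2) (1 - s)) as [<-|]; [lra|].
        apply Rlt_le, ln_increasing; lra.
      - destruct (Req_dec 1 (1 - s)) as [E|]; [rewrite <- E, ln_1; lra|].
        rewrite ln_1; rewrite <- ln_1 at 1; apply Rlt_le, ln_increasing; lra. }
    assert (Ex : exp (Re (z * RtoC (ln (1 - s)))) <= exp (Cmod z * ln 2)).
    { assert (Re (z * RtoC (ln (1 - s))) <= Cmod z * ln 2).
      { replace (Re (z * RtoC (ln (1 - s)))) with (Re z * ln (1 - s))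
          by (unfold Re; simpl; ring).
        pose proof (re_le_Cmod z) as Q; apply Rabs_le_between in Q.
        pose proof (Cmod_ge_0 z); nra. }
      destruct (Req_dec (Re (z * RtoC (ln (1 - s)))) (Cmod z * ln 2)) as [->|]; [lra|].
      apply Rlt_le, exp_increasing; lra. }
    rewrite Rabs_pos_eq.
    2: { apply Rmult_le_pos; [lra|]; apply Rlt_le, Rinv_0_lt_compat; lra. }
    pose proof (exp_pos (Re (z * RtoC (ln (1 - s))))).
    assert (s / (1 - s) <= 2 * t).
    { apply Rmult_le_reg_r with (1 - s); [lra|]; unfold Rdiv.
      rewrite Rmult_assoc, Rinv_l by lra; nra. }
    assert (0 <= s / (1 - s)).
    { apply Rmult_le_pos; [lra|]; apply Rlt_le, Rinv_0_lt_compat; lra. }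
    nra.
Qed.

Lemma gauss_near_product (z : C) : exists c, 0 <= c /\ near_product (gauss z) c.
Proof.
  destruct (gauss_ratio_bound z) as (k & Hk & H); exists k; split; trivial.
  intros n Hn; rewrite gauss_S by trivial.
  replace (gauss z n * gauss_ratio z (/ INR (S n)) - gauss z n)%C
    with (gauss z n * (gauss_ratio z (/ INR (S n)) - 1))%C by ring.
  rewrite Cmod_mult; apply Rmult_le_compat_l; [apply Cmod_ge_0|].
  assert (Hp : 1 <= INR n) by (apply (le_INR 1); lia).
  assert (Hs : INR (S n) = INR n + 1) by apply S_INR.
  eapply Rle_trans; [apply H|].
  - split; [apply Rlt_le, Rinv_0_lt_compat; lra|apply Rinv_le_contravar; lra].
  - apply Rmult_le_compat_l; trivial; rewrite Hs.
    replace (/ INR n - / (INR n + 1)) with (/ INR n * / (INR n + 1)) by (field; lra).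
    simpl; rewrite Rmult_1_r; apply Rmult_le_compat_r;
      [apply Rlt_le, Rinv_0_lt_compat; lra|apply Rinv_le_contravar; lra].
Qed.

Lemma rGamma_lim (z : C) : clim (gauss z) (rGamma z).
Proof.
  destruct (gauss_near_product z) as (c & Hc & H).
  destruct (near_product_converges _ c Hc H) as (l & Hl & _).
  replace (rGamma z) with l; trivial; symmetry; exact (clim_Clim_seq _ _ Hl).
Qed.

Lemma Crising_neq_0 (z : C) (n : nat) :
  (forall m, (z + RtoC (INR m))%C <> 0) -> Crising z n <> 0.
Proof.
  intro H; induction n as [|n IH]; cbn [Crising].
  - intro E; apply (H O); simpl; rewrite E; ring.
  - now apply Cmult_neq_0.
Qed.

(** No factor of the product vanishes, so neither does its limit. *)
Lemma rGamma_neq_0 (z : C) :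
  (forall m, (z + RtoC (INR m))%C <> 0) -> rGamma z <> 0.
Proof.
  intro Hz; destruct (gauss_near_product z) as (c & Hc & H).
  destruct (near_product_converges _ c Hc H) as (l & Hl & Hnz).
  rewrite (clim_unique _ _ _ (rGamma_lim z) Hl); apply Hnz; intros n Hn.
  rewrite gauss_pos by trivial.
  repeat apply Cmult_neq_0; [now apply Crising_neq_0| |apply Cexp_neq_0].
  intro E.
  assert (RtoC (INR (fact n)) <> 0) by (apply RtoC_neq_0, INR_fact_neq_0).
  apply C1_nz; rewrite <- (Cinv_r (RtoC (INR (fact n)))), E by trivial; ring.
Qed.

Lemma Crising_shift (z : C) (n : nat) :
  (z * Crising (z + 1) n)%C = (Crising z n * (z + RtoC (INR n) + 1))%C.
Proof.
  induction n as [|n IH]; cbn [Crising]; [simpl; ring|].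
  rewrite Cmult_assoc, IH, S_INR, RtoC_plus; ring.
Qed.

(** At finite n, [z * gauss (z + 1) n] is [gauss z n] times 1 + (z + 1) / n, and the extra factor
    tends to 1. *)
Lemma rGamma_rec (z : C) : rGamma z = (z * rGamma (z + 1))%C.
Proof.
  apply (clim_unique (fun n => z * gauss (z + 1) n)%C).
  - apply (clim_ext (fun n => gauss z n * (1 + (z + 1) * RtoC (/ INR n)))%C).
    + intros n Hn; rewrite !gauss_pos by trivial.
      assert (Hp : 0 < INR n) by (apply lt_0_INR; lia).
      replace (- ((z + 1) * RtoC (ln (INR n))))%C
        with (- (z * RtoC (ln (INR n))) + RtoC (- ln (INR n)))%C
        by (rewrite RtoC_opp; ring).
      rewrite Cexp_plus, Cexp_RtoC, <- ln_Rinv, exp_ln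
        by (trivial; now apply Rinv_0_lt_compat).
      rewrite !Cmult_assoc, Crising_shift, RtoC_inv by lra.
      assert (RtoC (INR n) <> 0) by (apply RtoC_neq_0; lra).
      assert (RtoC (INR (fact n)) <> 0) by (apply RtoC_neq_0, INR_fact_neq_0).
      field; now split.
    + replace (rGamma z) with (rGamma z * (1 + (z + 1) * RtoC 0))%C by ring.
      apply clim_mult; [apply rGamma_lim|].
      destruct (clim_mult _ _ _ _ (clim_const (z + 1)) (clim_RtoC _ _ is_lim_seq_inv_INR))
        as [L1 L2]; split.
      * apply (is_lim_seq_plus' (fun _ => 1)); trivial; apply is_lim_seq_const.
      * apply (is_lim_seq_plus' (fun _ => 0)); trivial; apply is_lim_seq_const.
  - apply clim_mult; [apply clim_const|apply rGamma_lim].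
Qed.

Lemma Crising_1 (n : nat) : Crising 1 n = RtoC (INR (fact (S n))).
Proof.
  induction n as [|n IH]; [simpl; f_equal; ring|].
  cbn [Crising]; rewrite IH, (fact_simpl (S n)), mult_INR, RtoC_mult, (S_INR (S n)).
  rewrite S_INR, !RtoC_plus; ring.
Qed.

Lemma rGamma_1 : rGamma 1 = 1.
Proof.
  apply (clim_unique (gauss 1)); [apply rGamma_lim|].
  apply (clim_ext (fun n => RtoC (1 + / INR n))).
  - intros n Hn; rewrite gauss_pos by trivial.
    assert (Hp : 0 < INR n) by (apply lt_0_INR; lia).
    rewrite Cmult_1_l, <- RtoC_opp, Cexp_RtoC, <- ln_Rinv, exp_ln
      by (trivial; now apply Rinv_0_lt_compat).
    rewrite Crising_1, fact_simpl, mult_INR, <- RtoC_inv, <- !RtoC_mult, S_INR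
      by apply INR_fact_neq_0.
    f_equal; field; split; [lra|apply INR_fact_neq_0].
  - apply clim_RtoC; replace (Finite 1) with (Finite (1 + 0)) by (f_equal; ring).
    apply is_lim_seq_plus'; [apply is_lim_seq_const|apply is_lim_seq_inv_INR].
Qed.

(** * First order expansions at an integer order *)

(** A derivative at 0 with an explicit quadratic remainder on a fixed interval: such bounds, unlike
    a mere limit, can be summed over the terms of a series. On this interval 1 + e stays at least
    1/2. *)
Definition quad (f : R -> C) (a b : C) : Prop :=
  exists K : R, 0 <= K /\
  forall e, Rabs e <= / 2 -> Cmod (f e - a - RtoC e * b) <= K * e ^ 2.

Lemma quad_ext (f g : R -> C) (a b : C) :
  (forall e, Rabs e <= / 2 -> f e = g e) -> quad f a b -> quad g a b.
Proof.
  intros E (K & HK & H); exists K; split; trivial; intros e He; rewrite <- E; auto.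
Qed.

Lemma quad_eq (f : R -> C) (a b a' b' : C) :
  quad f a b -> a = a' -> b = b' -> quad f a' b'.
Proof. now intros H <- <-. Qed.

Lemma quad_const (a : C) : quad (fun _ => a) a 0.
Proof.
  exists 0; split; [lra|]; intros e _.
  replace (a - a - RtoC e * 0)%C with (RtoC 0) by ring; rewrite Cmod_0; lra.
Qed.

Lemma quad_plus (f g : R -> C) (a b a' b' : C) :
  quad f a b -> quad g a' b' -> quad (fun e => f e + g e)%C (a + a')%C (b + b')%C.
Proof.
  intros (K & HK & H) (K' & HK' & H'); exists (K + K'); split; [lra|]; intros e He.
  replace (f e + g e - (a + a') - RtoC e * (b + b'))%C
    with ((f e - a - RtoC e * b) + (g e - a' - RtoC e * b'))%C by ring.
  eapply Rle_trans; [apply Cmod_triangle|].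
  specialize (H e He); specialize (H' e He); lra.
Qed.

Lemma quad_mult (f g : R -> C) (a b a' b' : C) :
  quad f a b -> quad g a' b' ->
  quad (fun e => f e * g e)%C (a * a')%C (a * b' + b * a')%C.
Proof.
  intros (K & HK & H) (K' & HK' & H').
  set (L := Cmod a + Cmod b); set (L' := Cmod a' + Cmod b').
  pose proof (Cmod_ge_0 a); pose proof (Cmod_ge_0 b);
  pose proof (Cmod_ge_0 a'); pose proof (Cmod_ge_0 b').
  exists (L * K' + K * (L' + K') + Cmod b * Cmod b'); split.
  { unfold L, L'; repeat apply Rplus_le_le_0_compat; repeat apply Rmult_le_pos; lra. }
  intros e He; specialize (H e He); specialize (H' e He).
  set (u := (f e - a - RtoC e * b)%C) in *; set (u' := (g e - a' - RtoC e * b')%C) in *.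
  replace (f e * g e - a * a' - RtoC e * (a * b' + b * a'))%C with
    ((a + RtoC e * b) * u' + u * (a' + RtoC e * b' + u') + RtoC (e ^ 2) * (b * b'))%C
    by (unfold u, u'; rewrite RtoC_pow; simpl; ring).
  assert (He2 : 0 <= e ^ 2 <= 1).
  { rewrite <- (pow2_abs e); pose proof (Rabs_pos e); simpl; nra. }
  assert (B : forall x y, Cmod (x + RtoC e * y) <= Cmod x + Cmod y).
  { intros x y; eapply Rle_trans; [apply Cmod_triangle|].
    rewrite Cmod_mult, Cmod_R; pose proof (Cmod_ge_0 y); pose proof (Rabs_pos e); nra. }
  pose proof (Cmod_ge_0 u) as Hu; pose proof (Cmod_ge_0 u') as Hu'.
  assert (B1 : Cmod (a + RtoC e * b) <= L) by apply B.
  assert (B2 : Cmod (a' + RtoC e * b' + u') <= L' + K').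
  { eapply Rle_trans; [apply Cmod_triangle|]; pose proof (B a' b'); unfold L'; nra. }
  assert (T1 : Cmod ((a + RtoC e * b) * u') <= L * (K' * e ^ 2)).
  { rewrite Cmod_mult; apply Rmult_le_compat; trivial; apply Cmod_ge_0. }
  assert (T2 : Cmod (u * (a' + RtoC e * b' + u')) <= (K * e ^ 2) * (L' + K')).
  { rewrite Cmod_mult; apply Rmult_le_compat; trivial; apply Cmod_ge_0. }
  assert (T3 : Cmod (RtoC (e ^ 2) * (b * b')) = e ^ 2 * (Cmod b * Cmod b')).
  { rewrite !Cmod_mult, Cmod_R, Rabs_pos_eq; lra. }
  eapply Rle_trans; [apply Cmod_triangle|]; rewrite T3.
  pose proof (Cmod_triangle ((a + RtoC e * b) * u') (u * (a' + RtoC e * b' + u'))).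
  lra.
Qed.

Lemma quad_scal (c : C) (f : R -> C) (a b : C) :
  quad f a b -> quad (fun e => c * f e)%C (c * a)%C (c * b)%C.
Proof.
  intro H; eapply quad_eq; [apply quad_mult; [apply quad_const|exact H]|ring|ring].
Qed.

Lemma quad_opp_arg (f : R -> C) (a b : C) :
  quad f a b -> quad (fun e => f (- e)) a (- b)%C.
Proof.
  intros (K & HK & H); exists K; split; trivial; intros e He.
  specialize (H (- e)); rewrite Rabs_Ropp in H; specialize (H He).
  replace (f (- e)%R - a - RtoC e * - b)%C with (f (- e)%R - a - RtoC (- e) * b)%C
    by (rewrite RtoC_opp; ring).
  replace (e ^ 2) with ((- e) ^ 2) by ring; trivial.
Qed.

Lemma quad_C2 (f f1 f2 : R -> C) (K : R) :
  (forall e, Rabs e <= / 2 -> cderiv f e (f1 e)) ->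
  (forall e, Rabs e <= / 2 -> cderiv f1 e (f2 e)) ->
  (forall e, Rabs e <= / 2 -> Cmod (f2 e) <= K) -> quad f (f 0) (f1 0).
Proof.
  intros H1 H2 HK.
  assert (HK0 : 0 <= K).
  { eapply Rle_trans; [apply (Cmod_ge_0 (f2 0))|apply HK]; rewrite Rabs_R0; lra. }
  assert (I : forall e t, Rmin 0 e <= t <= Rmax 0 e -> Rabs t <= Rabs e).
  { intros e t; unfold Rmin, Rmax; destruct (Rle_dec 0 e); intro Ht.
    - rewrite !Rabs_pos_eq; lra.
    - rewrite !Rabs_left1; lra. }
  (* [cderiv_bound] is used twice, for [f] and for [f1], each time with a factor 2. *)
  exists (4 * K); split; [lra|]; intros e He.
  replace (4 * K * e ^ 2) with (2 * (2 * K * Rabs e) * Rabs (e - 0)).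
  2: { rewrite Rminus_0_r, <- (pow2_abs e); simpl; ring. }
  replace (f e - f 0 - RtoC e * f1 0)%C with
    ((f e - RtoC e * f1 0) - (f 0 - RtoC 0 * f1 0))%C by ring.
  apply (cderiv_bound (fun t => f t - RtoC t * f1 0)%C (fun t => f1 t - f1 0)%C); intros t Ht.
  - eapply cderiv_eq.
    + apply cderiv_minus; [apply H1|].
      * pose proof (I e t Ht); lra.
      * apply cderiv_mult; [apply cderiv_id|apply cderiv_const].
    + cbv beta; ring.
  - apply Rle_trans with (2 * K * Rabs (t - 0)).
    + apply (cderiv_bound f1 f2); intros s Hs; pose proof (I e t Ht); pose proof (I t s Hs).
      * apply H2; lra.
      * apply HK; lra.
    + rewrite Rminus_0_r; apply Rmult_le_compat_l; [lra|now apply I].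
Qed.

Lemma quad_Cexp (L : C) : quad (fun e => Cexp (L * RtoC e)) 1 L.
Proof.
  assert (D : forall e, cderiv (fun e => Cexp (L * RtoC e)) e (L * Cexp (L * RtoC e))%C).
  { intro e; eapply cderiv_eq; [exact (cderiv_Cexp_scal L (fun t => t) e 1 (is_derive_id e))|].
    cbv beta; ring. }
  eapply quad_eq.
  - apply (quad_C2 (fun e => Cexp (L * RtoC e)) (fun e => L * Cexp (L * RtoC e))%C
      (fun e => L * (L * Cexp (L * RtoC e)))%C (Cmod L * (Cmod L * exp (Cmod L)))).
    + intros e _; apply D.
    + intros e _; apply cderiv_scal, D.
    + intros e He; rewrite !Cmod_mult, Cmod_Cexp.
      pose proof (Cmod_ge_0 L).
      do 2 (apply Rmult_le_compat_l; trivial).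
      assert (Re (L * RtoC e) <= Cmod L).
      { eapply Rle_trans; [apply Rle_abs|]; eapply Rle_trans; [apply re_le_Cmod|].
        rewrite Cmod_mult, Cmod_R; pose proof (Rabs_pos e); nra. }
      destruct (Req_dec (Re (L * RtoC e)) (Cmod L)) as [->|]; [lra|].
      apply Rlt_le, exp_increasing; lra.
  - simpl; rewrite Cmult_0_r; apply Cexp_0.
  - simpl; rewrite Cmult_0_r, Cexp_0; ring.
Qed.

Lemma quad_cos_PI : quad (fun e => RtoC (cos (PI * e))) 1 0.
Proof.
  eapply quad_eq.
  - apply (quad_C2 _ (fun e => RtoC (- PI * sin (PI * e)))
      (fun e => RtoC (- PI * (PI * cos (PI * e)))) (PI * PI)).
    + intros e _; apply cderiv_RtoC; auto_derive; trivial; ring.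
    + intros e _; apply cderiv_RtoC; auto_derive; trivial; ring.
    + intros e _; rewrite Cmod_R, !Rabs_mult, Rabs_Ropp, !Rabs_pos_eq by apply Rlt_le, PI_RGT_0.
      pose proof PI_RGT_0; assert (Rabs (cos (PI * e)) <= 1).
      { apply Rabs_le, COS_bound. }
      assert (PI * Rabs (cos (PI * e)) <= PI) by nra; nra.
  - simpl; now rewrite Rmult_0_r, cos_0.
  - simpl; rewrite !Rmult_0_r, sin_0; f_equal; ring.
Qed.

Lemma quad_sin_PI : quad (fun e => RtoC (sin (PI * e))) 0 (RtoC PI).
Proof.
  eapply quad_eq.
  - apply (quad_C2 _ (fun e => RtoC (PI * cos (PI * e)))
      (fun e => RtoC (- PI * (PI * sin (PI * e)))) (PI * PI)).
    + intros e _; apply cderiv_RtoC; auto_derive; trivial; ring.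
    + intros e _; apply cderiv_RtoC; auto_derive; trivial; ring.
    + intros e _; rewrite Cmod_R, !Rabs_mult, Rabs_Ropp, !Rabs_pos_eq by apply Rlt_le, PI_RGT_0.
      pose proof PI_RGT_0; assert (Rabs (sin (PI * e)) <= 1).
      { apply Rabs_le, SIN_bound. }
      assert (PI * Rabs (sin (PI * e)) <= PI) by nra; nra.
  - simpl; now rewrite Rmult_0_r, sin_0.
  - simpl; rewrite !Rmult_0_r, cos_0; f_equal; ring.
Qed.

Lemma ln_1_plus_bound (x : R) : Rabs x <= / 2 -> Rabs (ln (1 + x) - x) <= 2 * x ^ 2.
Proof.
  intro Hx.
  assert (I : forall t, Rmin 0 x <= t <= Rmax 0 x -> Rabs t <= Rabs x).
  { intro t; unfold Rmin, Rmax; destruct (Rle_dec 0 x); intro Ht.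
    - rewrite !Rabs_pos_eq; lra.
    - rewrite !Rabs_left1; lra. }
  replace (ln (1 + x) - x) with ((ln (1 + x) - x) - (ln (1 + 0) - 0))
    by (rewrite Rplus_0_r, ln_1; ring).
  replace (2 * x ^ 2) with (2 * Rabs x * Rabs (x - 0)).
  2: { rewrite Rminus_0_r, <- (pow2_abs x); simpl; ring. }
  apply (MVT_bound (fun t => ln (1 + t) - t) (fun t => - t / (1 + t))); intros t Ht;
    apply I in Ht; assert (Rabs t <= / 2) by lra; apply Rabs_le_between in H.
  - auto_derive; [lra|field; lra].
  - unfold Rdiv; rewrite Rabs_mult, Rabs_Ropp, Rabs_inv, (Rabs_pos_eq (1 + t)) by lra.
    assert (/ (1 + t) <= 2).
    { rewrite <- (Rinv_inv 2); apply Rinv_le_contravar; lra. }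
    pose proof (Rabs_pos t); nra.
Qed.

(** * The expansion of 1 / Gamma at 1 *)

Fixpoint rising (x : R) (n : nat) : R :=
  match n with O => x | S m => rising x m * (x + INR n) end.

Lemma Crising_RtoC (x : R) (n : nat) : Crising (RtoC x) n = RtoC (rising x n).
Proof.
  induction n as [|n IH]; trivial; cbn [Crising rising].
  now rewrite IH, RtoC_mult, RtoC_plus.
Qed.

Definition real_gauss (x : R) (n : nat) : R :=
  rising x n * / INR (fact n) * exp (- (x * ln (INR n))).

Lemma gauss_RtoC (x : R) (n : nat) : (1 <= n)%nat ->
  gauss (RtoC x) n = RtoC (real_gauss x n).
Proof.
  intro Hn; rewrite gauss_pos, Crising_RtoC by trivial; unfold real_gauss.
  rewrite <- RtoC_mult, <- RtoC_opp, Cexp_RtoC, <- RtoC_inv by apply INR_fact_neq_0.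
  now rewrite <- !RtoC_mult.
Qed.

Lemma rising_pos (x : R) (n : nat) : 0 < x -> 0 < rising x n.
Proof.
  intro Hx; induction n as [|n IH]; trivial; cbn [rising].
  apply Rmult_lt_0_compat; trivial; pose proof (pos_INR (S n)); lra.
Qed.

Lemma real_gauss_pos (x : R) (n : nat) : 0 < x -> 0 < real_gauss x n.
Proof.
  intro Hx; repeat apply Rmult_lt_0_compat.
  - now apply rising_pos.
  - apply Rinv_0_lt_compat, INR_fact_lt_0.
  - apply exp_pos.
Qed.

Lemma ln_real_gauss (x : R) (n : nat) : 0 < x ->
  ln (real_gauss x n) = ln (rising x n) - ln (INR (fact n)) - x * ln (INR n).
Proof.
  intros Hx; pose proof (rising_pos x n Hx); pose proof (INR_fact_lt_0 n) as Hf.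
  pose proof (Rinv_0_lt_compat _ Hf); unfold real_gauss.
  rewrite !ln_mult, ln_Rinv, ln_exp;
    first [ring|assumption|apply exp_pos|now apply Rmult_lt_0_compat].
Qed.

(** It has n + 1 terms, matching the n + 1 factors of [rising]. *)
Definition harmonic (n : nat) : R := sum_f_R0 (fun j => / INR (S j)) n.

(** The left side is a sum over a = 1, ..., n + 1 of ln (a + e) - ln a - e / a, each at most 2 e^2 /
    a^2. The bound does not depend on n, so it survives the limit. *)
Lemma real_gauss_log_expansion (e : R) (n : nat) : Rabs e <= / 2 ->
  Rabs (ln (real_gauss (1 + e) n) - ln (real_gauss 1 n) - e * (harmonic n - ln (INR n)))
  <= 4 * e ^ 2.
Proof.
  intro He; assert (He' := He); apply Rabs_le_between in He'.
  rewrite !ln_real_gauss by lra.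
  match goal with |- Rabs ?x <= _ =>
    replace x with (ln (rising (1 + e) n) - ln (rising 1 n) - e * harmonic n) by ring end.
  (* A sharper bound, for which the induction telescopes by 1 / a^2 <= 1 / (a - 1) - 1 / a. *)
  assert (B : Rabs (ln (rising (1 + e) n) - ln (rising 1 n) - e * harmonic n)
    <= 2 * e ^ 2 * (2 - / INR (S n))).
  { assert (St : forall a, 0 < a -> 1 <= a ->
      Rabs (ln (a + e) - ln a - e * / a) <= 2 * e ^ 2 * (/ a) ^ 2).
    { intros a Ha Ha1; pose proof (Rinv_0_lt_compat a Ha).
      assert (Ha2 : / a <= 1) by (rewrite <- Rinv_1; apply Rinv_le_contravar; lra).
      replace (a + e) with (a * (1 + e * / a)) by (field; lra).
      rewrite ln_mult; [|lra|nra].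
      replace (ln a + ln (1 + e * / a) - ln a - e * / a)
        with (ln (1 + e * / a) - e * / a) by ring.
      replace (2 * e ^ 2 * (/ a) ^ 2) with (2 * (e * / a) ^ 2) by ring.
      apply ln_1_plus_bound; rewrite Rabs_mult, (Rabs_pos_eq (/ a)) by lra.
      pose proof (Rabs_pos e); nra. }
    induction n as [|n IH].
    - unfold harmonic; simpl; specialize (St 1); rewrite !Rinv_1, !pow1 in *.
      eapply Rle_trans; [apply St; lra|]; right; simpl; ring.
    - unfold harmonic; cbn [rising]; rewrite tech5; fold (harmonic n).
      set (a := INR (S (S n))).
      assert (Ea : 1 + INR (S n) = a) by (unfold a; rewrite (S_INR (S n)); ring).
      assert (Ha : 2 <= a) by (unfold a; apply (le_INR 2); lia).
      rewrite !ln_mult, Ea; try (apply rising_pos; lra); try lra.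
      replace (1 + e + INR (S n)) with (a + e) by lra.
      match goal with |- Rabs ?x <= _ =>
        replace x with ((ln (rising (1 + e) n) - ln (rising 1 n) - e * harmonic n)
          + (ln (a + e) - ln a - e * / a)) by ring end.
      eapply Rle_trans; [apply Rabs_triang|].
      assert (St' := St a ltac:(lra) ltac:(lra)).
      assert (Hn : INR (S n) = a - 1) by lra.
      assert ((/ a) ^ 2 <= / INR (S n) - / a).
      { rewrite Hn; replace (/ (a - 1) - / a) with (/ (a - 1) * / a) by (field; lra).
        simpl; rewrite Rmult_1_r; apply Rmult_le_compat_r;
          [apply Rlt_le, Rinv_0_lt_compat; lra|apply Rinv_le_contravar; lra]. }
      assert (IH' : Rabs (ln (rising (1 + e) n) - ln (rising 1 n) - e * harmonic n)
        <= 2 * e ^ 2 * (2 - / INR (S n))).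
      { apply IH. }
      pose proof (pow2_ge_0 e); nra. }
  eapply Rle_trans; [exact B|].
  assert (0 < / INR (S n)) by (apply Rinv_0_lt_compat, lt_0_INR; lia).
  pose proof (pow2_ge_0 e); nra.
Qed.

Lemma ln_le_pred (x : R) : 0 < x -> ln x <= x - 1.
Proof.
  intro Hx; pose proof (exp_ineq1_le (ln x)) as H; rewrite exp_ln in H; lra.
Qed.

(** From index 1 on the sequence decreases and is bounded below by 0; both facts follow from ln x <=
    x - 1. *)
Lemma euler_constant : exists g : R, is_lim_seq (fun n => harmonic n - ln (INR n)) g.
Proof.
  destruct (ex_finite_lim_seq_decr (fun n => harmonic (S n) - ln (INR (S n))) 0) as [g Hg].
  - intro n; unfold harmonic; rewrite (tech5 _ (S n)).
    set (a := INR (S n)); assert (Ha : 1 <= a) by (apply (le_INR 1); lia).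
    assert (E2 : INR (S (S n)) = a + 1) by apply (S_INR (S n)).
    assert (E3 : INR (S (S (S n))) = a + 2) by (rewrite S_INR, E2; ring).
    rewrite E2, E3.
    assert (H : ln (a * / (a + 1)) <= a * / (a + 1) - 1).
    { apply ln_le_pred, Rmult_lt_0_compat; [lra|apply Rinv_0_lt_compat; lra]. }
    rewrite ln_mult, ln_Rinv in H by (try apply Rinv_0_lt_compat; lra).
    replace (a * / (a + 1) - 1) with (- / (a + 1)) in H by (field; lra).
    assert (/ (a + 2) <= / (a + 1)) by (apply Rinv_le_contravar; lra); lra.
  - intro n.
    assert (H : ln (INR (S (S (S n)))) <= harmonic (S n)).
    { generalize (S n); clear n; intro n; unfold harmonic; induction n as [|n IH].
      - simpl; rewrite Rinv_1; replace (1 + 1) with 2 by ring.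
        pose proof (ln_le_pred 2 ltac:(lra)); lra.
      - rewrite tech5; set (a := INR (S (S n))) in *.
        assert (Ha : 2 <= a) by (unfold a; apply (le_INR 2); lia).
        assert (E3 : INR (S (S (S n))) = a + 1) by apply (S_INR (S (S n))).
        rewrite E3; pose proof (Rinv_0_lt_compat a ltac:(lra)).
        assert (Q : ln (1 + / a) <= / a).
        { pose proof (ln_le_pred (1 + / a) ltac:(lra)); lra. }
        replace (a + 1) with (a * (1 + / a)) by (field; lra).
        rewrite ln_mult by lra; lra. }
    assert (ln (INR (S n)) <= ln (INR (S (S (S n))))); [|lra].
    apply Rlt_le, ln_increasing; [apply lt_0_INR; lia|apply lt_INR; lia].
  - exists g; apply (is_lim_seq_incr_1 (fun n => harmonic n - ln (INR n))); exact Hg.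
Qed.

(** [g] is Euler's constant. The logarithmic bound is passed to the limit and then exponentiated;
    the limit is positive, as its logarithm requires, by [rGamma_neq_0]. *)
Lemma rGamma_1_expansion :
  exists g : R, quad (fun e => rGamma (RtoC (1 + e))) 1 (RtoC g).
Proof.
  destruct euler_constant as [g Hg]; exists g.
  set (G := fun e => Re (rGamma (RtoC (1 + e)))).
  assert (HG : forall e, is_lim_seq (real_gauss (1 + e)) (G e)).
  { intro e; destruct (rGamma_lim (RtoC (1 + e))) as [H _].
    apply (is_lim_seq_ext_loc (fun n => Re (gauss (RtoC (1 + e)) n))); trivial.
    exists 1%nat; intros n Hn; rewrite gauss_RtoC by trivial; reflexivity. }
  assert (EG : forall e, rGamma (RtoC (1 + e)) = RtoC (G e)).
  { intro e; apply (clim_unique (gauss (RtoC (1 + e)))); [apply rGamma_lim|].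
    apply (clim_ext (fun n => RtoC (real_gauss (1 + e) n))).
    - intros n Hn; now rewrite gauss_RtoC.
    - now apply clim_RtoC. }
  assert (PG : forall e, Rabs e <= / 2 -> 0 < G e).
  { intros e He; apply Rabs_le_between in He.
    assert (N0 : G e <> 0).
    { intro E; apply (rGamma_neq_0 (RtoC (1 + e))).
      - intros m E'; rewrite <- RtoC_plus in E'; apply RtoC_inj in E'.
        pose proof (pos_INR m); lra.
      - now rewrite EG, E. }
    assert (P0 : Rbar_le 0 (G e)).
    { apply (is_lim_seq_le (fun _ => 0) (real_gauss (1 + e))); trivial.
      - intro n; apply Rlt_le, real_gauss_pos; lra.
      - apply is_lim_seq_const. }
    simpl in P0; lra. }
  assert (G0 : G 0 = 1).
  { unfold G; now rewrite Rplus_0_r, rGamma_1. }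
  assert (LG : forall e, Rabs e <= / 2 ->
    is_lim_seq (fun n => ln (real_gauss (1 + e) n)) (ln (G e))).
  { intros e He; apply (is_lim_seq_continuous ln (real_gauss (1 + e))); trivial.
    apply continuity_pt_filterlim, @ex_derive_continuous.
    eexists; apply is_derive_ln, PG, He. }
  assert (B : forall e, Rabs e <= / 2 -> Rabs (ln (G e) - e * g) <= 4 * e ^ 2).
  { intros e He.
    assert (L : is_lim_seq (fun n => Rabs (ln (real_gauss (1 + e) n) - ln (real_gauss 1 n)
        - e * (harmonic n - ln (INR n)))) (Rabs (ln (G e) - ln (G 0) - e * g))).
    { apply (is_lim_seq_abs _ (Finite (ln (G e) - ln (G 0) - e * g))).
      apply is_lim_seq_minus'; [apply is_lim_seq_minus'|].
      - now apply LG.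
      - assert (H := LG 0); rewrite Rplus_0_r, Rabs_R0 in H; apply H; lra.
      - apply (is_lim_seq_scal_l _ e g Hg). }
    rewrite G0, ln_1, Rminus_0_r in L.
    exact (is_lim_seq_le _ _ _ _ (fun n => real_gauss_log_expansion e n He) L
      (is_lim_seq_const (4 * e ^ 2))). }
  (* 1 / Gamma (1 + e) is exp (g e) times the exponential of the logarithmic remainder, which is 1 +
     O(e^2). *)
  apply (quad_ext (fun e => Cexp (RtoC g * RtoC e) * RtoC (exp (ln (G e) - e * g)))%C).
  - intros e He; rewrite EG, <- RtoC_mult, Cexp_RtoC, <- RtoC_mult, <- exp_plus.
    replace (g * e + (ln (G e) - e * g)) with (ln (G e)) by ring.
    now rewrite exp_ln by auto.
  - eapply quad_eq; [apply quad_mult; [apply quad_Cexp|]|..].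
    2: instantiate (1 := 1); ring.
    2: instantiate (1 := 0); ring.
    (* 12 = 3 * 4: the remainder is at most 4 e^2 <= 1, and exp has derivative at most 3 up to 1. *)
    exists 12; split; [lra|]; intros e He; specialize (B e He).
    set (h := ln (G e) - e * g) in *.
    replace (RtoC (exp h) - 1 - RtoC e * 0)%C with (RtoC (exp h - exp 0))
      by (rewrite exp_0, RtoC_minus; ring).
    rewrite Cmod_R.
    assert (He2 : 4 * e ^ 2 <= 1).
    { rewrite <- (pow2_abs e); pose proof (Rabs_pos e); simpl; nra. }
    apply Rle_trans with (3 * Rabs (h - 0)); [|rewrite Rminus_0_r; lra].
    apply (MVT_bound exp exp); intros t Ht.
    + apply is_derive_exp.
    + rewrite Rabs_pos_eq by apply Rlt_le, exp_pos.
      assert (t <= 1).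
      { apply Rle_trans with (Rmax 0 h); [lra|].
        apply Rmax_lub; [lra|]; eapply Rle_trans; [apply Rle_abs|lra]. }
      apply Rle_trans with (exp 1); [|exact exp_le_3].
      destruct (Req_dec t 1) as [->|]; [lra|]; apply Rlt_le, exp_increasing; lra.
Qed.

(** [quad] uniformly in the index, up to geometric growth, which the factor 1 / m! of the Bessel
    series absorbs. *)
Definition uquad (f : R -> nat -> C) (a b : nat -> C) : Prop :=
  exists U K : R, 0 <= U /\ 0 <= K /\ forall m,
    Cmod (a m) <= U * K ^ m /\ Cmod (b m) <= U * K ^ m /\
    forall e, Rabs e <= / 2 -> Cmod (f e m - a m - RtoC e * b m) <= U * K ^ m * e ^ 2.

Lemma uquad_ext (f g : R -> nat -> C) (a b : nat -> C) :
  (forall e m, f e m = g e m) -> uquad f a b -> uquad g a b.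
Proof.
  intros E (U & K & HU & HK & H); exists U, K; do 2 (split; trivial).
  intro m; destruct (H m) as (H1 & H2 & H3); do 2 (split; trivial).
  intros e He; rewrite <- E; auto.
Qed.

Lemma uquad_shift (n : nat) (f : R -> nat -> C) (a b : nat -> C) :
  uquad f a b ->
  uquad (fun e m => f e (n + m)%nat) (fun m => a (n + m)%nat) (fun m => b (n + m)%nat).
Proof.
  intros (U & K & HU & HK & H); exists (U * K ^ n), K; split.
  { apply Rmult_le_pos; trivial; now apply pow_le. }
  split; trivial; intro m; rewrite Rmult_assoc, <- pow_add; apply H.
Qed.

Lemma INR_le_pow2 (m : nat) : INR m + 1 <= 2 ^ m.
Proof.
  induction m as [|m IH]; [simpl; lra|].
  rewrite S_INR; simpl; pose proof (pos_INR m); lra.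
Qed.

(** One backward step of the recurrence of 1 / Gamma: the slope follows the product rule, and the
    linear factor is paid for by doubling [K]. *)
Lemma uquad_linear (n : nat) (f : R -> nat -> C) (a b : nat -> C) :
  uquad f a b ->
  uquad (fun e m => RtoC (INR m - INR n + e) * f e m)%C
    (fun m => RtoC (INR m - INR n) * a m)%C
    (fun m => RtoC (INR m - INR n) * b m + a m)%C.
Proof.
  intros (U & K & HU & HK & H); exists (U * (INR n + 3)), (2 * K).
  pose proof (pos_INR n) as Hn.
  split; [apply Rmult_le_pos; lra|]; split; [lra|].
  intro m; destruct (H m) as (H1 & H2 & H3).
  pose proof (INR_le_pow2 m) as Hm; pose proof (pos_INR m) as Hm0.
  rewrite Rpow_mult_distr.
  assert (Hp : 0 <= U * K ^ m) by (apply Rmult_le_pos; trivial; now apply pow_le).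
  assert (B : Rabs (INR m - INR n) <= (INR n + 1) * 2 ^ m) by (apply Rabs_le; nra).
  set (T := 2 ^ m) in *; set (V := U * K ^ m) in *.
  replace (U * (INR n + 3) * (T * K ^ m)) with ((INR n + 3) * T * V) by (unfold V; ring).
  pose proof (Cmod_ge_0 (a m)); pose proof (Cmod_ge_0 (b m)).
  pose proof (Rabs_pos (INR m - INR n)) as HA.
  assert (HT : 1 <= T) by lra.
  assert (Q : (INR n + 1) * T + 1 <= (INR n + 3) * T) by nra.
  assert (Q' : ((INR n + 1) * T + 1) * V <= (INR n + 3) * T * V)
    by (apply Rmult_le_compat_r; trivial).
  assert (P : forall x, Cmod x <= V ->
    Cmod (RtoC (INR m - INR n) * x) <= (INR n + 1) * T * V).
  { intros x Hx; rewrite Cmod_mult, Cmod_R.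
    apply Rmult_le_compat; trivial; apply Cmod_ge_0. }
  split; [|split].
  - eapply Rle_trans; [now apply P|]; lra.
  - eapply Rle_trans; [apply Cmod_triangle|]; pose proof (P _ H2); lra.
  - intros e He; specialize (H3 e He).
    set (u := (f e m - a m - RtoC e * b m)%C) in *.
    match goal with |- Cmod ?x <= _ =>
      replace x with (RtoC (INR m - INR n + e) * u + RtoC (e ^ 2) * b m)%C end.
    2: { unfold u; rewrite RtoC_pow, RtoC_plus; simpl; ring. }
    eapply Rle_trans; [apply Cmod_triangle|].
    pose proof (pow2_ge_0 e) as He2.
    rewrite !Cmod_mult, !Cmod_R, (Rabs_pos_eq (e ^ 2)) by trivial.
    assert (B' : Rabs (INR m - INR n + e) <= (INR n + 1) * T + 1).
    { eapply Rle_trans; [apply Rabs_triang|]; lra. }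
    assert (T1 : Rabs (INR m - INR n + e) * Cmod u <= ((INR n + 1) * T + 1) * (V * e ^ 2)).
    { apply Rmult_le_compat; trivial; [apply Rabs_pos|apply Cmod_ge_0]. }
    assert (T2 : e ^ 2 * Cmod (b m) <= e ^ 2 * V) by (apply Rmult_le_compat_l; trivial).
    assert (T3 : ((INR n + 1) * T + 2) * (V * e ^ 2) <= (INR n + 3) * T * (V * e ^ 2)).
    { apply Rmult_le_compat_r; [apply Rmult_le_pos; trivial|nra]. }
    lra.
Qed.

(** * Values and slopes of 1 / Gamma at the integers *)

Definition g0 (m : nat) : C := RtoC (/ INR (fact m)).

(** The derivative of 1 / Gamma at m + 1, computed from its derivative [g] at 1 by the
    differentiated recurrence. *)
Fixpoint g1 (g : C) (m : nat) : C :=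
  match m with
  | O => g
  | S p => ((g1 g p - g0 m) / RtoC (INR m))%C
  end.

Lemma INR_S_neq_0 (m : nat) : RtoC (INR (S m)) <> 0.
Proof. apply RtoC_neq_0, not_0_INR; lia. Qed.

Lemma g0_S (m : nat) : g0 m = (RtoC (INR (S m)) * g0 (S m))%C.
Proof.
  unfold g0; rewrite <- RtoC_mult; f_equal.
  rewrite fact_simpl, mult_INR; field; split;
    [apply INR_fact_neq_0|apply not_0_INR; lia].
Qed.

Lemma g1_S (g : C) (m : nat) : g1 g m = (RtoC (INR (S m)) * g1 g (S m) + g0 (S m))%C.
Proof. cbn [g1]; field; apply INR_S_neq_0. Qed.

Lemma Cmod_le_of_mult (c : R) (x : C) (k : R) :
  / 2 <= c -> Cmod (RtoC c * x) <= k -> Cmod x <= 2 * k.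
Proof.
  intros Hc H; rewrite Cmod_mult, Cmod_R, Rabs_pos_eq in H by lra.
  pose proof (Cmod_ge_0 x); nra.
Qed.

(** Dividing the recurrence by m + 1 + e >= 1/2 costs a factor 2 at each step and the slopes grow at
    most like 2^m; the ratio 4 and the constant [U] leave room for both. *)
Lemma uquad_rGamma_pos : exists g : C,
  uquad (fun e m => rGamma (RtoC (INR m + 1 + e))) g0 (g1 g).
Proof.
  destruct rGamma_1_expansion as [g' (K0 & HK0 & HQ)]; exists (RtoC g').
  set (g := RtoC g') in *; set (R0 := Cmod g); set (U := K0 + 4 * (R0 + 1)).
  assert (HR : 0 <= R0) by apply Cmod_ge_0.
  assert (P2 : forall m, 1 <= 2 ^ m <= 4 ^ m).
  { intro m; split; [apply pow_R1_Rle; lra|apply pow_incr; lra]. }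
  assert (B0 : forall m, Cmod (g0 m) <= 1).
  { intro m; unfold g0; rewrite Cmod_R, Rabs_pos_eq.
    - rewrite <- Rinv_1; apply Rinv_le_contravar; [lra|].
      apply (le_INR 1), lt_O_fact.
    - apply Rlt_le, Rinv_0_lt_compat, INR_fact_lt_0. }
  assert (B1 : forall m, Cmod (g1 g m) <= (R0 + 1) * 2 ^ m).
  { induction m as [|m IH]; [simpl; fold R0; lra|].
    assert (Hm : 1 <= INR (S m)) by (apply (le_INR 1); lia).
    assert (H : Cmod (RtoC (INR (S m)) * g1 g (S m)) <= (R0 + 1) * 2 ^ m + 1).
    { replace (RtoC (INR (S m)) * g1 g (S m))%C with (g1 g m + - g0 (S m))%C
        by (rewrite g1_S; ring).
      eapply Rle_trans; [apply Cmod_triangle|]; rewrite Cmod_opp.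
      pose proof (B0 (S m)); lra. }
    rewrite Cmod_mult, Cmod_R, Rabs_pos_eq in H by lra.
    pose proof (Cmod_ge_0 (g1 g (S m))); pose proof (P2 m).
    cbn [pow]; nra. }
  exists U, 4; split; [unfold U; lra|]; split; [lra|].
  intro m; pose proof (B0 m) as B0m; pose proof (B1 m) as B1m; pose proof (P2 m) as P2m.
  split; [unfold U; nra|]; split; [unfold U; nra|].
  clear B0m B1m P2m.
  intros e He; induction m as [|m IH].
  - simpl (4 ^ 0); rewrite Rmult_1_r; simpl INR; rewrite Rplus_0_l.
    replace (g0 0) with (RtoC 1) by (unfold g0; simpl; now rewrite Rinv_1).
    eapply Rle_trans; [apply HQ, He|].
    pose proof (pow2_ge_0 e); unfold U; nra.
  - set (u := fun m => (rGamma (RtoC (INR m + 1 + e)) - g0 m - RtoC e * g1 g m)%C) in *.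
    fold (u (S m)); change (Cmod (u m) <= U * 4 ^ m * e ^ 2) in IH.
    (* The remainders satisfy the recurrence of 1 / Gamma up to a term of second order in e. *)
    assert (E : (RtoC (INR (S m) + e) * u (S m))%C = (u m - RtoC (e ^ 2) * g1 g (S m))%C).
    { unfold u; rewrite (rGamma_rec (RtoC (INR m + 1 + e))).
      replace (RtoC (INR m + 1 + e) + 1)%C with (RtoC (INR (S m) + 1 + e))
        by (rewrite S_INR, !RtoC_plus; ring).
      replace (RtoC (INR m + 1 + e)) with (RtoC (INR (S m)) + RtoC e)%C
        by (rewrite S_INR, !RtoC_plus; ring).
      rewrite (g0_S m), (g1_S g m), RtoC_pow, RtoC_plus; simpl; ring. }
    assert (Hm : 1 <= INR (S m)) by (apply (le_INR 1); lia).
    assert (He' := He); apply Rabs_le_between in He'.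
    apply Rle_trans with (2 * (U * 4 ^ m * e ^ 2 + e ^ 2 * ((R0 + 1) * (2 * 2 ^ m)))).
    + apply (Cmod_le_of_mult (INR (S m) + e)); [lra|].
      rewrite E; eapply Rle_trans; [apply Cmod_triangle|]; rewrite Cmod_opp.
      apply Rplus_le_compat; trivial.
      rewrite Cmod_mult, Cmod_R, Rabs_pos_eq by apply pow2_ge_0.
      apply Rmult_le_compat_l; [apply pow2_ge_0|]; apply (B1 (S m)).
    + pose proof (pow2_ge_0 e); pose proof (P2 m); cbn [pow].
      assert (U * 4 ^ m + (R0 + 1) * (2 * 2 ^ m) <= 2 * U * 4 ^ m).
      { unfold U; assert ((R0 + 1) * 2 ^ m <= (R0 + 1) * 4 ^ m)
          by (apply Rmult_le_compat_l; lra).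
        assert (0 <= K0 * 4 ^ m) by (apply Rmult_le_pos; lra).
        assert (0 <= (R0 + 1) * 4 ^ m) by (apply Rmult_le_pos; lra).
        lra. }
      replace (2 * (U * 4 ^ m * (e * (e * 1)) + e * (e * 1) * ((R0 + 1) * (2 * 2 ^ m))))
        with (2 * (e ^ 2 * (U * 4 ^ m + (R0 + 1) * (2 * 2 ^ m)))) by ring.
      replace (U * (4 * 4 ^ m) * (e * (e * 1))) with (2 * (e ^ 2 * (2 * U * 4 ^ m))) by ring.
      apply Rmult_le_compat_l; [lra|]; now apply Rmult_le_compat_l.
Qed.

(* [h0 n] and [h1 g n] are the coefficients of order 0 and 1 in [e] of
   1 / Gamma (m - n + 1 + e). *)
Fixpoint h0 (n m : nat) : C :=
  match n with
  | O => g0 m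
  | S p => (RtoC (INR m - INR p) * h0 p m)%C
  end.

Fixpoint h1 (g : C) (n m : nat) : C :=
  match n with
  | O => g1 g m
  | S p => (RtoC (INR m - INR p) * h1 g p m + h0 p m)%C
  end.

Lemma h0_rec (n m : nat) : h0 n m = (RtoC (INR (S m) - INR n) * h0 n (S m))%C.
Proof.
  induction n as [|n IH]; cbn [h0].
  - rewrite g0_S; simpl (INR 0); now rewrite Rminus_0_r.
  - rewrite IH, !S_INR, !RtoC_minus, !RtoC_plus; ring.
Qed.

Lemma h1_rec (g : C) (n m : nat) :
  h1 g n m = (RtoC (INR (S m) - INR n) * h1 g n (S m) + h0 n (S m))%C.
Proof.
  induction n as [|n IH]; cbn [h0 h1].
  - rewrite g1_S; simpl (INR 0); now rewrite Rminus_0_r.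
  - rewrite IH, (h0_rec n m), !S_INR, !RtoC_minus, !RtoC_plus; ring.
Qed.

Lemma h0_shift (n m : nat) : h0 n (m + n) = g0 m.
Proof.
  revert m; induction n as [|n IH]; intro m; cbn [h0]; [now rewrite Nat.add_0_r|].
  replace (m + S n)%nat with (S m + n)%nat by lia; rewrite IH, (g0_S m).
  f_equal; f_equal; rewrite plus_INR; ring.
Qed.

(** These are the zeros of 1 / Gamma at 0, -1, -2, ... *)
Lemma h0_low (n m : nat) : (m < n)%nat -> h0 n m = 0.
Proof.
  induction n as [|n IH]; intro H; [lia|]; cbn [h0].
  destruct (Nat.eq_dec m n) as [->|h].
  - rewrite Rminus_diag; ring.
  - rewrite IH by lia; ring.
Qed.

(** The zeros of 1 / Gamma are simple; this keeps the singular leading term of the second solution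
    nonzero. *)
Lemma h1_0_neq_0 (g : C) (n : nat) : h1 g (S n) 0 <> 0.
Proof.
  induction n as [|n IH].
  - cbn [h0 h1]; simpl INR; rewrite Rminus_diag.
    replace (g0 0) with (RtoC 1) by (unfold g0; simpl; now rewrite Rinv_1).
    replace (0 * g1 g 0 + 1)%C with (RtoC 1) by ring; exact C1_nz.
  - change (h1 g (S (S n)) 0) with (RtoC (INR 0 - INR (S n)) * h1 g (S n) 0 + h0 (S n) 0)%C.
    rewrite h0_low by lia; rewrite Cplus_0_r.
    apply Cmult_neq_0; trivial; apply RtoC_neq_0.
    assert (1 <= INR (S n)) by (apply (le_INR 1); lia); simpl (INR 0); lra.
Qed.

(** A single number, the slope at 1, gives the expansions at all integers; it is carried abstractly
    from here on. *)
Definition gamma_slope (g : C) : Prop := forall n : nat,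
  uquad (fun e m => rGamma (RtoC (INR m - INR n + 1 + e))) (h0 n) (h1 g n).

Lemma uquad_rGamma : exists g : C, gamma_slope g.
Proof.
  destruct uquad_rGamma_pos as [g Hg]; exists g; intro n; induction n as [|n IH].
  - apply (uquad_ext (fun e m => rGamma (RtoC (INR m + 1 + e)))); trivial.
    intros; simpl (INR 0); now rewrite Rminus_0_r.
  - eapply uquad_ext; [|exact (uquad_linear n _ _ _ IH)].
    intros e m; cbv beta.
    rewrite (rGamma_rec (RtoC (INR m - INR (S n) + 1 + e))), S_INR.
    f_equal; [f_equal; ring|f_equal].
    rewrite !RtoC_plus, !RtoC_minus, !RtoC_plus; ring.
Qed.

(** * From coefficients to sums of series *)

Definition sgn_fact (m : nat) : C := RtoC ((-1) ^ m / INR (fact m)).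

Lemma Cmod_sgn_fact (m : nat) : Cmod (sgn_fact m) = / INR (fact m).
Proof.
  unfold sgn_fact, Rdiv; rewrite Cmod_R, Rabs_mult, pow_1_abs, Rmult_1_l.
  apply Rabs_pos_eq, Rlt_le, Rinv_0_lt_compat, INR_fact_lt_0.
Qed.

Lemma entire_sgn_fact (a : nat -> C) (U K : R) : 0 <= K ->
  (forall m, Cmod (a m) <= U * K ^ m) -> entire (fun m => sgn_fact m * a m)%C.
Proof.
  intros HK H; exists U, K; split; trivial; intro m.
  rewrite Cmod_mult, Cmod_sgn_fact; unfold Rdiv; rewrite <- Rmult_assoc, Rmult_comm.
  apply Rmult_le_compat_r; trivial; apply Rlt_le, Rinv_0_lt_compat, INR_fact_lt_0.
Qed.

(** Comparison with the exponential series. *)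
Lemma PSeries_bound (a : nat -> R) (M K x : R) : 0 <= K ->
  (forall n, Rabs (a n) <= M * (K ^ n / INR (fact n))) ->
  Rabs (PSeries a x) <= M * exp (K * Rabs x).
Proof.
  intros HK H; unfold PSeries.
  assert (E : is_series (fun n => M * ((K * Rabs x) ^ n / INR (fact n))) (M * exp (K * Rabs x))).
  { apply (is_series_scal_l M (fun n => (K * Rabs x) ^ n / INR (fact n))).
    generalize (is_exp_Reals (K * Rabs x)); unfold is_pseries; apply is_series_ext.
    intro n; rewrite pow_n_pow; unfold scal; simpl; unfold mult; simpl; unfold Rdiv; ring. }
  assert (B : forall n, 0 <= Rabs (a n * x ^ n) <= M * ((K * Rabs x) ^ n / INR (fact n))).
  { intro n; split; [apply Rabs_pos|].
    rewrite Rabs_mult, <- RPow_abs, Rpow_mult_distr.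
    replace (M * (K ^ n * Rabs x ^ n / INR (fact n)))
      with (M * (K ^ n / INR (fact n)) * Rabs x ^ n) by (unfold Rdiv; ring).
    apply Rmult_le_compat_r; trivial; apply pow_le, Rabs_pos. }
  assert (X : ex_series (fun n => M * ((K * Rabs x) ^ n / INR (fact n)))) by now eexists; exact E.
  assert (Xa : ex_series (fun n => Rabs (a n * x ^ n))).
  { apply (ex_series_le (K:=R_AbsRing) (V:=R_CompleteNormedModule) _ _) with (2 := X).
    intro n; unfold norm; simpl; unfold abs; simpl; rewrite Rabs_Rabsolu; apply B. }
  eapply Rle_trans; [now apply Series_Rabs|].
  rewrite <- (is_series_unique _ _ E); now apply Series_le.
Qed.

Lemma CP_bound (a : nat -> C) (M K x : R) : 0 <= K ->
  (forall n, Cmod (a n) <= M * (K ^ n / INR (fact n))) ->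
  Cmod (CP a x) <= 2 * (M * exp (K * Rabs x)).
Proof.
  intros HK H; eapply Rle_trans; [apply Cmod_le_abs|].
  assert (A : Rabs (Re (CP a x)) <= M * exp (K * Rabs x)).
  { apply PSeries_bound; trivial; intro n; eapply Rle_trans; [apply re_le_Cmod|apply H]. }
  assert (B : Rabs (Im (CP a x)) <= M * exp (K * Rabs x)).
  { apply PSeries_bound; trivial; intro n; eapply Rle_trans; [apply im_le_Cmod|apply H]. }
  lra.
Qed.

Lemma uquad_entire (f : R -> nat -> C) (a b : nat -> C) : uquad f a b ->
  entire (fun m => sgn_fact m * a m)%C /\ entire (fun m => sgn_fact m * b m)%C.
Proof.
  intros (U & K & HU & HK & H); split; apply (entire_sgn_fact _ U K HK); apply H.
Qed.

(** Limit and sum are exchanged here: the series of the remainders is itself bounded by a multiple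
    of e^2. *)
Lemma quad_CP (f : R -> nat -> C) (a b : nat -> C) (x : R) : uquad f a b ->
  quad (fun e => CP (fun m => sgn_fact m * f e m)%C x)
    (CP (fun m => sgn_fact m * a m)%C x) (CP (fun m => sgn_fact m * b m)%C x).
Proof.
  intro Hq; destruct (uquad_entire f a b Hq) as [Ea Eb].
  destruct Hq as (U & K & HU & HK & H).
  exists (2 * (U * exp (K * Rabs x))); split.
  { pose proof (exp_pos (K * Rabs x)); nra. }
  intros e He.
  set (u := fun m => (sgn_fact m * (f e m - a m - RtoC e * b m))%C).
  assert (Bu : forall m, Cmod (u m) <= U * e ^ 2 * (K ^ m / INR (fact m))).
  { intro m; unfold u; rewrite Cmod_mult, Cmod_sgn_fact.
    destruct (H m) as (_ & _ & H3); specialize (H3 e He).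
    replace (U * e ^ 2 * (K ^ m / INR (fact m))) with (/ INR (fact m) * (U * K ^ m * e ^ 2))
      by (unfold Rdiv; ring).
    apply Rmult_le_compat_l; trivial; apply Rlt_le, Rinv_0_lt_compat, INR_fact_lt_0. }
  assert (Eu : entire u) by (exists (U * e ^ 2), K; now split).
  rewrite (CP_ext (fun m => sgn_fact m * f e m)%C
    (fun m => u m + (sgn_fact m * a m + RtoC e * (sgn_fact m * b m)))%C)
    by (intro m; unfold u; ring).
  rewrite CP_plus, CP_plus, CP_scal; auto using entire_plus, entire_scal.
  match goal with |- Cmod ?y <= _ => replace y with (CP u x) by ring end.
  eapply Rle_trans; [apply (CP_bound u (U * e ^ 2) K x HK Bu)|]; right; ring.
Qed.

(** * The radial equation *)

(* [g] is [r f'], and the equation is [r (r f')' + (lam r^2 + m) f = 0]. *)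
Definition radial (m lam : R) (f g : R -> C) : Prop :=
  forall r, 0 < r ->
    cderiv f r (RtoC (/ r) * g r)%C /\
    cderiv g r (RtoC (/ r) * - (RtoC (lam * r ^ 2 + m) * f r))%C.

Lemma radial_comb (m lam : R) (a b : C) (f g f' g' : R -> C) :
  radial m lam f g -> radial m lam f' g' ->
  radial m lam (fun r => a * f r + b * f' r)%C (fun r => a * g r + b * g' r)%C.
Proof.
  intros H H' r Hr; destruct (H r Hr) as [H1 H2], (H' r Hr) as [H1' H2']; split.
  - eapply cderiv_eq; [apply cderiv_plus; apply cderiv_scal; eassumption|cbv beta; ring].
  - eapply cderiv_eq; [apply cderiv_plus; apply cderiv_scal; eassumption|cbv beta; ring].
Qed.

(** For [radial] pairs the second functions are r times derivatives, so this is r times the usual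
    Wronskian. *)
Definition wronskian (f g f' g' : R -> C) (r : R) : C := (f r * g' r - f' r * g r)%C.

Lemma wronskian_const (m lam : R) (f g f' g' : R -> C) :
  radial m lam f g -> radial m lam f' g' ->
  forall r s, 0 < r -> 0 < s -> wronskian f g f' g' r = wronskian f g f' g' s.
Proof.
  intros H H'; apply (cderiv_zero_const _ (fun r => 0 < r)); [intros; lra|].
  intros r Hr; destruct (H r Hr) as [H1 H2], (H' r Hr) as [H1' H2'].
  eapply cderiv_eq; [apply cderiv_minus; apply cderiv_mult; eassumption|ring].
Qed.

Lemma radial_span (m lam : R) (f g f' g' F G : R -> C) :
  radial m lam f g -> radial m lam f' g' -> radial m lam F G ->
  wronskian f g f' g' 1 <> 0 ->
  exists a b : C, forall r, 0 < r -> F r = (a * f r + b * f' r)%C.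
Proof.
  intros H H' HF W.
  (* Cramer's rule at r; the coefficients may be evaluated at 1 since the Wronskians are
     constant. *)
  exists (wronskian F G f' g' 1 / wronskian f g f' g' 1)%C,
         (wronskian f g F G 1 / wronskian f g f' g' 1)%C; intros r Hr.
  pose proof Rlt_0_1 as H1.
  rewrite (wronskian_const _ _ _ _ _ _ HF H' 1 r), (wronskian_const _ _ _ _ _ _ H HF 1 r)
    by trivial.
  rewrite (wronskian_const _ _ _ _ _ _ H H' 1 r) in * by trivial.
  unfold wronskian in *; field; trivial.
Qed.

(** * Frobenius series *)

Definition rpow (rho : C) (r : R) : C := Cexp (rho * RtoC (ln r)).

(** A Frobenius series in lam r^2 / 4, the square of s r / 2 when s^2 = lam; this variable is real
    for either sign of lam. *)
Definition frob (lam : R) (rho : C) (a : nat -> C) (r : R) : C :=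
  (rpow rho r * CP a (lam * r ^ 2 / 4))%C.

(** The operator r d/dr on coefficients: the n-th term of [frob] carries the power r^(rho + 2 n). *)
Definition theta (rho : C) (a : nat -> C) (n : nat) : C :=
  ((rho + 2 * RtoC (INR n)) * a n)%C.

Lemma entire_theta (rho : C) (a : nat -> C) : entire a -> entire (theta rho a).
Proof. apply entire_linear_coef. Qed.

Lemma CP_theta (rho : C) (a : nat -> C) (x : R) : entire a ->
  CP (theta rho a) x =
  (rho * CP a x + 2 * RtoC x * CP (fun n => RtoC (INR (S n)) * a (S n))%C x)%C.
Proof.
  intro Ha; pose proof (entire_der a Ha) as Hd.
  assert (Hs : entire (cshift (fun n => RtoC (INR (S n)) * a (S n))%C)).
  { apply (entire_ext (fun n => 0 * a n + / 2 * ((0 + 2 * RtoC (INR n)) * a n))%C).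
    - intros [|n]; unfold cshift; [simpl|]; field.
    - apply entire_plus; apply entire_scal; trivial; now apply entire_linear_coef. }
  rewrite (CP_ext _ (fun n => rho * a n
    + 2 * cshift (fun n => RtoC (INR (S n)) * a (S n)) n)%C).
  - rewrite CP_plus, !CP_scal, CP_shift by (auto using entire_scal); ring.
  - intros [|n]; unfold theta, cshift; [simpl|]; ring.
Qed.

Lemma cderiv_rpow (rho : C) (r : R) : 0 < r ->
  cderiv (rpow rho) r (RtoC (/ r) * (rho * rpow rho r))%C.
Proof.
  intro Hr; eapply cderiv_eq.
  - apply cderiv_Cexp_scal; apply is_derive_ln, Hr.
  - unfold rpow; ring.
Qed.

Lemma cderiv_CP_square (lam : R) (a : nat -> C) (r : R) : entire a ->
  cderiv (fun r => CP a (lam * r ^ 2 / 4)) r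
    (RtoC (lam * r / 2) * CP (fun n => RtoC (INR (S n)) * a (S n)) (lam * r ^ 2 / 4))%C.
Proof.
  intro Ha; apply (cderiv_comp (CP a) (fun r => lam * r ^ 2 / 4)).
  - now apply cderiv_CP.
  - auto_derive; trivial; field.
Qed.

Lemma cderiv_frob (lam : R) (rho : C) (a : nat -> C) (r : R) : entire a -> 0 < r ->
  cderiv (frob lam rho a) r (RtoC (/ r) * frob lam rho (theta rho a) r)%C.
Proof.
  intros Ha Hr; eapply cderiv_eq.
  - apply cderiv_mult; [now apply cderiv_rpow|now apply cderiv_CP_square].
  - unfold frob; rewrite CP_theta by trivial.
    replace (lam * r / 2) with (/ r * (2 * (lam * r ^ 2 / 4))) by (field; lra).
    rewrite !RtoC_mult; ring.
Qed.

(** K^n / n! equals (n + 1) K^n / (n + 1)!, where n + 1 <= 2^n; replacing K by K + 1 makes the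
    additional power harmless. *)
Lemma entire_cshift (a : nat -> C) : entire a -> entire (cshift a).
Proof.
  intro Ha; destruct Ha as (M & K & HK & H).
  assert (HM : 0 <= M).
  { specialize (H O); simpl in H; pose proof (Cmod_ge_0 (a O)); lra. }
  exists M, (2 * (K + 1)); split; [lra|]; intros [|n]; unfold cshift.
  - rewrite Cmod_0; simpl; lra.
  - eapply Rle_trans; [apply H|]; apply Rmult_le_compat_l; trivial.
    pose proof (INR_fact_lt_0 n) as Hf; pose proof (INR_fact_lt_0 (S n)) as Hf'.
    apply Rmult_le_reg_r with (INR (fact (S n))); trivial.
    replace ((2 * (K + 1)) ^ S n / INR (fact (S n)) * INR (fact (S n)))
      with ((2 * (K + 1)) ^ S n) by (field; lra).
    rewrite fact_simpl, mult_INR.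
    replace (K ^ n / INR (fact n) * (INR (S n) * INR (fact n))) with (K ^ n * INR (S n))
      by (field; lra).
    rewrite Rpow_mult_distr, Rmult_comm.
    pose proof (INR_le_pow2 n); rewrite S_INR; cbn [pow].
    assert (K ^ n <= (K + 1) ^ n) by (apply pow_incr; lra).
    assert (0 <= K ^ n) by now apply pow_le.
    pose proof (pos_INR n).
    apply Rmult_le_compat; try lra; nra.
Qed.

(** Multiplication by lam r^2 is four times a shift of the coefficients, so the differential
    operator becomes an operator on sequences. *)
Lemma frob_operator (lam m : R) (rho : C) (a : nat -> C) (r : R) : entire a ->
  (frob lam rho (theta rho (theta rho a)) r + RtoC (lam * r ^ 2 + m) * frob lam rho a r)%C =
  frob lam rho (fun n => theta rho (theta rho a) n + (RtoC m * a n + 4 * cshift a n))%C r.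
Proof.
  intro Ha; unfold frob; set (x := lam * r ^ 2 / 4).
  pose proof (entire_cshift a Ha) as Es.
  rewrite !CP_plus, !CP_scal, CP_shift
    by auto using entire_plus, entire_scal, entire_theta.
  replace (lam * r ^ 2 + m) with (4 * x + m) by (unfold x; field).
  rewrite RtoC_plus, RtoC_mult; ring.
Qed.

Lemma frob_radial (m lam : R) (rho : C) (a : nat -> C) : entire a ->
  (forall n, (theta rho (theta rho a) n + (RtoC m * a n + 4 * cshift a n))%C = 0) ->
  radial m lam (frob lam rho a) (frob lam rho (theta rho a)).
Proof.
  intros Ha E r Hr; split; [now apply cderiv_frob|].
  eapply cderiv_eq; [apply cderiv_frob; trivial; now apply entire_theta|]; f_equal.
  assert (F := frob_operator lam m rho a r Ha).
  assert (Z : frob lam rho (fun n => theta rho (theta rho a) n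
    + (RtoC m * a n + 4 * cshift a n))%C r = 0).
  { unfold frob; rewrite (CP_ext _ (fun n => 0 * a n)%C).
    - rewrite CP_scal by trivial; ring.
    - intro n; rewrite E; ring. }
  rewrite Z in F.
  transitivity ((frob lam rho (theta rho (theta rho a)) r
    + RtoC (lam * r ^ 2 + m) * frob lam rho a r)
    - RtoC (lam * r ^ 2 + m) * frob lam rho a r)%C; [ring|rewrite F; ring].
Qed.

Lemma rpow_plus (a b : C) (r : R) : (rpow a r * rpow b r)%C = rpow (a + b) r.
Proof. unfold rpow; rewrite <- Cexp_plus; f_equal; ring. Qed.

Lemma rpow_0 (r : R) : rpow 0 r = 1.
Proof. unfold rpow; rewrite Cmult_0_l; apply Cexp_0. Qed.

Lemma rpow_nat (n : nat) (r : R) : 0 < r -> rpow (RtoC (INR n)) r = RtoC (r ^ n).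
Proof.
  intro Hr; unfold rpow; rewrite <- RtoC_mult, Cexp_RtoC; f_equal.
  rewrite <- (Rpower_pow n r Hr); reflexivity.
Qed.

(** Differentiability at 0 serves through the continuity it implies there. *)
Lemma right_limit_value (V : R -> C) (K l : C) :
  cderiv V 0 l -> (forall r, 0 < r -> V r = K) -> V 0 = K.
Proof.
  intros [D1 D2] H.
  assert (L : forall (f : R -> R) d k, is_derive f 0 d ->
    (forall r, 0 < r -> f r = k) -> f 0 = k).
  { intros f d k Hd Hk; destruct (Req_dec (f 0) k) as [E|n]; trivial; exfalso.
    assert (Ct : continuous f 0) by (apply @ex_derive_continuous; eexists; exact Hd).
    assert (He : 0 < Rabs (f 0 - k)) by (apply Rabs_pos_lt; lra).
    destruct (proj1 (filterlim_locally f (f 0)) Ct (mkposreal _ He)) as [dl Hdl].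
    assert (Hp : 0 < dl / 2) by (destruct dl; simpl; lra).
    specialize (Hdl (dl / 2)).
    unfold ball in Hdl; simpl in Hdl; unfold AbsRing_ball, abs, minus, plus, opp in Hdl;
      simpl in Hdl.
    rewrite Hk in Hdl by trivial.
    assert (Rabs (k + - f 0) < Rabs (f 0 - k)).
    { apply Hdl; rewrite Rabs_pos_eq; lra. }
    replace (k + - f 0) with (- (f 0 - k)) in H0 by ring; rewrite Rabs_Ropp in H0; lra. }
  apply injective_projections.
  - apply (L (fun r => Re (V r)) _ (Re K) D1); intros r Hr; now rewrite H.
  - apply (L (fun r => Im (V r)) _ (Im K) D2); intros r Hr; now rewrite H.
Qed.

(** The powers r^rho and r^(-rho) cancel, so the Wronskian is built from power series in r^2 and can
    be evaluated at r = 0, where only the leading coefficients remain. *)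
Lemma frob_wronskian (lam : R) (rho : C) (a b : nat -> C) (K : C) :
  entire a -> entire b ->
  (forall r, 0 < r -> wronskian (frob lam rho a) (frob lam rho (theta rho a))
     (frob lam (- rho) b) (frob lam (- rho) (theta (- rho) b)) r = K) ->
  K = (-2 * rho * a O * b O)%C.
Proof.
  intros Ha Hb H.
  set (V := fun r => (CP a (lam * r ^ 2 / 4) * CP (theta (- rho) b) (lam * r ^ 2 / 4)
    - CP b (lam * r ^ 2 / 4) * CP (theta rho a) (lam * r ^ 2 / 4))%C).
  assert (E : forall r, 0 < r -> V r = K).
  { intros r Hr; rewrite <- (H r Hr); unfold V, wronskian, frob.
    transitivity (rpow rho r * rpow (- rho) r *
      (CP a (lam * r ^ 2 / 4) * CP (theta (- rho) b) (lam * r ^ 2 / 4)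
       - CP b (lam * r ^ 2 / 4) * CP (theta rho a) (lam * r ^ 2 / 4)))%C; [|ring].
    rewrite rpow_plus, Cplus_opp_r, rpow_0; ring. }
  rewrite <- (right_limit_value V K _ ltac:(unfold V; apply cderiv_minus; apply cderiv_mult;
    apply cderiv_CP_square; auto using entire_theta) E).
  unfold V; replace (lam * 0 ^ 2 / 4) with 0 by (simpl; field).
  rewrite !CP_0; unfold theta; simpl; ring.
Qed.

Definition bcoef (nu : C) (m : nat) : C :=
  (sgn_fact m * rGamma (nu + RtoC (INR m) + 1))%C.

Lemma eventually_decreasing_bounded (u : nat -> R) (m0 : nat) :
  (forall m, (m0 <= m)%nat -> u (S m) <= u m) -> exists B, forall m, u m <= B.
Proof.
  intro H.
  assert (F : forall n, exists B, forall m, (m <= n)%nat -> u m <= B).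
  { induction n as [|n [B HB]].
    - exists (u O); intros m Hm; replace m with O by lia; lra.
    - exists (Rmax B (u (S n))); intros m Hm.
      destruct (Nat.eq_dec m (S n)) as [->|h]; [apply Rmax_r|].
      eapply Rle_trans; [apply HB; lia|apply Rmax_l]. }
  destruct (F m0) as [B HB]; exists B; intro m.
  destruct (Nat.le_gt_cases m m0) as [h|h]; auto.
  assert (G : forall p, u (m0 + p)%nat <= B).
  { induction p as [|p IH]; [rewrite Nat.add_0_r; auto|].
    rewrite Nat.add_succ_r; eapply Rle_trans; [apply H; lia|exact IH]. }
  replace m with (m0 + (m - m0))%nat by lia; apply G.
Qed.

(** Once m exceeds the modulus of nu, the recurrence divides by a number of modulus at least 1, so
    the values of 1 / Gamma stay bounded. *)
Lemma entire_bcoef (nu : C) : entire (bcoef nu).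
Proof.
  destruct (nfloor_ex (Cmod nu)) as [m0 [_ Hm0]]; [apply Cmod_ge_0|].
  destruct (eventually_decreasing_bounded
    (fun m => Cmod (rGamma (nu + RtoC (INR m) + 1))) (S m0)) as [B HB].
  - intros m Hm.
    rewrite (rGamma_rec (nu + RtoC (INR m) + 1)).
    replace (nu + RtoC (INR (S m)) + 1)%C with (nu + RtoC (INR m) + 1 + 1)%C
      by (rewrite S_INR, RtoC_plus; ring).
    rewrite Cmod_mult.
    assert (H1 : 1 <= Cmod (nu + RtoC (INR m) + 1)).
    { assert (T := Cmod_triangle (nu + RtoC (INR m) + 1) (- nu)).
      replace (nu + RtoC (INR m) + 1 + - nu)%C with (RtoC (INR (S m))) in T
        by (rewrite S_INR, RtoC_plus; ring).
      rewrite Cmod_opp, Cmod_R, Rabs_pos_eq, S_INR in T by apply pos_INR.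
      apply le_INR in Hm; rewrite S_INR in Hm; lra. }
    pose proof (Cmod_ge_0 (rGamma (nu + RtoC (INR m) + 1 + 1))); nra.
  - apply (entire_sgn_fact _ B 1); [lra|]; intro m; rewrite pow1, Rmult_1_r; apply HB.
Qed.

Lemma sgn_fact_S (m : nat) : sgn_fact m = (- RtoC (INR (S m)) * sgn_fact (S m))%C.
Proof.
  unfold sgn_fact; rewrite <- RtoC_opp, <- RtoC_mult; f_equal.
  rewrite fact_simpl, mult_INR; cbn [pow]; field; split;
    [apply INR_fact_neq_0|apply not_0_INR; lia].
Qed.

Lemma bcoef_recurrence (nu : C) (m : R) (n : nat) : (nu * nu)%C = RtoC (- m) ->
  (theta nu (theta nu (bcoef nu)) n + (RtoC m * bcoef nu n + 4 * cshift (bcoef nu) n))%C = 0.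
Proof.
  intro Hnu; unfold theta.
  (* Since nu^2 = - m, the equation reduces to the Bessel recurrence n (n + nu) b_n + b_(n-1) =
     0. *)
  transitivity (4 * (RtoC (INR n) * (RtoC (INR n) + nu) * bcoef nu n + cshift (bcoef nu) n))%C.
  { replace (RtoC m) with (- (nu * nu))%C by (rewrite Hnu, RtoC_opp; ring); ring. }
  destruct n as [|n]; [simpl; ring|]; cbn [cshift]; unfold bcoef.
  rewrite (sgn_fact_S n), (rGamma_rec (nu + RtoC (INR n) + 1)).
  replace (nu + RtoC (INR n) + 1)%C with (nu + RtoC (INR (S n)))%C
    by (rewrite S_INR, RtoC_plus; ring).
  ring.
Qed.

Definition bessel_solution (lam : R) (nu : C) : R -> C := frob lam nu (bcoef nu).

Lemma bessel_solution_radial (m lam : R) (nu : C) : (nu * nu)%C = RtoC (- m) ->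
  radial m lam (bessel_solution lam nu) (frob lam nu (theta nu (bcoef nu))).
Proof.
  intro H; apply frob_radial; [apply entire_bcoef|intro n; now apply bcoef_recurrence].
Qed.

(** The constant (s / 2)^nu splits off from r^nu because the principal branch is multiplicative for
    the positive factor r. *)
Lemma BJ_eq (lam : R) (s nu : C) (r : R) : s <> 0 -> (s * s)%C = RtoC lam -> 0 < r ->
  BJ nu (s * RtoC r) = (Cexp (nu * Clog (s / 2)) * bessel_solution lam nu r)%C.
Proof.
  intros Hs Hl Hr; unfold BJ, bessel_solution, frob.
  assert (H2 : RtoC 2 <> 0) by (apply RtoC_neq_0; lra).
  assert (Hs2 : (s / 2)%C <> 0).
  { intro E; apply Hs; replace s with (s / 2 * 2)%C by (field; trivial); rewrite E; ring. }
  replace (s * RtoC r / 2)%C with (s / 2 * RtoC r)%C by (field; trivial).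
  replace (Cpower (s / 2 * RtoC r) nu) with (Cexp (nu * Clog (s / 2)) * rpow nu r)%C.
  2: { unfold Cpower, rpow; destruct (Ceq_dec (s / 2 * RtoC r) 0) as [E|_].
       - elim (Cmult_neq_0 _ _ Hs2 (RtoC_neq_0 r ltac:(lra)) E).
       - rewrite Clog_scal, <- Cexp_plus by trivial; f_equal; ring. }
  rewrite <- Cmult_assoc; f_equal; f_equal.
  assert (E : forall m, (sgn_fact m * rGamma (nu + RtoC (INR m) + 1)
      * Cpow (s / 2 * RtoC r) (2 * m))%C = (bcoef nu m * RtoC ((lam * r ^ 2 / 4) ^ m))%C).
  { intro m; unfold bcoef; f_equal; rewrite Cpow_mult_r, RtoC_pow; f_equal.
    replace (lam * r ^ 2 / 4) with (lam * (r * r / 4)) by field.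
    rewrite RtoC_mult, <- Hl, RtoC_div, RtoC_mult by lra; simpl; field. }
  unfold CSeries, CP, PSeries; apply injective_projections; simpl; apply Series_ext;
    intro m; fold (sgn_fact m).
  - change (Re (sgn_fact m * rGamma (nu + RtoC (INR m) + 1)
      * Cpow (s / 2 * RtoC r) (2 * m))%C = Re (bcoef nu m) * (lam * r ^ 2 / 4) ^ m).
    rewrite E; unfold Re; simpl; ring.
  - change (Im (sgn_fact m * rGamma (nu + RtoC (INR m) + 1)
      * Cpow (s / 2 * RtoC r) (2 * m))%C = Im (bcoef nu m) * (lam * r ^ 2 / 4) ^ m).
    rewrite E; unfold Im; simpl; ring.
Qed.

Lemma bessel_solution_wronskian (m lam : R) (nu : C) (r : R) :
  (nu * nu)%C = RtoC (- m) -> 0 < r ->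
  wronskian (bessel_solution lam nu) (frob lam nu (theta nu (bcoef nu)))
    (bessel_solution lam (- nu)) (frob lam (- nu) (theta (- nu) (bcoef (- nu)))) r
  = (-2 * nu * rGamma (nu + 1) * rGamma (- nu + 1))%C.
Proof.
  intros H Hr.
  assert (H' : (- nu * - nu)%C = RtoC (- m)) by (rewrite <- H; ring).
  set (K := wronskian _ _ _ _ r).
  assert (E : K = (-2 * nu * bcoef nu 0 * bcoef (- nu) 0)%C).
  { apply (frob_wronskian lam); [apply entire_bcoef|apply entire_bcoef|].
    intros q Hq; unfold K.
    apply (wronskian_const m lam); trivial; now apply bessel_solution_radial. }
  rewrite E; unfold bcoef, sgn_fact; simpl.
  replace (1 / 1) with 1 by field; rewrite !Cplus_0_r; ring.
Qed.

(** * The Bessel functions of the second kind *)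

Lemma Cexp_Clog (z : C) : z <> 0 -> Cexp (Clog z) = z.
Proof.
  intro Hz; assert (Hm : 0 < Cmod z) by now apply Cmod_gt_0.
  unfold Cexp, Clog; cbn [Re Im fst snd].
  change (Re (ln (Cmod z), Carg z)) with (ln (Cmod z)).
  change (Im (ln (Cmod z), Carg z)) with (Carg z).
  rewrite exp_ln by trivial.
  assert (Hu : -1 <= Re z / Cmod z <= 1).
  { pose proof (re_le_Cmod z) as H; apply Rabs_le_between in H.
    split; apply Rmult_le_reg_r with (Cmod z); trivial;
      unfold Rdiv; rewrite Rmult_assoc, Rinv_l; lra. }
  assert (Hs : Cmod z * sin (acos (Re z / Cmod z)) = Rabs (Im z)).
  { rewrite sin_acos by trivial.
    rewrite <- (sqrt_Rsqr (Cmod z)) at 1 by lra.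
    rewrite <- sqrt_mult; [|apply Rle_0_sqr|].
    - rewrite <- sqrt_Rsqr_abs; f_equal.
      assert (E : Rsqr (Cmod z) = Rsqr (Re z) + Rsqr (Im z)).
      { unfold Cmod; rewrite Rsqr_sqrt; [unfold Rsqr, Re, Im; ring|].
        apply Rplus_le_le_0_compat; apply pow2_ge_0. }
      rewrite Rsqr_div'; field_simplify; [rewrite E; ring|].
      intro E'; apply Rsqr_eq_0 in E'; lra.
    - assert (0 <= 1 - Rsqr (Re z / Cmod z)); [|lra].
      unfold Rsqr; nra. }
  unfold Carg; destruct (Rle_dec 0 (Im z)) as [h|h]; apply injective_projections; simpl.
  - rewrite cos_acos by trivial; unfold Re; field; lra.
  - rewrite Hs; now apply Rabs_pos_eq.
  - rewrite cos_neg, cos_acos by trivial; unfold Re; field; lra.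
  - rewrite sin_neg.
    replace (Cmod z * - sin (acos (Re z / Cmod z))) with (- Rabs (Im z)) by lra.
    rewrite Rabs_left by lra; unfold Im; ring.
Qed.

Lemma Csin_RtoC (x : R) : Csin (RtoC x) = RtoC (sin x).
Proof.
  unfold Csin, Cexp; apply injective_projections; simpl;
    rewrite ?Rmult_0_l, ?Rmult_0_r, ?Rmult_1_l, ?Rmult_1_r, ?Rplus_0_l, ?Rplus_0_r,
      ?Rminus_0_r, ?Rminus_0_l, ?Ropp_0, ?exp_0, ?cos_neg, ?sin_neg; field.
Qed.

Lemma Ccos_RtoC (x : R) : Ccos (RtoC x) = RtoC (cos x).
Proof.
  unfold Ccos, Cexp; apply injective_projections; simpl;
    rewrite ?Rmult_0_l, ?Rmult_0_r, ?Rmult_1_l, ?Rmult_1_r, ?Rplus_0_l, ?Rplus_0_r,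
      ?Rminus_0_r, ?Rminus_0_l, ?Ropp_0, ?exp_0, ?cos_neg, ?sin_neg; field.
Qed.

Lemma cos_INR_PI (n : nat) : cos (PI * INR n) = (-1) ^ n.
Proof.
  induction n as [|n IH]; [simpl; rewrite Rmult_0_r; apply cos_0|].
  rewrite S_INR, Rmult_plus_distr_l, Rmult_1_r, neg_cos, IH; simpl; ring.
Qed.

Lemma sin_INR_PI (n : nat) : sin (PI * INR n) = 0.
Proof.
  induction n as [|n IH]; [simpl; rewrite Rmult_0_r; apply sin_0|].
  rewrite S_INR, Rmult_plus_distr_l, Rmult_1_r, neg_sin, IH; ring.
Qed.

(** The increments along which [Lim] at a finite point is defined. *)
Definition vanishing (k : nat) : R := / (INR k + 1).

Lemma vanishing_lim : is_lim_seq vanishing 0.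
Proof.
  apply (is_lim_seq_ext (fun n => / INR (S n))).
  - intro n; unfold vanishing; now rewrite S_INR.
  - apply (is_lim_seq_incr_1 (fun n => / INR n)), is_lim_seq_inv_INR.
Qed.

Lemma vanishing_small (k : nat) : (1 <= k)%nat -> 0 < vanishing k <= / 2.
Proof.
  intro Hk; apply (le_INR 1) in Hk; simpl in Hk; unfold vanishing; split.
  - apply Rinv_0_lt_compat; lra.
  - apply Rinv_le_contravar; lra.
Qed.

Lemma quad_quotient_lim (f : R -> C) (b : C) : quad f 0 b ->
  clim (fun k => f (vanishing k) * RtoC (/ vanishing k))%C b.
Proof.
  intros (K & HK & H).
  assert (B : forall k, (1 <= k)%nat ->
    Cmod (f (vanishing k) * RtoC (/ vanishing k) - b) <= K * vanishing k).
  { intros k Hk; pose proof (vanishing_small k Hk) as Hv; set (e := vanishing k) in *.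
    assert (He : Rabs e <= / 2) by (rewrite Rabs_pos_eq; lra).
    specialize (H e He).
    replace (f e * RtoC (/ e) - b)%C with (RtoC (/ e) * (f e - 0 - RtoC e * b))%C.
    - rewrite Cmod_mult, Cmod_R, Rabs_pos_eq by (apply Rlt_le, Rinv_0_lt_compat; lra).
      apply Rmult_le_reg_l with e; [lra|]; rewrite <- Rmult_assoc, Rinv_r by lra.
      lra.
    - rewrite RtoC_inv by lra; field; apply RtoC_neq_0; lra. }
  assert (L : is_lim_seq (fun k => K * vanishing k) 0).
  { replace (Finite 0) with (Rbar_mult K 0) by (simpl; f_equal; ring).
    apply is_lim_seq_scal_l, vanishing_lim. }
  assert (Z : forall (u : nat -> R) (l : R),
    (forall k, (1 <= k)%nat -> Rabs (u k - l) <= K * vanishing k) -> is_lim_seq u l).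
  { intros u l Hu; apply (is_lim_seq_ext (fun k => (u k - l) + l)); [intro; ring|].
    replace (Finite l) with (Finite (0 + l)) by (f_equal; ring).
    apply is_lim_seq_plus'; [|apply is_lim_seq_const].
    apply is_lim_seq_abs_0.
    apply (is_lim_seq_le_le_loc (fun _ => 0) _ (fun k => K * vanishing k)); trivial.
    - exists 1%nat; intros k Hk; split; [apply Rabs_pos|auto].
    - apply is_lim_seq_const. }
  split; apply Z; intros k Hk; eapply Rle_trans; [|now apply B| |now apply B].
  - eapply Rle_trans; [|apply re_le_Cmod]; right; f_equal.
  - eapply Rle_trans; [|apply im_le_Cmod]; right; f_equal.
Qed.

Lemma CP_low (n : nat) (a : nat -> C) (x : R) : (forall m, (m < n)%nat -> a m = 0) ->
  CP a x = (RtoC (x ^ n) * CP (fun m => a (n + m)%nat) x)%C.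
Proof.
  revert a; induction n as [|n IH]; intros a H.
  - cbn [pow]; rewrite Cmult_1_l; reflexivity.
  - rewrite (CP_ext a (cshift (fun m => a (S m)))).
    + rewrite CP_shift, IH by (intros m Hm; apply H; lia).
      cbn [pow]; rewrite RtoC_mult, Cmult_assoc; reflexivity.
    + intros [|m]; cbn [cshift]; trivial; apply H; lia.
Qed.

(** The remainder bound is 0 at e = 0. *)
Lemma uquad_at_0 (f : R -> nat -> C) (a b : nat -> C) (m : nat) :
  uquad f a b -> f 0 m = a m.
Proof.
  intros (U & K & _ & _ & H); destruct (H m) as (_ & _ & H3).
  specialize (H3 0); rewrite Rabs_R0 in H3; specialize (H3 ltac:(lra)).
  replace (f 0 m - a m - 0 * b m)%C with (f 0 m - a m)%C in H3 by ring.
  replace (U * K ^ m * 0 ^ 2) with 0 in H3 by (simpl; ring).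
  pose proof (Cmod_ge_0 (f 0 m - a m)).
  assert (E : (f 0 m - a m)%C = 0) by (apply Cmod_eq_0; lra).
  replace (f 0 m) with (f 0 m - a m + a m)%C by ring; rewrite E; ring.
Qed.

Lemma sgn_fact_add (n m : nat) :
  (sgn_fact (n + m) * g0 m)%C = (RtoC ((-1) ^ n) * (sgn_fact m * g0 (n + m)))%C.
Proof.
  unfold sgn_fact, g0; rewrite <- !RtoC_mult; f_equal; rewrite pow_add; field; split;
    apply INR_fact_neq_0.
Qed.

(* First order coefficients in [e] of the series of the Bessel functions of
   orders [n + e] and [- (n + e)] (up to the sign for the latter). *)
Definition pos0 (n m : nat) : C := (sgn_fact m * g0 (n + m))%C.
Definition pos1 (g : C) (n m : nat) : C := (sgn_fact m * g1 g (n + m))%C.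
Definition neg0 (n m : nat) : C := (sgn_fact m * h0 n m)%C.
Definition neg1 (g : C) (n m : nat) : C := (sgn_fact m * h1 g n m)%C.

(** The first [n] coefficients sit at zeros of 1 / Gamma. With [w = 1] this is J_(-n) = (-1)^n J_n;
    the weights are needed for the terms produced by differentiation. *)
Lemma CP_neg0 (n : nat) (x : R) (w : nat -> C) :
  CP (fun m => w m * neg0 n m)%C x =
  (RtoC (x ^ n) * CP (fun m => RtoC ((-1) ^ n) * (w (n + m)%nat * pos0 n m))%C x)%C.
Proof.
  rewrite (CP_low n) by (intros m Hm; unfold neg0; rewrite h0_low by trivial; ring).
  f_equal; apply CP_ext; intro m; unfold neg0, pos0.
  replace (h0 n (n + m)) with (g0 m) by (now rewrite Nat.add_comm, h0_shift).
  rewrite sgn_fact_add; ring.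
Qed.

(** The recurrence of order n + e differentiated at e = 0; the right side comes from the derivative
    of the factor p (p + n + e). *)
Lemma pos1_operator (g : C) (n p : nat) :
  (theta (RtoC (INR n)) (theta (RtoC (INR n)) (pos1 g n)) p
   + (RtoC (- INR n ^ 2) * pos1 g n p + 4 * cshift (pos1 g n) p))%C
  = (-4 * RtoC (INR p) * pos0 n p)%C.
Proof.
  unfold theta; replace (RtoC (- INR n ^ 2)) with (- (RtoC (INR n) * RtoC (INR n)))%C
    by (rewrite <- RtoC_mult, <- RtoC_opp; f_equal; ring).
  destruct p as [|p]; [simpl; ring|]; cbn [cshift]; unfold pos1, pos0.
  rewrite (sgn_fact_S p), (g1_S g (n + p)).
  replace (n + S p)%nat with (S (n + p)) by lia.
  replace (RtoC (INR (S (n + p)))) with (RtoC (INR n) + RtoC (INR (S p)))%C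
    by (rewrite <- RtoC_plus, <- plus_INR; do 2 f_equal; lia).
  ring.
Qed.

Lemma neg1_operator (g : C) (n p : nat) :
  (theta (- RtoC (INR n)) (theta (- RtoC (INR n)) (neg1 g n)) p
   + (RtoC (- INR n ^ 2) * neg1 g n p + 4 * cshift (neg1 g n) p))%C
  = (-4 * RtoC (INR p) * neg0 n p)%C.
Proof.
  unfold theta; replace (RtoC (- INR n ^ 2)) with (- (RtoC (INR n) * RtoC (INR n)))%C
    by (rewrite <- RtoC_mult, <- RtoC_opp; f_equal; ring).
  destruct p as [|p]; [simpl; ring|]; cbn [cshift]; unfold neg1, neg0.
  rewrite (sgn_fact_S p), (h1_rec g n p), RtoC_minus; ring.
Qed.

Lemma rpow_opp (rho : C) (r : R) : (rpow rho r * rpow (- rho) r)%C = 1.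
Proof. now rewrite rpow_plus, Cplus_opp_r, rpow_0. Qed.

Lemma pow_m1_sq (n : nat) : (RtoC ((-1) ^ n) * RtoC ((-1) ^ n))%C = 1.
Proof.
  rewrite <- RtoC_mult, <- Rpow_mult_distr; replace (-1 * -1) with 1 by ring.
  now rewrite pow1.
Qed.

(* [pi] times the Bessel function of the second kind of order [n], as a
   function of [r], and [r] times its derivative. *)
Definition bessel2 (lam : R) (s g : C) (n : nat) (r : R) : C :=
  let k := Cexp (RtoC (INR n) * Clog (s / 2)) in
  (2 * (Clog (s / 2) + RtoC (ln r)) * (k * frob lam (RtoC (INR n)) (pos0 n) r)
   + k * frob lam (RtoC (INR n)) (pos1 g n) r
   + RtoC ((-1) ^ n) * / k * frob lam (- RtoC (INR n)) (neg1 g n) r)%C.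

Definition bessel2' (lam : R) (s g : C) (n : nat) (r : R) : C :=
  let k := Cexp (RtoC (INR n) * Clog (s / 2)) in
  (2 * (Clog (s / 2) + RtoC (ln r))
     * (k * frob lam (RtoC (INR n)) (theta (RtoC (INR n)) (pos0 n)) r)
   + 2 * (k * frob lam (RtoC (INR n)) (pos0 n) r)
   + k * frob lam (RtoC (INR n)) (theta (RtoC (INR n)) (pos1 g n)) r
   + RtoC ((-1) ^ n) * / k
     * frob lam (- RtoC (INR n)) (theta (- RtoC (INR n)) (neg1 g n)) r)%C.

Lemma entire_pos_neg (g : C) :
  gamma_slope g ->
  forall n, entire (pos0 n) /\ entire (pos1 g n) /\ entire (neg0 n) /\ entire (neg1 g n).
Proof.
  intros Hg n; pose proof (uquad_entire _ _ _ (uquad_shift n _ _ _ (Hg O))) as [H1 H2].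
  pose proof (uquad_entire _ _ _ (Hg n)) as [H3 H4]; repeat split; assumption.
Qed.

Lemma bcoef_INR (g : C) :
  gamma_slope g ->
  forall n m, bcoef (RtoC (INR n)) m = pos0 n m.
Proof.
  intros Hg n m; unfold bcoef, pos0; f_equal.
  change (g0 (n + m)) with (h0 0 (n + m)).
  rewrite <- (uquad_at_0 _ _ _ (n + m)%nat (Hg O)).
  f_equal; rewrite plus_INR, <- !RtoC_plus; f_equal; simpl (INR 0); ring.
Qed.

(* [lam r^2 / 4] is the square of [(s / 2) r]. *)
Lemma bessel_scale (lam : R) (s : C) (n : nat) (r : R) :
  s <> 0 -> (s * s)%C = RtoC lam -> 0 < r ->
  let k := Cexp (RtoC (INR n) * Clog (s / 2)) in
  (/ k * rpow (- RtoC (INR n)) r * RtoC ((lam * r ^ 2 / 4) ^ n))%C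
  = (k * rpow (RtoC (INR n)) r)%C.
Proof.
  intros Hs Hl Hr k.
  assert (H2 : RtoC 2 <> 0) by (apply RtoC_neq_0; lra).
  assert (Hs2 : (s / 2)%C <> 0).
  { intro E; apply Hs; replace s with (s / 2 * 2)%C by (field; trivial); rewrite E; ring. }
  assert (Ek : k = Cpow (s / 2) n).
  { unfold k; clear - Hs2; induction n as [|n IH].
    - simpl; rewrite Cmult_0_l; apply Cexp_0.
    - rewrite S_INR, RtoC_plus.
      replace ((RtoC (INR n) + 1) * Clog (s / 2))%C
        with (Clog (s / 2) + RtoC (INR n) * Clog (s / 2))%C by ring.
      now rewrite Cexp_plus, Cexp_Clog, IH. }
  assert (Hk : k <> 0) by apply Cexp_neq_0.
  assert (Hp := rpow_opp (RtoC (INR n)) r).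
  assert (E : RtoC ((lam * r ^ 2 / 4) ^ n)
    = ((k * rpow (RtoC (INR n)) r) * (k * rpow (RtoC (INR n)) r))%C).
  { rewrite rpow_nat, Ek, !RtoC_pow, <- !Cpow_mult_l by trivial; f_equal.
    replace (lam * r ^ 2 / 4) with (lam * (r * r / 4)) by field.
    rewrite RtoC_mult, <- Hl, RtoC_div, RtoC_mult by lra; simpl; field.
    }
  rewrite E.
  transitivity (k * rpow (RtoC (INR n)) r * (/ k * k)
    * (rpow (RtoC (INR n)) r * rpow (- RtoC (INR n)) r))%C; [ring|].
  rewrite Hp, Cinv_l by trivial; ring.
Qed.

(** The logarithm multiplies a solution, and differentiating it leaves 4 k J1. This is cancelled by
    the right sides of [pos1_operator] and [neg1_operator], the latter brought to order n by
    [CP_neg0] and [bessel_scale]. *)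
Lemma bessel2_radial (lam : R) (s g : C) (n : nat) :
  s <> 0 -> (s * s)%C = RtoC lam ->
  gamma_slope g ->
  radial (- INR n ^ 2) lam (bessel2 lam s g n) (bessel2' lam s g n).
Proof.
  intros Hs Hl Hg r Hr.
  destruct (entire_pos_neg g Hg n) as (E0 & E1 & F0 & F1).
  set (k := Cexp (RtoC (INR n) * Clog (s / 2))).
  assert (DL : cderiv (fun r => 2 * (Clog (s / 2) + RtoC (ln r)))%C r (2 * RtoC (/ r))%C).
  { apply cderiv_scal; eapply cderiv_eq.
    - apply cderiv_plus; [apply cderiv_const|apply cderiv_RtoC, is_derive_ln, Hr].
    - cbv beta; ring. }
  split.
  - unfold bessel2, bessel2'; fold k; eapply cderiv_eq.
    + apply cderiv_plus; [apply cderiv_plus|].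
      * apply cderiv_mult; [exact DL|apply cderiv_scal, cderiv_frob; trivial].
      * apply cderiv_scal, cderiv_frob; trivial.
      * apply cderiv_scal, cderiv_frob; trivial.
    + cbv beta; ring.
  - unfold bessel2'; fold k; eapply cderiv_eq.
    + apply cderiv_plus; [apply cderiv_plus; [apply cderiv_plus|]|].
      * apply cderiv_mult; [exact DL|apply cderiv_scal, cderiv_frob; auto using entire_theta].
      * apply cderiv_scal, cderiv_scal, cderiv_frob; trivial.
      * apply cderiv_scal, cderiv_frob; auto using entire_theta.
      * apply cderiv_scal, cderiv_frob; auto using entire_theta.
    (* [pos0] is the series of the Bessel function of order n, so the terms still containing the
       logarithm vanish. *)
    + assert (J : (frob lam (RtoC (INR n)) (theta (RtoC (INR n)) (theta (RtoC (INR n)) (pos0 n))) r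
        + RtoC (lam * r ^ 2 + - INR n ^ 2) * frob lam (RtoC (INR n)) (pos0 n) r)%C = 0).
      { rewrite frob_operator by trivial; unfold frob.
        rewrite (CP_ext _ (fun m => 0 * pos0 n m)%C).
        - rewrite CP_scal by trivial; ring.
        - intro m; rewrite Cmult_0_l.
          assert (Q := bcoef_recurrence (RtoC (INR n)) (- INR n ^ 2) m).
          unfold theta in *; rewrite !(bcoef_INR g Hg) in Q.
          replace (cshift (bcoef (RtoC (INR n))) m) with (cshift (pos0 n) m) in Q
            by (destruct m; trivial; cbn [cshift]; now rewrite (bcoef_INR g Hg)).
          apply Q; rewrite <- RtoC_mult; f_equal; ring. }
      assert (A := frob_operator lam (- INR n ^ 2) (RtoC (INR n)) (pos1 g n) r E1).
      assert (B := frob_operator lam (- INR n ^ 2) (- RtoC (INR n)) (neg1 g n) r F1).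
      unfold bessel2; fold k.
      set (q := RtoC (lam * r ^ 2 + - INR n ^ 2)) in *.
      set (J0 := frob lam (RtoC (INR n)) (pos0 n) r) in *.
      set (A0 := frob lam (RtoC (INR n)) (pos1 g n) r) in *.
      set (B0 := frob lam (- RtoC (INR n)) (neg1 g n) r) in *.
      set (J1 := frob lam (RtoC (INR n)) (theta (RtoC (INR n)) (pos0 n)) r).
      set (J2 := frob lam (RtoC (INR n)) (theta (RtoC (INR n)) (theta (RtoC (INR n)) (pos0 n))) r) in *.
      set (A2 := frob lam (RtoC (INR n)) (theta (RtoC (INR n)) (theta (RtoC (INR n)) (pos1 g n))) r) in *.
      set (B2 := frob lam (- RtoC (INR n)) (theta (- RtoC (INR n)) (theta (- RtoC (INR n)) (neg1 g n))) r) in *.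
      assert (Z : (4 * k * J1 + k * (A2 + q * A0) + RtoC ((-1) ^ n) * / k * (B2 + q * B0))%C = 0).
      { rewrite A, B; unfold J1, frob.
        rewrite (CP_ext _ _ (lam * r ^ 2 / 4) (pos1_operator g n)).
        rewrite (CP_ext _ _ (lam * r ^ 2 / 4) (neg1_operator g n)).
        rewrite (CP_neg0 n (lam * r ^ 2 / 4) (fun p => -4 * RtoC (INR p))%C).
        set (x := lam * r ^ 2 / 4).
        assert (T0 : entire (fun m => RtoC (INR m) * pos0 n m)%C).
        { apply (entire_ext (fun m => / 2 * ((0 + 2 * RtoC (INR m)) * pos0 n m))%C).
          - intro m; field.
          - apply entire_scal; now apply entire_linear_coef. }
        rewrite (CP_ext (fun m => -4 * RtoC (INR m) * pos0 n m)%C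
          (fun m => -4 * (RtoC (INR m) * pos0 n m))%C) by (intro; ring).
        rewrite (CP_ext (theta (RtoC (INR n)) (pos0 n))
          (fun m => RtoC (INR n) * pos0 n m + 2 * (RtoC (INR m) * pos0 n m))%C)
          by (intro; unfold theta; ring).
        rewrite (CP_ext (fun m => RtoC ((-1) ^ n) * (-4 * RtoC (INR (n + m)) * pos0 n m))%C
          (fun m => RtoC ((-1) ^ n) * (-4 * RtoC (INR n) * pos0 n m + -4 * (RtoC (INR m) * pos0 n m)))%C)
          by (intro; rewrite plus_INR, RtoC_plus; ring).
        rewrite !CP_scal, !CP_plus, !CP_scal; auto using entire_plus, entire_scal.
        set (a := CP (pos0 n) x); set (b := CP (fun m => RtoC (INR m) * pos0 n m)%C x).
        assert (Sc := bessel_scale lam s n r Hs Hl Hr); cbv zeta in Sc; fold k x in Sc.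
        transitivity (4 * (k * rpow (RtoC (INR n)) r) * (RtoC (INR n) * a + b)
          - 4 * (RtoC ((-1) ^ n) * RtoC ((-1) ^ n))
            * (/ k * rpow (- RtoC (INR n)) r * RtoC (x ^ n)) * (RtoC (INR n) * a + b))%C;
          [ring|].
        rewrite pow_m1_sq, Sc; ring. }
      replace (2 * RtoC (/ r) * (k * J1))%C with (RtoC (/ r) * (2 * k * J1))%C by ring.
      transitivity (RtoC (/ r) * ((4 * k * J1 + k * (A2 + q * A0)
          + RtoC ((-1) ^ n) * / k * (B2 + q * B0))
        + 2 * (Clog (s / 2) + RtoC (ln r)) * k * (J2 + q * J0)
        - q * (2 * (Clog (s / 2) + RtoC (ln r)) * (k * J0) + k * A0
           + RtoC ((-1) ^ n) * / k * B0)))%C.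
      * unfold J1, J2, A2, B2, J0; ring.
      * rewrite Z, J; ring.
Qed.

(** The logarithms cancel in the Wronskian, and the part of order n carries the factor r^(2 n), zero
    at r = 0 since n > 0. Only the singular series [neg1] contributes there, with -2 n times the
    product of the leading coefficients. *)
Lemma bessel2_wronskian (lam : R) (s g : C) (n : nat) :
  s <> 0 -> (s * s)%C = RtoC lam ->
  gamma_slope g ->
  n <> O ->
  wronskian (bessel_solution lam (RtoC (INR n)))
    (frob lam (RtoC (INR n)) (theta (RtoC (INR n)) (bcoef (RtoC (INR n)))))
    (bessel2 lam s g n) (bessel2' lam s g n) 1 <> 0.
Proof.
  intros Hs Hl Hg Hn.
  destruct (entire_pos_neg g Hg n) as (E0 & E1 & F0 & F1).
  set (k := Cexp (RtoC (INR n) * Clog (s / 2))); assert (Hk : k <> 0) by apply Cexp_neq_0.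
  set (W := wronskian _ _ _ _ 1).
  set (P := fun (a : nat -> C) r => CP a (lam * r ^ 2 / 4)).
  (* The Wronskian rewritten without logarithms and negative powers, so that it makes sense at r =
     0. *)
  set (V := fun r => (RtoC (r ^ n) * (RtoC (r ^ n) * (k * (2 * (P (pos0 n) r * P (pos0 n) r)
      + (P (pos0 n) r * P (theta (RtoC (INR n)) (pos1 g n)) r
         - P (pos1 g n) r * P (theta (RtoC (INR n)) (pos0 n)) r))))
    + RtoC ((-1) ^ n) * / k * (P (pos0 n) r * P (theta (- RtoC (INR n)) (neg1 g n)) r
         - P (neg1 g n) r * P (theta (RtoC (INR n)) (pos0 n)) r))%C).
  assert (EV : forall r, 0 < r -> V r = W).
  { intros r Hr; unfold W.
    rewrite (wronskian_const (- INR n ^ 2) lam _ _ _ _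
      (bessel_solution_radial (- INR n ^ 2) lam (RtoC (INR n))
         ltac:(rewrite <- RtoC_mult; f_equal; ring))
      (bessel2_radial lam s g n Hs Hl Hg) 1 r Rlt_0_1 Hr).
    unfold wronskian, bessel_solution, bessel2, bessel2', frob; fold k.
    rewrite (CP_ext _ _ (lam * r ^ 2 / 4) (bcoef_INR g Hg n)).
    rewrite (CP_ext (theta (RtoC (INR n)) (bcoef (RtoC (INR n)))) (theta (RtoC (INR n)) (pos0 n)))
      by (intro m; unfold theta; now rewrite (bcoef_INR g Hg)).
    unfold V, P.
    assert (Hp := rpow_opp (RtoC (INR n)) r).
    rewrite <- rpow_nat by trivial.
    set (u := rpow (RtoC (INR n)) r) in *; set (u' := rpow (- RtoC (INR n)) r) in *.
    transitivity ((u * (u * (k * (2 * (CP (pos0 n) (lam * r ^ 2 / 4) * CP (pos0 n) (lam * r ^ 2 / 4))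
      + (CP (pos0 n) (lam * r ^ 2 / 4) * CP (theta (RtoC (INR n)) (pos1 g n)) (lam * r ^ 2 / 4)
         - CP (pos1 g n) (lam * r ^ 2 / 4) * CP (theta (RtoC (INR n)) (pos0 n)) (lam * r ^ 2 / 4)))))
    + RtoC ((-1) ^ n) * / k * (u * u')
       * (CP (pos0 n) (lam * r ^ 2 / 4) * CP (theta (- RtoC (INR n)) (neg1 g n)) (lam * r ^ 2 / 4)
         - CP (neg1 g n) (lam * r ^ 2 / 4) * CP (theta (RtoC (INR n)) (pos0 n)) (lam * r ^ 2 / 4))))%C.
    - rewrite Hp; ring.
    - cbv beta; ring. }
  assert (DV : exists l, cderiv V 0 l).
  { assert (DP : forall a, entire a -> exists l, cderiv (P a) 0 l).
    { intros a Ha; eexists; now apply cderiv_CP_square. }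
    assert (Dr : exists l, cderiv (fun r => RtoC (r ^ n)) 0 l).
    { eexists; apply cderiv_RtoC; auto_derive; trivial. }
    destruct Dr as [l0 D0], (DP _ E0) as [l1 D1], (DP _ E1) as [l2 D2], (DP _ F1) as [l3 D3],
      (DP _ (entire_theta (RtoC (INR n)) _ E0)) as [l4 D4],
      (DP _ (entire_theta (RtoC (INR n)) _ E1)) as [l5 D5],
      (DP _ (entire_theta (- RtoC (INR n)) _ F1)) as [l6 D6].
    eexists; unfold V; apply cderiv_plus.
    - apply cderiv_mult; [exact D0|]; apply cderiv_mult; [exact D0|]; apply cderiv_scal.
      apply cderiv_plus; [apply cderiv_scal; apply cderiv_mult; exact D1|].
      apply cderiv_minus; apply cderiv_mult;
        first [exact D1|exact D2|exact D3|exact D4|exact D5|exact D6].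
    - apply cderiv_scal, cderiv_minus; apply cderiv_mult;
        first [exact D1|exact D2|exact D3|exact D4|exact D5|exact D6]. }
  destruct DV as [l DV]; rewrite <- (right_limit_value V W l DV EV).
  unfold V, P; replace (lam * 0 ^ 2 / 4) with 0 by (simpl; field).
  rewrite pow_i by lia; rewrite !CP_0; unfold theta; simpl (INR 0).
  assert (Hs1 : RtoC ((-1) ^ n) <> 0) by (apply RtoC_neq_0, pow_nonzero; lra).
  assert (Hc : pos0 n 0 <> 0).
  { unfold pos0, g0, sgn_fact; apply Cmult_neq_0; apply RtoC_neq_0.
    - simpl; lra.
    - apply Rinv_neq_0_compat, INR_fact_neq_0. }
  assert (Hd : neg1 g n 0 <> 0).
  { unfold neg1, sgn_fact; apply Cmult_neq_0.
    - apply RtoC_neq_0; simpl; lra.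
    - destruct n as [|n']; [easy|]; apply h1_0_neq_0. }
  assert (Hki : (/ k)%C <> 0).
  { intro E; apply C1_nz; rewrite <- (Cinv_r k Hk), E; ring. }
  assert (HN : RtoC (-2 * INR n) <> 0).
  { apply RtoC_neq_0; assert (INR n <> 0) by (now apply not_0_INR); lra. }
  match goal with |- ?y <> _ => replace y with
    (RtoC ((-1) ^ n) * / k * (RtoC (-2 * INR n) * (pos0 n 0 * neg1 g n 0)))%C
    by (rewrite RtoC_mult; ring) end.
  exact (Cmult_neq_0 _ _ (Cmult_neq_0 _ _ Hs1 Hki)
    (Cmult_neq_0 _ _ HN (Cmult_neq_0 _ _ Hc Hd))).
Qed.

(** (s / 2)^nu and r^nu are merged into one exponential in nu, ready for expansion in e. *)
Lemma bessel_solution_expansion (lam : R) (nu : C) (s : C) (r : R) (f : nat -> C) :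
  s <> 0 -> (s * s)%C = RtoC lam -> 0 < r ->
  (forall m, bcoef nu m = (sgn_fact m * f m)%C) ->
  BJ nu (s * RtoC r) = (Cexp (nu * (Clog (s / 2) + RtoC (ln r)))
    * CP (fun m => sgn_fact m * f m)%C (lam * r ^ 2 / 4))%C.
Proof.
  intros Hs Hl Hr E; rewrite (BJ_eq lam) by trivial.
  unfold bessel_solution, frob, rpow; rewrite Cmult_assoc, <- Cexp_plus.
  rewrite (CP_ext _ _ (lam * r ^ 2 / 4) E); f_equal; f_equal; ring.
Qed.

(** J_(-n) = (-1)^n J_n, with the powers of s / 2 and r included. *)
Lemma bessel_orders_meet (lam : R) (s g : C) (n : nat) (r : R) :
  s <> 0 -> (s * s)%C = RtoC lam -> 0 < r ->
  gamma_slope g ->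
  let k := Cexp (RtoC (INR n) * Clog (s / 2)) in
  (/ k * rpow (- RtoC (INR n)) r * CP (neg0 n) (lam * r ^ 2 / 4))%C =
  (RtoC ((-1) ^ n) * (k * rpow (RtoC (INR n)) r * CP (pos0 n) (lam * r ^ 2 / 4)))%C.
Proof.
  intros Hs Hl Hr Hg k; destruct (entire_pos_neg g Hg n) as (E0 & _).
  rewrite (CP_ext (neg0 n) (fun m => 1 * neg0 n m)%C) by (intro; ring).
  rewrite (CP_neg0 n (lam * r ^ 2 / 4) (fun _ => 1)).
  rewrite (CP_ext (fun m => RtoC ((-1) ^ n) * (1 * pos0 n m))%C
    (fun m => RtoC ((-1) ^ n) * pos0 n m)%C) by (intro; ring).
  rewrite CP_scal by trivial.
  assert (Sc := bessel_scale lam s n r Hs Hl Hr); cbv zeta in Sc; fold k in Sc.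
  rewrite <- Sc; ring.
Qed.

(** At order n + e the sine is (-1)^n sin (pi e), and the numerator vanishes at e = 0 by
    [bessel_orders_meet]; so the quotient tends to the slope of the numerator divided by (-1)^n
    pi. *)
Lemma BY_generic_integer_lim (lam : R) (s g : C) (n : nat) (r : R) :
  s <> 0 -> (s * s)%C = RtoC lam -> 0 < r ->
  gamma_slope g ->
  clim (fun k => BY_generic (RtoC (INR n + vanishing k)) (s * RtoC r))
    (RtoC (/ PI) * bessel2 lam s g n r)%C.
Proof.
  intros Hs Hl Hr Hg.
  set (x := lam * r ^ 2 / 4); set (L := (Clog (s / 2) + RtoC (ln r))%C).
  set (sg := RtoC ((-1) ^ n)).
  set (E := Cexp (RtoC (INR n) * L)); assert (HE : E <> 0) by apply Cexp_neq_0.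
  set (A := fun e => CP (fun m => sgn_fact m * rGamma (RtoC (INR (n + m)%nat - INR 0 + 1 + e)))%C x).
  set (B := fun e => CP (fun m => sgn_fact m * rGamma (RtoC (INR m - INR n + 1 + - e)))%C x).
  (* The numerator of [BY_generic] at order n + e. *)
  set (Nm := fun e => (E * (Cexp (L * RtoC e) * (A e * (sg * RtoC (cos (PI * e)))))
    + - / E * (Cexp (L * RtoC (- e)) * B e))%C).
  assert (QA : quad A (CP (pos0 n) x) (CP (pos1 g n) x)).
  { apply (quad_CP (fun e m => rGamma (RtoC (INR (n + m)%nat - INR 0 + 1 + e)))
      (fun m => g0 (n + m)) (fun m => g1 g (n + m))).
    exact (uquad_shift n _ _ _ (Hg O)). }
  assert (QB : quad B (CP (neg0 n) x) (- CP (neg1 g n) x)).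
  { apply (quad_opp_arg (fun e => CP (fun m => sgn_fact m * rGamma (RtoC (INR m - INR n + 1 + e)))%C x)).
    exact (quad_CP _ _ _ x (Hg n)). }
  assert (Ek : E = (Cexp (RtoC (INR n) * Clog (s / 2)) * rpow (RtoC (INR n)) r)%C).
  { unfold E, L, rpow; rewrite <- Cexp_plus; f_equal; ring. }
  assert (Hk0 : Cexp (RtoC (INR n) * Clog (s / 2)) <> 0) by apply Cexp_neq_0.
  assert (Hr0 : rpow (RtoC (INR n)) r <> 0) by apply Cexp_neq_0.
  assert (Hro := rpow_opp (RtoC (INR n)) r).
  assert (Eki : (/ E)%C = (/ Cexp (RtoC (INR n) * Clog (s / 2)) * rpow (- RtoC (INR n)) r)%C).
  { rewrite Ek.
    replace (rpow (- RtoC (INR n)) r) with (/ rpow (RtoC (INR n)) r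
      * (rpow (RtoC (INR n)) r * rpow (- RtoC (INR n)) r))%C by (field; trivial).
    rewrite Hro; field; now split. }
  assert (M := bessel_orders_meet lam s g n r Hs Hl Hr Hg); cbv zeta in M.
  fold x sg in M; rewrite <- Eki, <- Ek in M.
  assert (SS : (sg * sg)%C = 1) by apply pow_m1_sq.
  assert (QN : quad Nm 0 (sg * bessel2 lam s g n r)%C).
  { eapply quad_eq.
    - apply (quad_plus (fun e => E * (Cexp (L * RtoC e) * (A e * (sg * RtoC (cos (PI * e))))))%C
        (fun e => - / E * (Cexp (L * RtoC (- e)) * B e))%C).
      + apply quad_scal, quad_mult; [apply quad_Cexp|].
        apply quad_mult; [exact QA|apply quad_scal, quad_cos_PI].
      + apply quad_scal, quad_mult; [|exact QB].
        apply (quad_opp_arg (fun e => Cexp (L * RtoC e))), quad_Cexp.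
    - transitivity (sg * (E * CP (pos0 n) x) - / E * CP (neg0 n) x)%C; [ring|].
      rewrite M; ring.
    - transitivity (sg * (E * (L * CP (pos0 n) x)) + sg * (E * CP (pos1 g n) x)
        + L * (/ E * CP (neg0 n) x) + / E * CP (neg1 g n) x)%C; [ring|].
      rewrite M; unfold bessel2, frob; fold x L.
      transitivity (sg * (2 * L * (E * CP (pos0 n) x)) + sg * (E * CP (pos1 g n) x)
         + (sg * sg) * (/ E * CP (neg1 g n) x))%C; [rewrite SS; ring|].
      rewrite Eki, Ek; unfold sg; ring. }
  (* Numerator and sine are both divided by e, so that each has a limit. *)
  apply (clim_ext (fun k => Nm (vanishing k) * RtoC (/ vanishing k)
    * RtoC (/ ((-1) ^ n * (sin (PI * vanishing k) * / vanishing k))))%C).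
  - intros k Hk; pose proof (vanishing_small k Hk) as Hv; set (e := vanishing k) in *.
    pose proof PI_RGT_0 as HPI.
    assert (Hsin : 0 < sin (PI * e)) by (apply sin_gt_0; nra).
    assert (Hsg : (-1) ^ n <> 0) by (apply pow_nonzero; lra).
    unfold BY_generic.
    rewrite <- RtoC_mult, Csin_RtoC, Ccos_RtoC, Rmult_plus_distr_l.
    rewrite cos_plus, sin_plus, cos_INR_PI, sin_INR_PI, !Rmult_0_l, Rminus_0_r, Rplus_0_l.
    rewrite (bessel_solution_expansion lam (RtoC (INR n + e)) s r
      (fun m => rGamma (RtoC (INR (n + m)%nat - INR 0 + 1 + e))) Hs Hl Hr).
    2: { intro m; unfold bcoef; do 2 f_equal; rewrite plus_INR, <- !RtoC_plus; f_equal;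
         simpl (INR 0); ring. }
    rewrite (bessel_solution_expansion lam (- RtoC (INR n + e)) s r
      (fun m => rGamma (RtoC (INR m - INR n + 1 + - e))) Hs Hl Hr).
    2: { intro m; unfold bcoef; do 2 f_equal; rewrite <- RtoC_opp, <- !RtoC_plus; f_equal; ring. }
    fold L x; fold (A e) (B e); unfold Nm.
    replace (RtoC (INR n + e) * L)%C with (RtoC (INR n) * L + L * RtoC e)%C
      by (rewrite RtoC_plus; ring).
    replace (- RtoC (INR n + e) * L)%C with (- (RtoC (INR n) * L) + L * RtoC (- e))%C
      by (rewrite RtoC_opp, RtoC_plus; ring).
    rewrite !Cexp_plus; fold E.
    replace (Cexp (- (RtoC (INR n) * L))) with (/ E)%C.
    2: { pose proof (Cexp_opp_r (RtoC (INR n) * L)) as Q; fold E in Q.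
         transitivity (/ E * (E * Cexp (- (RtoC (INR n) * L))))%C;
           [rewrite Q; ring|field; trivial]. }
    replace (/ ((-1) ^ n * (sin (PI * e) * / e))) with (e * / ((-1) ^ n * sin (PI * e)))
      by (field; repeat split; lra || trivial).
    rewrite (RtoC_mult e), !RtoC_inv, !RtoC_mult by (try apply Rmult_integral_contrapositive_currified; lra || trivial).
    unfold sg; field; repeat split; try apply RtoC_neq_0; trivial; lra.
  - replace (RtoC (/ PI) * bessel2 lam s g n r)%C
      with (sg * bessel2 lam s g n r * RtoC (/ ((-1) ^ n * PI)))%C.
    + apply clim_mult; [now apply quad_quotient_lim|].
      apply clim_RtoC.
      destruct (quad_quotient_lim _ _ quad_sin_PI) as [LS _].
      assert (L1 : is_lim_seq (fun k => (-1) ^ n * (sin (PI * vanishing k) * / vanishing k))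
        ((-1) ^ n * PI)).
      { apply (is_lim_seq_scal_l _ ((-1) ^ n) PI).
        refine (is_lim_seq_ext _ _ _ _ LS); intro k; unfold Re; simpl; ring. }
      apply (is_lim_seq_inv _ ((-1) ^ n * PI) L1).
      intro Q; injection Q as Q; apply Rmult_integral in Q; pose proof PI_RGT_0.
      destruct Q as [Q|Q]; [|lra]; revert Q; apply pow_nonzero; lra.
    + rewrite Rinv_mult, RtoC_mult, (RtoC_inv ((-1) ^ n)) by (apply pow_nonzero; lra).
      unfold sg; field; apply RtoC_neq_0, pow_nonzero; lra.
Qed.

(** * Square roots as orders, and [BY] as a solution *)

Lemma csqrt_sq (a : R) : (csqrt a * csqrt a)%C = RtoC a.
Proof.
  unfold csqrt; apply injective_projections; simpl;
    destruct (Rle_dec 0 a) as [h|h].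
  - rewrite (sqrt_neg_0 (- a)), sqrt_sqrt by lra; ring.
  - rewrite (sqrt_neg_0 a), sqrt_sqrt by lra; ring.
  - rewrite (sqrt_neg_0 (- a)) by lra; ring.
  - rewrite (sqrt_neg_0 a) by lra; ring.
Qed.

Lemma csqrt_neq_0 (a : R) : a <> 0 -> csqrt a <> 0.
Proof.
  intros Ha E; pose proof (csqrt_sq a) as H; rewrite E in H.
  apply Ha, RtoC_inj; rewrite <- H; ring.
Qed.

(** The order is real nonnegative or, for m > 0, a nonzero imaginary number, where the sine is a
    difference of two distinct real exponentials. *)
Lemma Csin_csqrt_zero (m : R) : Csin (PI * csqrt (- m)) = 0 ->
  exists n : nat, csqrt (- m) = RtoC (INR n) /\ m = - INR n ^ 2.
Proof.
  intro H; pose proof PI_RGT_0 as HPI.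
  destruct (Rle_dec m 0) as [h|h].
  - assert (E : csqrt (- m) = RtoC (sqrt (- m))).
    { unfold csqrt; now rewrite (sqrt_neg_0 (- - m)) by lra. }
    rewrite E, <- RtoC_mult, Csin_RtoC in H; apply RtoC_inj in H.
    destruct (sin_eq_0_0 _ H) as [z Hz].
    assert (Es : sqrt (- m) = IZR z) by (apply (Rmult_eq_reg_l PI); lra).
    assert (Hz0 : (0 <= z)%Z) by (apply le_IZR; rewrite <- Es; apply sqrt_pos).
    exists (Z.to_nat z).
    assert (En : INR (Z.to_nat z) = IZR z) by (rewrite INR_IZR_INZ, Z2Nat.id; trivial).
    split; [now rewrite E, Es, En|].
    rewrite En, <- Es; simpl; rewrite Rmult_1_r, sqrt_sqrt; lra.
  - exfalso; revert H; set (b := sqrt m).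
    assert (Hb : 0 < b) by (apply sqrt_lt_R0; lra).
    assert (E : csqrt (- m) = (Ci * RtoC b)%C).
    { unfold csqrt; rewrite (sqrt_neg_0 (- m)), Ropp_involutive by lra.
      apply injective_projections; simpl; unfold b; ring. }
    rewrite E; unfold Csin.
    replace (Ci * (PI * (Ci * b)))%C with (RtoC (- (PI * b)))
      by (apply injective_projections; simpl; ring).
    rewrite <- RtoC_opp, !Cexp_RtoC, Ropp_involutive, <- RtoC_minus; intro H.
    assert (Hi : exp (- (PI * b)) < exp (PI * b)) by (apply exp_increasing; nra).
    assert (H2i : (2 * Ci)%C <> 0).
    { intro Q; injection Q; lra. }
    assert (Q : RtoC (exp (- (PI * b)) - exp (PI * b)) = 0).
    { generalize dependent (2 * Ci)%C; intros q Hq Hq0.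
      replace (RtoC (exp (- (PI * b)) - exp (PI * b)))
        with (RtoC (exp (- (PI * b)) - exp (PI * b)) / q * q)%C by (field; trivial).
      rewrite Hq; ring. }
    apply RtoC_inj in Q; lra.
Qed.

Lemma BY_solution (m lam : R) (s : C) : s <> 0 -> (s * s)%C = RtoC lam ->
  let nu := csqrt (- m) in
  exists Y Y' : R -> C, radial m lam Y Y' /\
    (forall r, 0 < r -> BY nu (s * RtoC r) = Y r) /\
    (m <> 0 -> wronskian (bessel_solution lam nu) (frob lam nu (theta nu (bcoef nu)))
       Y Y' 1 <> 0).
Proof.
  intros Hs Hl nu; pose proof PI_RGT_0 as HPI.
  assert (Hnu : (nu * nu)%C = RtoC (- m)) by apply csqrt_sq.
  assert (Hnu' : (- nu * - nu)%C = RtoC (- m)) by (rewrite <- Hnu; ring).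
  destruct (Ceq_dec (Csin (PI * nu)) 0) as [H0|H0].
  - destruct (Csin_csqrt_zero m H0) as (n & En & Em); fold nu in En.
    destruct uquad_rGamma as [g Hg].
    pose proof (bessel2_radial lam s g n Hs Hl Hg) as HR; rewrite <- Em in HR.
    (* The zero summand brings a single multiple into the form of [radial_comb]. *)
    exists (fun r => RtoC (/ PI) * bessel2 lam s g n r + 0 * bessel2 lam s g n r)%C,
      (fun r => RtoC (/ PI) * bessel2' lam s g n r + 0 * bessel2' lam s g n r)%C.
    split; [now apply radial_comb|]; split.
    + intros r Hr; unfold BY; destruct (Ceq_dec (Csin (PI * nu)) 0) as [_|N]; [|easy].
      pose proof (BY_generic_integer_lim lam s g n r Hs Hl Hr Hg) as [L1 L2].
      replace (Re nu) with (INR n) by (now rewrite En).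
      (* [Lim] becomes the limit along the orders [INR n + vanishing k]. *)
      unfold Lim; rewrite Cmult_0_l, Cplus_0_r.
      apply injective_projections; cbn [fst snd].
      * change (real (Lim_seq (fun k => Re (BY_generic (RtoC (INR n + vanishing k)) (s * RtoC r))))
          = Re (RtoC (/ PI) * bessel2 lam s g n r)%C).
        now rewrite (is_lim_seq_unique _ _ L1).
      * change (real (Lim_seq (fun k => Im (BY_generic (RtoC (INR n + vanishing k)) (s * RtoC r))))
          = Im (RtoC (/ PI) * bessel2 lam s g n r)%C).
        now rewrite (is_lim_seq_unique _ _ L2).
    + intros Hm W; rewrite En in W.
      apply (bessel2_wronskian lam s g n Hs Hl Hg).
      { intro Q; subst n; apply Hm; rewrite Em; simpl; ring. }
      unfold wronskian in *.
      match goal with |- ?y = _ => replace y with (RtoC PI * (RtoC (/ PI) * y))%C end.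
      2: { rewrite Cmult_assoc, <- RtoC_mult, Rinv_r by lra; ring. }
      match type of W with ?y = _ => transitivity (RtoC PI * y)%C end.
      * ring.
      * rewrite W; ring.
  - set (a := (Cexp (nu * Clog (s / 2)) * Ccos (PI * nu) / Csin (PI * nu))%C).
    set (b := (- (Cexp (- nu * Clog (s / 2)) / Csin (PI * nu)))%C).
    exists (fun r => a * bessel_solution lam nu r + b * bessel_solution lam (- nu) r)%C,
      (fun r => a * frob lam nu (theta nu (bcoef nu)) r
        + b * frob lam (- nu) (theta (- nu) (bcoef (- nu))) r)%C.
    split; [apply radial_comb; now apply bessel_solution_radial|]; split.
    + intros r Hr; unfold BY; destruct (Ceq_dec (Csin (PI * nu)) 0) as [E|_]; [easy|].
      unfold BY_generic; rewrite !(BJ_eq lam) by trivial; unfold a, b; field; trivial.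
    + intros Hm W.
      assert (Hnu0 : nu <> 0) by (apply csqrt_neq_0; lra).
      (* A nonvanishing sine excludes integer orders, so neither value of 1 / Gamma in the Wronskian
         is 0. *)
      assert (Hint : forall (p : nat), nu <> RtoC (INR p) /\ nu <> RtoC (- INR p)).
      { intro p; split; intro E; apply H0; rewrite E, <- RtoC_mult, Csin_RtoC.
        - now rewrite sin_INR_PI.
        - now rewrite Ropp_mult_distr_r_reverse, sin_neg, sin_INR_PI, Ropp_0. }
      assert (W0 := bessel_solution_wronskian m lam nu 1 Hnu Rlt_0_1).
      assert (Hb : b <> 0).
      { unfold b; intro E; apply (Cexp_neq_0 (- nu * Clog (s / 2))).
        transitivity (- (- (Cexp (- nu * Clog (s / 2)) / Csin (PI * nu))) * Csin (PI * nu))%C.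
        - field; trivial.
        - rewrite E; ring. }
      revert W; unfold wronskian in *.
      match goal with |- ?y = _ -> _ => replace y with
        (b * (-2 * nu * rGamma (nu + 1) * rGamma (- nu + 1)))%C by (rewrite <- W0; ring) end.
      apply Cmult_neq_0; trivial; repeat apply Cmult_neq_0; trivial.
      * intro E; injection E; lra.
      * apply rGamma_neq_0; intros p E; apply (proj2 (Hint (S p))).
        replace nu with ((nu + 1 + RtoC (INR p)) - RtoC (INR (S p)))%C
          by (rewrite S_INR, RtoC_plus; ring).
        rewrite E, RtoC_opp; ring.
      * apply rGamma_neq_0; intros p E; apply (proj1 (Hint (S p))).
        replace nu with (RtoC (INR (S p)) - (- nu + 1 + RtoC (INR p)))%C
          by (rewrite S_INR, RtoC_plus; ring).
        rewrite E; ring.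
Qed.

(** * Separated solutions *)

(** Bootstrapping for a linear first order system: the derivative of each function is a smooth
    multiple of the other, so their orders increase together. *)
Lemma smooth_pair (c : coord) (f g al be : R -> R) :
  smooth (fun p => al (get c p)) -> smooth (fun p => be (get c p)) ->
  (forall p, dom p -> is_derive f (get c p) (al (get c p) * g (get c p))) ->
  (forall p, dom p -> is_derive g (get c p) (be (get c p) * f (get c p))) ->
  smooth (fun p => f (get c p)) /\ smooth (fun p => g (get c p)).
Proof.
  rewrite !smooth_Cn; intros Ha Hb Hf Hg.
  assert (H : forall n, Cn n (fun p => f (get c p)) /\ Cn n (fun p => g (get c p))).
  { induction n as [|n [IH1 IH2]]; split.
    - apply (Cn_coord 0 c f (fun x => al x * g x)); [trivial|discriminate].
    - apply (Cn_coord 0 c g (fun x => be x * f x)); [trivial|discriminate].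
    - apply (Cn_coord (S n) c f (fun x => al x * g x)); trivial.
      intros m E; injection E as <-; now apply Cn_mult.
    - apply (Cn_coord (S n) c g (fun x => be x * f x)); trivial.
      intros m E; injection E as <-; now apply Cn_mult. }
  split; intro n; apply H.
Qed.

Definition csmooth (f : point -> C) : Prop :=
  smooth (fun p => Re (f p)) /\ smooth (fun p => Im (f p)).

Lemma csmooth_mult (f g : point -> C) :
  csmooth f -> csmooth g -> csmooth (fun p => f p * g p)%C.
Proof.
  intros [F1 F2] [G1 G2]; split.
  - apply (smooth_ext (fun p => Re (f p) * Re (g p) - Im (f p) * Im (g p))); [reflexivity|].
    auto with smooth.
  - apply (smooth_ext (fun p => Re (f p) * Im (g p) + Im (f p) * Re (g p))); [reflexivity|].
    auto with smooth.
Qed.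

Lemma csmooth_pair (c : coord) (f g : R -> C) (al be : R -> R) :
  smooth (fun p => al (get c p)) -> smooth (fun p => be (get c p)) ->
  (forall p, dom p -> cderiv f (get c p) (RtoC (al (get c p)) * g (get c p))%C) ->
  (forall p, dom p -> cderiv g (get c p) (RtoC (be (get c p)) * f (get c p))%C) ->
  csmooth (fun p => f (get c p)).
Proof.
  intros Ha Hb Hf Hg.
  assert (E : forall (a : R) (z : C), Re (RtoC a * z) = a * Re z /\ Im (RtoC a * z) = a * Im z).
  { intros a z; unfold Re, Im; simpl; split; ring. }
  split.
  - apply (smooth_pair c (fun x => Re (f x)) (fun x => Re (g x)) al be Ha Hb); intros p Hp;
      rewrite <- (proj1 (E _ _)); [apply (Hf p Hp)|apply (Hg p Hp)].
  - apply (smooth_pair c (fun x => Im (f x)) (fun x => Im (g x)) al be Ha Hb); intros p Hp;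
      rewrite <- (proj2 (E _ _)); [apply (Hf p Hp)|apply (Hg p Hp)].
Qed.

(** The factors are complex while eta is real; the real part is still a solution because the
    equation has real coefficients. *)
Definition product3 (f g h : R -> C) (r t z : R) : R := Re (f r * (g t * h z))%C.

Lemma pd_product3 (f g h : R -> C) (i : indep) (p : point) (l : C) :
  cderiv (match i with ir => f | ith => g | iz => h end) (get (dx i) p) l ->
  pd (dx i) (lift3 (product3 f g h)) p =
  let '(r, t, z, _) := p in
  match i with
  | ir => Re (l * (g t * h z))%C
  | ith => Re (f r * (l * h z))%C
  | iz => Re (f r * (g t * l))%C
  end.
Proof.
  destruct p as [[[r t] z] u]; intro H; unfold pd; apply is_derive_unique.
  destruct i; cbn [get upd lift3] in *; unfold product3.
  - destruct (cderiv_mult f (fun _ => (g t * h z)%C) r l 0 H (cderiv_const _ _)) as [D _].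
    evar_last; [exact D|]; f_equal; ring.
  - destruct (cderiv_scal (f r) _ t _ (cderiv_mult g (fun _ => h z) t l 0 H (cderiv_const _ _)))
      as [D _].
    evar_last; [exact D|]; f_equal; ring.
  - destruct (cderiv_scal (f r) _ z _ (cderiv_scal (g t) h z l H)) as [D _]; exact D.
Qed.

(** Separation of variables: c2 and c3 are the eigenvalues of the second derivatives in theta and z,
    and they turn the Helmholtz equation into the radial one. *)
Lemma product3_solution (k c2 c3 : R) (f f1 g g1' h h1' : R -> C) :
  radial c2 (c3 + k ^ 2) f f1 ->
  (forall t, cderiv g t (g1' t)) -> (forall t, cderiv g1' t (RtoC c2 * g t)%C) ->
  (forall z, cderiv h z (h1' z)) -> (forall z, cderiv h1' z (RtoC c3 * h z)%C) ->
  helmholtz_solution k (product3 f g h).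
Proof.
  intros Hf Hg Hg1 Hh Hh1; split.
  - assert (S1 : csmooth (fun p => f (get dr p))).
    { apply (csmooth_pair dr f f1 (fun r => / r)
        (fun r => - (((c3 + k ^ 2) * (r * r) + c2) * / r))); auto 10 with smooth.
      - intros p Hp; apply (Hf _ Hp).
      - intros p Hp; eapply cderiv_eq; [apply (Hf _ Hp)|].
        replace (get dr p ^ 2) with (get dr p * get dr p) by ring.
        rewrite RtoC_opp, (RtoC_mult (_ + _)); ring. }
    assert (S2 : csmooth (fun p => g (get dt p))).
    { apply (csmooth_pair dt g g1' (fun _ => 1) (fun _ => c2)); auto with smooth.
      intros p _; eapply cderiv_eq; [apply Hg|ring]. }
    assert (S3 : csmooth (fun p => h (get dz p))).
    { apply (csmooth_pair dz h h1' (fun _ => 1) (fun _ => c3)); auto with smooth.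
      intros p _; eapply cderiv_eq; [apply Hh|ring]. }
    apply (smooth_ext (fun p => Re (f (get dr p) * (g (get dt p) * h (get dz p)))%C)).
    + now intros [[[r t] z] u] _.
    + exact (proj1 (csmooth_mult _ _ S1 (csmooth_mult _ _ S2 S3))).
  - intros p Hp; cbn [pds].
    set (f' := fun r => (RtoC (/ r) * f1 r)%C).
    assert (Df : forall r, 0 < r -> cderiv f' r
      (- (RtoC (/ r) * RtoC (/ r)) * f1 r
       + RtoC (/ r) * (RtoC (/ r) * - (RtoC ((c3 + k ^ 2) * r ^ 2 + c2) * f r)))%C).
    { intros r Hr; eapply cderiv_eq.
      - apply cderiv_mult; [|apply Hf, Hr].
        apply cderiv_RtoC with (l := - (/ r * / r)); auto_derive; [lra|field; lra].
      - rewrite RtoC_opp, RtoC_mult; reflexivity. }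
    assert (P1 : forall q, dom q -> pd dr (lift3 (product3 f g h)) q = lift3 (product3 f' g h) q).
    { intros q Hq; rewrite (pd_product3 f g h ir q _ (proj1 (Hf _ Hq))).
      now destruct q as [[[r t] z] u]. }
    assert (P2 : forall q, dom q -> pd dt (lift3 (product3 f g h)) q = lift3 (product3 f g1' h) q).
    { intros q Hq; rewrite (pd_product3 f g h ith q _ (Hg _)).
      now destruct q as [[[r t] z] u]. }
    assert (P3 : forall q, dom q -> pd dz (lift3 (product3 f g h)) q = lift3 (product3 f g h1') q).
    { intros q Hq; rewrite (pd_product3 f g h iz q _ (Hh _)).
      now destruct q as [[[r t] z] u]. }
    rewrite (pd_ext dr _ _ p P1 Hp), (pd_ext dt _ _ p P2 Hp), (pd_ext dz _ _ p P3 Hp), P1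
      by trivial.
    rewrite (pd_product3 f' g h ir p _ (Df _ Hp)), (pd_product3 f g1' h ith p _ (Hg1 _)),
      (pd_product3 f g h1' iz p _ (Hh1 _)).
    destruct p as [[[r t] z] u]; unfold dom in Hp; cbn [get lift3] in *; unfold product3, f'.
    assert (R1 : forall (a : R) (w : C), a * Re w = Re (RtoC a * w)).
    { intros a w; unfold Re; simpl; ring. }
    assert (R2 : forall v w : C, Re v + Re w = Re (v + w)) by reflexivity.
    rewrite !R1, !R2; change 0 with (Re 0); f_equal.
    assert (Hr : RtoC r <> 0) by (apply RtoC_neq_0; lra).
    rewrite !RtoC_plus, !RtoC_mult, !RtoC_inv, !RtoC_pow by (try apply pow_nonzero; lra).
    rewrite !RtoC_plus, ?RtoC_pow; field; trivial.
Qed.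

(** The exponential prefactor is distributed over the two brackets, which then contain both signs of
    the exponents. *)
Lemma eta_bessel_factor (k c2 c3 : R) (d : nat -> C) (r t z : R) :
  eta_bessel k c2 c3 d r t z =
  ((d 11%nat * BY (csqrt (- c2)) (csqrt (c3 + k ^ 2) * RtoC r)
    + d 12%nat * BJ (csqrt (- c2)) (csqrt (c3 + k ^ 2) * RtoC r))
   * ((d 7%nat * Cexp (csqrt c2 * RtoC t) + d 8%nat * Cexp (- csqrt c2 * RtoC t))
      * (d 9%nat * Cexp (csqrt c3 * RtoC z) + d 10%nat * Cexp (- csqrt c3 * RtoC z))))%C.
Proof.
  unfold eta_bessel.
  replace (- csqrt c3 * RtoC z - csqrt c2 * RtoC t)%C
    with (- csqrt c3 * RtoC z + - csqrt c2 * RtoC t)%C by ring.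
  replace (2 * csqrt c2 * RtoC t)%C with (csqrt c2 * RtoC t + csqrt c2 * RtoC t)%C by ring.
  replace (2 * csqrt c3 * RtoC z)%C with (csqrt c3 * RtoC z + csqrt c3 * RtoC z)%C by ring.
  rewrite !Cexp_plus.
  assert (H2 := Cexp_opp_r (csqrt c2 * RtoC t)); assert (H3 := Cexp_opp_r (csqrt c3 * RtoC z)).
  replace (- (csqrt c2 * RtoC t))%C with (- csqrt c2 * RtoC t)%C in H2 by ring.
  replace (- (csqrt c3 * RtoC z))%C with (- csqrt c3 * RtoC z)%C in H3 by ring.
  set (e2 := Cexp (csqrt c2 * RtoC t)) in *; set (e2' := Cexp (- csqrt c2 * RtoC t)) in *.
  set (e3 := Cexp (csqrt c3 * RtoC z)) in *; set (e3' := Cexp (- csqrt c3 * RtoC z)) in *.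
  set (b := (d 11%nat * _ + _)%C).
  transitivity (b * ((d 7%nat * e2 * (e2 * e2') + d 8%nat * e2')
    * (d 9%nat * e3 * (e3 * e3') + d 10%nat * e3')))%C; [ring|rewrite H2, H3; ring].
Qed.

Lemma exponentials_ode (c : R) (a b : C) (t : R) :
  cderiv (fun t => a * Cexp (csqrt c * RtoC t) + b * Cexp (- csqrt c * RtoC t))%C t
    (csqrt c * (a * Cexp (csqrt c * RtoC t) - b * Cexp (- csqrt c * RtoC t)))%C /\
  cderiv (fun t => csqrt c * (a * Cexp (csqrt c * RtoC t) - b * Cexp (- csqrt c * RtoC t)))%C t
    (RtoC c * (a * Cexp (csqrt c * RtoC t) + b * Cexp (- csqrt c * RtoC t)))%C.
Proof.
  assert (D : forall s, cderiv (fun t => Cexp (s * RtoC t)) t (s * 1 * Cexp (s * RtoC t))%C).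
  { intro s; exact (cderiv_Cexp_scal s (fun t => t) t 1 (is_derive_id t)). }
  split; eapply cderiv_eq.
  - apply cderiv_plus; apply cderiv_scal, D.
  - cbv beta; ring.
  - apply cderiv_scal, cderiv_minus; apply cderiv_scal, D.
  - cbv beta; rewrite <- (csqrt_sq c); ring.
Qed.

Lemma bessel_combination_radial (k c2 c3 : R) (d : nat -> C) :
  bessel_defined k c2 c3 d ->
  exists f f1 : R -> C, radial c2 (c3 + k ^ 2) f f1 /\ forall r, 0 < r ->
    (d 11%nat * BY (csqrt (- c2)) (csqrt (c3 + k ^ 2) * RtoC r)
     + d 12%nat * BJ (csqrt (- c2)) (csqrt (c3 + k ^ 2) * RtoC r))%C = f r.
Proof.
  intro Hd; set (lam := c3 + k ^ 2); set (nu := csqrt (- c2)).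
  destruct (Req_dec lam 0) as [E|n].
  (* At lam = 0 the Bessel argument is always 0 and the combination is constant in r. It is 0 for c2
     < 0, where 0^nu = 0, and for c2 > 0 by [bessel_defined]; for c2 = 0 constants are solutions. *)
  - destruct (Hd E) as [E11 E12]; rewrite E.
    assert (E0 : forall r, (csqrt 0 * RtoC r)%C = 0).
    { intro r; unfold csqrt; rewrite Ropp_0, sqrt_0; apply Cmult_0_l. }
    exists (fun _ => (d 12%nat * BJ nu 0)%C), (fun _ => 0); split.
    + intros r Hr; split; (eapply cderiv_eq; [apply cderiv_const|]); [ring|].
      destruct (total_order_T c2 0) as [[h|h]|h].
      * assert (Hnu : nu <> 0) by (apply csqrt_neq_0; lra).
        assert (Z : BJ nu 0 = 0).
        { unfold BJ, Cpower; destruct (Ceq_dec (0 / 2) 0) as [_|Q].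
          - destruct (Ceq_dec nu 0); [easy|ring].
          - elim Q; unfold Cdiv; ring. }
        rewrite Z; ring.
      * rewrite h; replace (0 * r ^ 2 + 0) with 0 by ring; ring.
      * rewrite (E12 h); ring.
    + intros r Hr; rewrite E0, E11; ring.
  - destruct (BY_solution c2 lam (csqrt lam)) as (Y & Y' & HY & EY & _);
      [now apply csqrt_neq_0|apply csqrt_sq|]; fold nu in EY.
    assert (HJ : radial c2 lam (bessel_solution lam nu) (frob lam nu (theta nu (bcoef nu)))).
    { apply bessel_solution_radial, csqrt_sq. }
    set (kap := Cexp (nu * Clog (csqrt lam / 2))).
    exists (fun r => d 11%nat * Y r + d 12%nat * kap * bessel_solution lam nu r)%C,
      (fun r => d 11%nat * Y' r + d 12%nat * kap * frob lam nu (theta nu (bcoef nu)) r)%C.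
    split; [now apply radial_comb|]; intros r Hr.
    rewrite EY, (BJ_eq lam) by (trivial; now apply csqrt_neq_0 || apply csqrt_sq).
    unfold kap; ring.
Qed.

Lemma displayed_symmetry (k : R) (c : nat -> R) (d : nat -> C) (v : vfield) :
  bessel_defined k (c 2%nat) (c 3%nat) d -> displayed_field k c d v -> inf_symmetry k v.
Proof.
  intros Hd [Hx Hu].
  destruct (bessel_combination_radial k (c 2%nat) (c 3%nat) d Hd) as (f & f1 & Hf & Ef).
  apply (superposed_symmetry k v c (product3 f
    (fun t => d 7%nat * Cexp (csqrt (c 2%nat) * RtoC t)
      + d 8%nat * Cexp (- csqrt (c 2%nat) * RtoC t))%C
    (fun z => d 9%nat * Cexp (csqrt (c 3%nat) * RtoC z)
      + d 10%nat * Cexp (- csqrt (c 3%nat) * RtoC z))%C)).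
  - exact (product3_solution k (c 2%nat) (c 3%nat) _ _ _ _ _ _ Hf
      (fun t => proj1 (exponentials_ode (c 2%nat) (d 7%nat) (d 8%nat) t))
      (fun t => proj2 (exponentials_ode (c 2%nat) (d 7%nat) (d 8%nat) t))
      (fun z => proj1 (exponentials_ode (c 3%nat) (d 9%nat) (d 10%nat) z))
      (fun z => proj2 (exponentials_ode (c 3%nat) (d 9%nat) (d 10%nat) z))).
  - split; trivial; intros r t z u Hr; specialize (Hu r t z u Hr).
    rewrite eta_bessel_factor, Ef in Hu by trivial.
    (* The displayed formula is an equality of complex numbers; its real part is the required
       one. *)
    apply (f_equal Re) in Hu; exact Hu.
Qed.

Lemma exponentials_span (c : R) (g g1' : R -> R) : c <> 0 ->
  (forall t, is_derive g t (g1' t)) -> (forall t, is_derive g1' t (c * g t)) ->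
  exists a b : C, forall t,
    RtoC (g t) = (a * Cexp (csqrt c * RtoC t) + b * Cexp (- csqrt c * RtoC t))%C.
Proof.
  intros Hc Hg Hg1; assert (Hs := csqrt_neq_0 c Hc); assert (Hs2 := csqrt_sq c).
  set (s := csqrt c) in *.
  assert (D : forall s t, cderiv (fun t => Cexp (s * RtoC t)) t (s * 1 * Cexp (s * RtoC t))%C).
  { intros s' t; exact (cderiv_Cexp_scal s' (fun t => t) t 1 (is_derive_id t)). }
  (* First integrals: (g' + s' g) exp (- s' t) is constant for both square roots s' of c, and the
     two values determine g after division by 2 s. *)
  assert (K : forall s', (s' * s')%C = RtoC c -> forall t,
    ((RtoC (g1' t) + s' * RtoC (g t)) * Cexp (- s' * RtoC t))%C
    = (RtoC (g1' 0) + s' * RtoC (g 0))%C).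
  { intros s' Es t.
    transitivity ((RtoC (g1' 0) + s' * RtoC (g 0)) * Cexp (- s' * RtoC 0))%C.
    - apply (cderiv_zero_const (fun t => (RtoC (g1' t) + s' * RtoC (g t)) * Cexp (- s' * RtoC t))%C
        (fun _ => True)); trivial.
      intros x _; eapply cderiv_eq.
      + apply cderiv_mult; [apply cderiv_plus|apply D].
        * apply cderiv_RtoC, Hg1.
        * apply cderiv_scal, cderiv_RtoC, Hg.
      + cbv beta; rewrite RtoC_mult, <- Es; ring.
    - rewrite Cmult_0_r, Cexp_0; ring. }
  exists ((RtoC (g1' 0) + s * RtoC (g 0)) / (2 * s))%C,
    (- ((RtoC (g1' 0) + - s * RtoC (g 0)) / (2 * s)))%C; intro t.
  assert (H2 : RtoC 2 <> 0) by (apply RtoC_neq_0; lra).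
  rewrite <- (K s Hs2 t), <- (K (- s)%C ltac:(rewrite <- Hs2; ring) t).
  replace (- - s * RtoC t)%C with (s * RtoC t)%C by ring.
  assert (E := Cexp_opp_r (s * RtoC t)).
  replace (- (s * RtoC t))%C with (- s * RtoC t)%C in E by ring.
  set (e := Cexp (s * RtoC t)) in *; set (e' := Cexp (- s * RtoC t)) in *.
  transitivity ((e * e') * RtoC (g t))%C; [rewrite E; ring|field; trivial].
Qed.

Lemma radial_span_bessel (m lam : R) (F F1 : R -> C) :
  m <> 0 -> lam <> 0 -> radial m lam F F1 ->
  exists a b : C, forall r, 0 < r ->
    F r = (a * BY (csqrt (- m)) (csqrt lam * RtoC r)
           + b * BJ (csqrt (- m)) (csqrt lam * RtoC r))%C.
Proof.
  intros Hm Hl HF; set (nu := csqrt (- m)).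
  destruct (BY_solution m lam (csqrt lam)) as (Y & Y' & HY & EY & HW);
    [now apply csqrt_neq_0|apply csqrt_sq|]; fold nu in EY, HW.
  assert (HJ : radial m lam (bessel_solution lam nu) (frob lam nu (theta nu (bcoef nu)))).
  { apply bessel_solution_radial, csqrt_sq. }
  destruct (radial_span m lam _ _ _ _ F F1 HJ HY HF (HW Hm)) as (a & b & E).
  set (kap := Cexp (nu * Clog (csqrt lam / 2))); assert (Hk : kap <> 0) by apply Cexp_neq_0.
  exists b, (a / kap)%C; intros r Hr.
  rewrite E, EY, (BJ_eq lam) by (trivial; now apply csqrt_neq_0 || apply csqrt_sq).
  fold kap; field; trivial.
Qed.

Lemma is_derive_Rscal_eq (f g : R -> R) (a x l l' : R) :
  locally x (fun t => g t = a * f t) -> l' = a * l -> is_derive f x l -> is_derive g x l'.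
Proof.
  intros E -> H; apply (is_derive_ext_loc (fun t => a * f t)).
  - revert E; apply filter_imp; intros t Et; now rewrite Et.
  - now apply is_derive_scal.
Qed.

(** The factors are arbitrary functions, so they are replaced by slices of [b] through a point where
    it does not vanish. The exclusions concern constants where the display degenerates: two
    exponentials coincide when s2 or s3 is 0, and the Bessel argument is 0 when s3 + k^2 = 0. *)
Lemma separated_solutions (k : R) (b : R -> R -> R -> R) (f g h : R -> R) :
  helmholtz_solution k b ->
  (forall r t z, 0 < r -> b r t z = f r * g t * h z) ->
  exists s2 s3 : R,
    (forall p, dom p ->
       pds [dx ith; dx ith] (lift3 b) p = s2 * lift3 b p /\
       pds [dx iz; dx iz] (lift3 b) p = s3 * lift3 b p) /\
    (s2 <> 0 -> s3 <> 0 -> s3 + k ^ 2 <> 0 ->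
     exists d : nat -> C, forall r t z, 0 < r ->
       RtoC (b r t z) = eta_bessel k s2 s3 d r t z).
Proof.
  intros [Hs Hp] Hb.
  destruct (classic (exists r t z, 0 < r /\ b r t z <> 0)) as [(r0 & t0 & z0 & Hr0 & Hb0)|Z].
  (* For the zero solution both constants are taken 0, which makes the last claim vacuous. *)
  2: { exists 0, 0; split; [|intro N; now elim N].
       assert (E : forall q, dom q -> lift3 b q = 0).
       { intros [[[r t] z] u] Hq; apply NNPP; intro N; apply Z; now exists r, t, z. }
       intros p Hdp; rewrite !(pds_ext _ _ _ E p Hdp); simpl.
       split; (rewrite pd_of_zero; [ring| |trivial]); intros; apply pd_const. }
  set (b0 := b r0 t0 z0) in *.
  set (B := lift3 b) in *.
  set (F := fun r => b r t0 z0); set (G := fun t => b r0 t z0); set (H := fun z => b r0 t0 z).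
  set (F1 := fun r => pd dr B (r, t0, z0, 0)); set (F2 := fun r => pd dr (pd dr B) (r, t0, z0, 0)).
  set (G1 := fun t => pd dt B (r0, t, z0, 0)); set (G2 := fun t => pd dt (pd dt B) (r0, t, z0, 0)).
  set (H1 := fun z => pd dz B (r0, t0, z, 0)); set (H2 := fun z => pd dz (pd dz B) (r0, t0, z, 0)).
  assert (DF : forall r, 0 < r -> is_derive F r (F1 r)).
  { intros r Hr; exact (Derive_correct _ _ (smooth_pdiff B (r, t0, z0, 0) Hs Hr dr)). }
  assert (DF1 : forall r, 0 < r -> is_derive F1 r (F2 r)).
  { intros r Hr.
    exact (Derive_correct _ _ (smooth_pdiff _ (r, t0, z0, 0) (smooth_pd B dr Hs) Hr dr)). }
  assert (DG : forall t, is_derive G t (G1 t)).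
  { intro t; exact (Derive_correct _ _ (smooth_pdiff B (r0, t, z0, 0) Hs Hr0 dt)). }
  assert (DG1 : forall t, is_derive G1 t (G2 t)).
  { intro t; exact (Derive_correct _ _ (smooth_pdiff _ (r0, t, z0, 0) (smooth_pd B dt Hs) Hr0 dt)). }
  assert (DH : forall z, is_derive H z (H1 z)).
  { intro z; exact (Derive_correct _ _ (smooth_pdiff B (r0, t0, z, 0) Hs Hr0 dz)). }
  assert (DH1 : forall z, is_derive H1 z (H2 z)).
  { intro z; exact (Derive_correct _ _ (smooth_pdiff _ (r0, t0, z, 0) (smooth_pd B dz Hs) Hr0 dz)). }
  (* The product of the three slices contains the value at the base point twice too often. *)
  assert (Eb : forall r t z, 0 < r -> b r t z = F r * G t * H z / b0 ^ 2).
  { intros r t z Hr; unfold F, G, H; unfold b0 in *; rewrite !Hb in * by trivial.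
    field; repeat split; intro Q; apply Hb0; rewrite Q; ring. }
  assert (Lt : forall q, dom q -> let '(r, t, z, _) := q in
    pd dt (pd dt B) q = F r * G2 t * H z / b0 ^ 2).
  { intros [[[r t] z] u] Hq; unfold dom in Hq; cbn [get] in Hq.
    rewrite (pd_ext dt (pd dt B) (fun q => let '(r, t, z, _) := q in F r * G1 t * H z / b0 ^ 2)); trivial.
    - apply is_derive_unique; cbn [get upd].
      apply (is_derive_Rscal_eq G1 _ (F r * H z / b0 ^ 2) _ (G2 t)); trivial;
        [apply filter_forall; intro|]; unfold Rdiv; ring.
    - intros [[[r' t'] z'] u'] Hq'; unfold dom in Hq'; cbn [get] in Hq'.
      apply is_derive_unique; cbn [get upd].
      apply (is_derive_Rscal_eq G _ (F r' * H z' / b0 ^ 2) _ (G1 t')); trivial;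
        [apply filter_forall; intro; unfold B; cbn [lift3]; rewrite Eb by trivial|];
        unfold Rdiv; ring. }
  assert (Lz : forall q, dom q -> let '(r, t, z, _) := q in
    pd dz (pd dz B) q = F r * G t * H2 z / b0 ^ 2).
  { intros [[[r t] z] u] Hq; unfold dom in Hq; cbn [get] in Hq.
    rewrite (pd_ext dz (pd dz B) (fun q => let '(r, t, z, _) := q in F r * G t * H1 z / b0 ^ 2)); trivial.
    - apply is_derive_unique; cbn [get upd].
      apply (is_derive_Rscal_eq H1 _ (F r * G t / b0 ^ 2) _ (H2 z)); trivial;
        [apply filter_forall; intro|]; unfold Rdiv; ring.
    - intros [[[r' t'] z'] u'] Hq'; unfold dom in Hq'; cbn [get] in Hq'.
      apply is_derive_unique; cbn [get upd].
      apply (is_derive_Rscal_eq H _ (F r' * G t' / b0 ^ 2) _ (H1 z')); trivial;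
        [apply filter_forall; intro; unfold B; cbn [lift3]; rewrite Eb by trivial|];
        unfold Rdiv; ring. }
  assert (Lr : forall r t z u, 0 < r -> pd dr B (r, t, z, u) = F1 r * G t * H z / b0 ^ 2).
  { intros r t z u Hr; apply is_derive_unique; cbn [get upd].
    apply (is_derive_Rscal_eq F _ (G t * H z / b0 ^ 2) _ (F1 r)); auto;
      [|unfold Rdiv; ring].
    generalize (open_gt 0 r Hr); apply filter_imp; intros s Hs0.
    unfold B; cbn [lift3]; rewrite Eb by trivial; unfold Rdiv; ring. }
  assert (Lrr : forall r t z u, 0 < r -> pd dr (pd dr B) (r, t, z, u) = F2 r * G t * H z / b0 ^ 2).
  { intros r t z u Hr.
    rewrite (pd_ext dr (pd dr B) (fun q => let '(r, t, z, _) := q in F1 r * G t * H z / b0 ^ 2)); trivial.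
    - apply is_derive_unique; cbn [get upd].
      apply (is_derive_Rscal_eq F1 _ (G t * H z / b0 ^ 2) _ (F2 r)); auto;
        [apply filter_forall; intro|]; unfold Rdiv; ring.
    - intros [[[r' t'] z'] u'] Hq'; now apply Lr. }
  assert (PDE : forall r t z, 0 < r ->
    (F2 r + F1 r / r + k ^ 2 * F r) * G t * H z + F r * G2 t * H z / r ^ 2 + F r * G t * H2 z = 0).
  { intros r t z Hr; specialize (Hp (r, t, z, 0) Hr); cbn [pds get] in Hp.
    fold B in Hp; rewrite Lrr, Lr, (Lt (r, t, z, 0) Hr), (Lz (r, t, z, 0) Hr) in Hp by trivial.
    replace (B (r, t, z, 0)) with (F r * G t * H z / b0 ^ 2) in Hp
      by (unfold B; cbn [lift3]; now rewrite Eb).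
    apply (Rmult_eq_reg_r (/ b0 ^ 2)); [|now apply Rinv_neq_0_compat, pow_nonzero].
    rewrite Rmult_0_l, <- Hp; field; split; lra. }
  assert (F0 : F r0 = b0) by reflexivity; assert (G0 : G t0 = b0) by reflexivity;
    assert (H0 : H z0 = b0) by reflexivity.
  (* The separation constants are read off from the equation with two of the variables fixed at the
     base point. *)
  set (K := F2 r0 + F1 r0 / r0 + k ^ 2 * b0).
  set (s3 := - (K / b0 + G2 t0 / (b0 * r0 ^ 2))).
  set (s2 := - r0 ^ 2 * (K / b0 + H2 z0 / b0)).
  assert (Eh : forall z, H2 z = s3 * H z).
  { intro z; pose proof (PDE r0 t0 z Hr0) as Q; rewrite F0, G0 in Q; fold K in Q.
    apply (Rmult_eq_reg_l (b0 * b0)); [|now apply Rmult_integral_contrapositive_currified].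
    replace (b0 * b0 * H2 z) with (0 - (K * b0 * H z + b0 * G2 t0 * H z / r0 ^ 2)) by (rewrite <- Q; ring).
    unfold s3; field; split; lra. }
  assert (Eg : forall t, G2 t = s2 * G t).
  { intro t; pose proof (PDE r0 t z0 Hr0) as Q; rewrite F0, H0 in Q; fold K in Q.
    apply (Rmult_eq_reg_l (b0 * b0 / r0 ^ 2)).
    2: { apply Rmult_integral_contrapositive_currified;
         [now apply Rmult_integral_contrapositive_currified|].
         apply Rinv_neq_0_compat, pow_nonzero; lra. }
    replace (b0 * b0 / r0 ^ 2 * G2 t) with (0 - (K * G t * b0 + b0 * G t * H2 z0))
      by (rewrite <- Q; field; lra).
    unfold s2; field; split; lra. }
  exists s2, s3; split.
  - intros [[[r t] z] u] Hq; cbn [pds]; fold B.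
    rewrite (Lt _ Hq), (Lz _ Hq), Eg, Eh; unfold B; cbn [lift3].
    rewrite Eb by exact Hq; split; unfold Rdiv; ring.
  - intros N2 N3 Nl.
    assert (HR : radial s2 (s3 + k ^ 2) (fun r => RtoC (F r)) (fun r => RtoC (r * F1 r))).
    { intros r Hr; split.
      - eapply cderiv_eq; [apply cderiv_RtoC, DF, Hr|].
        rewrite <- RtoC_mult; f_equal; field; lra.
      - eapply cderiv_eq.
        + apply cderiv_RtoC, is_derive_Rmult; [apply @is_derive_id|apply DF1, Hr].
        + rewrite <- RtoC_mult, <- RtoC_opp, <- RtoC_mult; f_equal.
          change one with 1.
          pose proof (PDE r t0 z0 Hr) as Q; rewrite Eg, Eh, G0, H0 in Q.
          apply (Rmult_eq_reg_l (b0 * b0)); [|now apply Rmult_integral_contrapositive_currified].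
          apply (Rmult_eq_reg_l (/ r)); [|apply Rinv_neq_0_compat; lra].
          apply Rminus_diag_uniq; rewrite <- Q; field; lra. }
    destruct (radial_span_bessel s2 (s3 + k ^ 2) _ _ N2 Nl HR) as (a1 & a2 & EF).
    destruct (exponentials_span s2 G G1 N2 DG) as (a3 & a4 & EG).
    { intro t; rewrite <- Eg; apply DG1. }
    destruct (exponentials_span s3 H H1 N3 DH) as (a5 & a6 & EH).
    { intro z; rewrite <- Eh; apply DH1. }
    (* The normalization by b0^2 goes into the two Bessel coefficients. *)
    exists (fun n => match n with
      7%nat => a3 | 8%nat => a4 | 9%nat => a5 | 10%nat => a6
      | 11%nat => (RtoC (/ b0 ^ 2) * a1)%C | _ => (RtoC (/ b0 ^ 2) * a2)%C end).
    intros r t z Hr; rewrite eta_bessel_factor, Eb by trivial; cbv iota.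
    rewrite <- EG, <- EH.
    replace (F r * G t * H z / b0 ^ 2) with (/ b0 ^ 2 * F r * (G t * H z)) by (unfold Rdiv; ring).
    rewrite !RtoC_mult, EF by trivial; ring.
Qed.

Theorem theorem1 (k : R) (hk : k <> 0) :
  (* every displayed vector field is an infinitesimal symmetry *)
  (forall (c : nat -> R) (d : nat -> C) (v : vfield),
     bessel_defined k (c 2%nat) (c 3%nat) d ->
     displayed_field k c d v -> inf_symmetry k v)
  /\
  (* completeness, the superposition part of eta being any solution *)
  (forall v : vfield,
     inf_symmetry k v <->
     exists (c : nat -> R) (b : R -> R -> R -> R),
       helmholtz_solution k b /\ superposed_field c b v)
  /\
  (* the separated solutions are the displayed ones, with the separation
     constants s2, s3 in the place of c2, c3 *)
  (forall (b : R -> R -> R -> R) (f g h : R -> R),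
     helmholtz_solution k b ->
     (forall r t z, 0 < r -> b r t z = f r * g t * h z) ->
     exists s2 s3 : R,
       (forall p, dom p ->
          pds [dx ith; dx ith] (lift3 b) p = s2 * lift3 b p /\
          pds [dx iz; dx iz] (lift3 b) p = s3 * lift3 b p) /\
       (s2 <> 0 -> s3 <> 0 -> s3 + k ^ 2 <> 0 ->
        exists d : nat -> C, forall r t z, 0 < r ->
          RtoC (b r t z) = eta_bessel k s2 s3 d r t z))
  /\
  (* g is a Lie algebra of symmetries with basis X 1, ..., X 7 *)
  (forall v : vfield, in_g v -> inf_symmetry k v)
  /\
  (forall v w : vfield, in_g v -> in_g w ->
     exists x : vfield, in_g x /\ is_commutator v w x)
  /\
  (forall v : vfield, in_g v <-> exists a : nat -> R, vf_eq v (lincomb a))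
  /\
  (forall a : nat -> R, vf_eq (lincomb a) vzero ->
     forall n : nat, (1 <= n <= 7)%nat -> a n = 0)
  /\
  (forall m n : nat, (1 <= m)%nat -> (m < n)%nat -> (n <= 7)%nat ->
     is_commutator (X m) (X n) (bracket_table m n)).
Proof.
  split; [exact (displayed_symmetry k)|].
  split.
  { intro v; split; [now apply symmetry_superposed|].
    intros (c & b & Hb & Hv); exact (superposed_symmetry k v c b Hb Hv). }
  split; [exact (separated_solutions k)|].
  split; [exact (in_g_symmetry k)|].
  split; [exact in_g_commutator|].
  split; [exact in_g_lincomb|].
  split; [exact lincomb_independent|exact basis_commutators].
Qed.
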